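(* For $n=3,4,5$, every convex $n$-gon in the plane $\mathbb{R}^2$ possesses a realizable copy. For $n=6$ this is not true: there is a convex hexagon in $\mathbb{R}^2$ that does not have a realizable copy.
   Context: A linear switching system in $\mathbb{R}^2$ is identified with its control set $\mathcal{A}$, a nonempty compact set of real $2\times 2$ matrices. A trajectory is an absolutely continuous function $x:[0,\infty)\to\mathbb{R}^2$ such that $\dot x(t)=A(t)x(t)$ for almost every $t$, for some measurable function $A(\cdot):[0,\infty)\to\mathcal{A}$. The Lyapunov exponent $\sigma(\mathcal{A})$ is the infimum of all $\beta\in\mathbb{R}$ such that every trajectory satisfies $\|x(t)\|\le C e^{\beta t}$ for all $t\ge0$ with a constant $C$ depending on the trajectory. Standing assumption: $\mathcal{A}$ is convex and the corresponding normalized system $\mathcal{A}-\sigma(\mathcal{A})I=\{A-\sigma(\mathcal A)I: A\in\mathcal{A}\}$ does not contain the zero matrix, i.e. $\sigma(\mathcal{A})I\notin\mathcal{A}$. For a compact set $M\subset\mathbb{R}^2$ and $t\ge 0$, $M_t$ denotes the set of points $x(t)$ over all trajectories with $x(0)\in M$. An eigenset of $\mathcal{A}$ is a compact set $M\ne\emptyset$, $M\neq\{0\}$, for which there is $\alpha\in\mathbb{R}$ with $M_t=e^{\alpha t}M$ for all $t\ge0$. The system is irreducible if the matrices of $\mathcal{A}$ have no common invariant linear subspace other than $\{0\}$ and $\mathbb{R}^2$. A compact set $M\subset\mathbb{R}^2$ is realizable if there exists an irreducible linear switching system $\mathcal{A}$ for which $M$ is an eigenset. A compact set $M$ has a realizable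 copy if there is a realizable set $M'$ isometric to $M$ (equivalently, some translate of $M$ is realizable). A convex $n$-gon is a solid convex polygon with exactly $n$ vertices. *)

(* Defs.v *)
From mathcomp Require Export all_boot all_order all_algebra.
From mathcomp Require Export all_classical all_reals all_analysis.

Set Implicit Arguments.
Unset Strict Implicit.
Unset Printing Implicit Defensive.

Export Order.TTheory GRing.Theory Num.Theory.
Export numFieldNormedType.Exports.

Local Open Scope classical_set_scope.
Local Open Scope ring_scope.

(* The library norm on matrices is the sup norm; distances in the plane are
   Euclidean. *)
Definition enorm (R : realType) (v : 'cV[R]_2) : R :=
  Num.sqrt (\sum_i v i 0 ^+ 2).

Definition abs_continuous_on (R : realType) (T : R) (x : R -> 'cV[R]_2) :=
  forall e : R, 0 < e -> exists2 d : R, 0 < d &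
    forall (n : nat) (a b : 'I_n -> R),
      (forall i, [/\ 0 <= a i, a i <= b i & b i <= T]) ->
      trivIset setT (fun i => [set` `]a i, b i[]) ->
      \sum_i (b i - a i) < d ->
      \sum_i enorm (x (b i) - x (a i)) < e.

(* A function on [0, +oo[ is represented by a total function on R whose values
   at negative times are irrelevant. Absolute continuity on [0, +oo[ means
   absolute continuity on each [0, T], as usual for solutions of ODEs.
   Measurability is Borel, entry by entry; allowing Lebesgue measurable control
   functions gives the same trajectories when S is a nonempty compact set. *)
Definition trajectory (R : realType) (S : set 'M[R]_2) (x : R -> 'cV[R]_2) :=
  (forall T : R, abs_continuous_on T x) /\
  exists A : R -> 'M[R]_2,
    [/\ forall t : R, 0 <= t -> S (A t),
        forall i j, measurable_fun (`[0, +oo[%classic : set R) (fun t => A t i j) &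
        {ae lebesgue_measure, forall t : R, 0 <= t ->
          is_derive t 1 x (A t *m x t)}].

(* For nonempty compact S the set below is nonempty and bounded below, so that
   inf is the true infimum. *)
Definition lyapunov_exponent (R : realType) (S : set 'M[R]_2) : R :=
  inf [set beta : R | forall x, trajectory S x ->
    exists C : R, forall t : R, 0 <= t -> enorm (x t) <= C * expR (beta * t)].

Definition linear_switching_system (R : realType) (S : set 'M[R]_2) :=
  [/\ S !=set0, compact S, convex_set S & ~ S (lyapunov_exponent S)%:M].

Definition irreducible_system (R : realType) (S : set 'M[R]_2) :=
  forall V : {vspace 'cV[R]_2},
    (forall A, S A -> forall v, v \in V -> A *m v \in V) ->
    V = 0%VS \/ V = fullv.

Definition reachable_set (R : realType) (S : set 'M[R]_2) (M : set 'cV[R]_2)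
    (t : R) : set 'cV[R]_2 :=
  [set v | exists x, [/\ trajectory S x, M (x 0) & v = x t]].

Definition eigenset (R : realType) (S : set 'M[R]_2) (M : set 'cV[R]_2) :=
  [/\ compact M, M !=set0, M <> [set 0] &
    exists alpha : R, forall t : R, 0 <= t ->
      reachable_set S M t = [set expR (alpha * t) *: v | v in M]].

Definition realizable (R : realType) (M : set 'cV[R]_2) :=
  exists S : set 'M[R]_2,
    [/\ linear_switching_system S, irreducible_system S & eigenset S M].

(* Isometry of M and N as metric subspaces of the Euclidean plane. *)
Definition isometric (R : realType) (M N : set 'cV[R]_2) :=
  exists f : 'cV[R]_2 -> 'cV[R]_2,
    [set f v | v in M] = N /\
    forall u v, M u -> M v -> enorm (f u - f v) = enorm (u - v).

Definition has_realizable_copy (R : realType) (M : set 'cV[R]_2) :=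
  exists2 M' : set 'cV[R]_2, isometric M M' & realizable M'.

Definition convex_hull (R : realType) (E : set 'cV[R]_2) : set 'cV[R]_2 :=
  smallest (fun C : set 'cV[R]_2 => convex_set C) E.

(* The points p i are the vertices: none lies in the convex hull of the
   others; in particular they are distinct. *)
Definition convex_ngon (R : realType) (n : nat) (P : set 'cV[R]_2) :=
  exists p : 'I_n -> 'cV[R]_2,
    [/\ P = convex_hull (range p),
        forall i, ~ convex_hull [set p j | j in [set j | j != i]] (p i) &
        interior P !=set0].

(* Main.v *)
(* Subtracting the Lyapunov exponent, one may ask for an eigenset [M] with
   exponent 0: trajectories stay in [M] and reach every point of it.

   For n <= 5, put the origin at the centroid of the triangle, at the crossing of
   the diagonals of the quadrilateral, and, for a pentagon, either at the crossing
   of two diagonals or at a vertex, depending on which of the five triangles cut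
   off by its diagonals are small. Then every edge is swept by a matrix of rank one
   whose image is parallel to the edge and whose flow preserves the polygon, while
   each end of the edge is an equilibrium of some matrix; so a trajectory can wait
   at a vertex and then slide to any point of the edge. The system of all [A] with
   [(1 + A) M] in [M], with bounded norm and trace at most [-tau < 0], is compact,
   convex and omits 0, and [M] is invariant under it by Nagumo's theorem.

   In an eigenset with exponent 0, conversely, a point of an edge can only be
   reached if some nonzero matrix of the system has zero velocity across that edge
   there. For a triangle with twisted truncated corners this forces the origin into
   a thin double cone over each of the three short edges, with apex at the opposite
   vertex, and the three cones have no common point. *)

Require Import Defs.
From mathcomp Require Import measurable_realfun interval_inference ring lra.

Set Implicit Arguments.
Unset Strict Implicit.
Unset Printing Implicit Defensive.

Local Open Scope classical_set_scope.
Local Open Scope ring_scope.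

(** The zero matrix is forbidden, so a trajectory can pause only where some matrix of the system
    annihilates its position; yet every point has to be reached at every prescribed time, however
    late. Convexity adds that averages of such matrices must not bring 0 back. A negative upper
    bound on the trace is linear in the matrix and compatible with a kernel, so it meets both
    demands. Interior points come with the boundary: when the origin belongs to the polygon, each
    point lies on a multiple of some edge, and a linear flow sweeps all multiples of an edge alike.
    What constrains the choice of the origin is that the sweep of one edge must push the remaining
    vertices inwards; this turns into comparisons of triangle areas. One analytic tool serves both
    directions: an absolutely continuous function whose upper right slope is nonpositive almost
    everywhere is nonincreasing. For a weighted distance it gives invariance; for a linear
    functional it shows that a point where all velocities point strictly inwards is not reached.
    Since an isometry may rotate or reflect, the hexagon is studied in an arbitrary affine frame. *)

Definition ac_fun (R : realType) (T : R) (g : R -> R) :=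
  forall e : R, 0 < e -> exists2 d : R, 0 < d &
    forall (n : nat) (a b : 'I_n -> R),
      (forall i, [/\ 0 <= a i, a i <= b i & b i <= T]) ->
      trivIset setT (fun i => [set` `]a i, b i[]) ->
      \sum_i (b i - a i) < d ->
      \sum_i `|g (b i) - g (a i)| < e.

(** Intervals are listed from right to left, so that growth to the right is a [cons]. The last bound
    is only an upper bound for them, which lets a chain be carried to a later time without a new
    interval. *)
Inductive chain (R : realType) (U : set R) (a : R) : R -> seq (R * R) -> Prop :=
| chain_nil t : a <= t -> @chain R U a t [::]
| chain_cons t s u v w : @chain R U a t s -> t <= u -> u <= v -> v <= w ->
    `[u, v] `<=` U -> @chain R U a w ((u, v) :: s).

(** * Finite chains of nonoverlapping intervals inside an open set *)

Section Chain.
Context (R : realType) (U : set R) (a : R).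
Implicit Types (t : R) (s : seq (R * R)).

Lemma chain_le t t' s : chain U a t s -> t <= t' -> chain U a t' s.
Proof.
case=> [{}t at_ tt'|{}t {}s u v w c tu uv vw uvU wt'].
  by apply: chain_nil; exact: le_trans tt'.
by apply: chain_cons c tu uv _ uvU; exact: le_trans wt'.
Qed.

Lemma chain_start t s : chain U a t s -> a <= t.
Proof.
by elim=> // {}t {}s u v w _ at_ tu uv vw _; lra.
Qed.

Lemma chain_mem t s : chain U a t s ->
  forall p, p \in s -> [/\ a <= p.1, p.1 <= p.2 & p.2 <= t].
Proof.
elim=> [//|{}t {}s u v w c IH tu uv vw _ p].
have at_ := chain_start c.
rewrite inE => /orP[/eqP ->|/IH[ap pp pt]] /=; split; lra.
Qed.

Lemma chain_disjoint t s : chain U a t s ->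
  forall i j, (i < j < size s)%N -> (nth (0, 0) s j).2 <= (nth (0, 0) s i).1.
Proof.
elim=> [_ _ i j|{}t {}s u v w c IH tu uv vw _ i [|j]]; rewrite ?andbF //.
case: i => [|i] /= ij; last exact: IH.
by have [_ _ h] := chain_mem c (mem_nth (0, 0) ij); lra.
Qed.

(** Cutting [U] off at [t] makes the induction work: the next interval lies in [U] to the right of
    [t], so its length is added to the measure of a disjoint set. *)
Lemma chain_measure t s : open U -> chain U a t s ->
  ((\sum_(p <- s) (p.2 - p.1))%:E <=
     lebesgue_measure (U `&` `]-oo, t[%classic : set R))%E.
Proof.
move=> oU; elim=> [{}t _|{}t {}s u v w c IH tu uv vw uvU].
  by rewrite big_nil.
have mU (z : itv_bound R) (z' : itv_bound R) :
    measurable (U `&` [set` Interval z z']).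
  by apply: measurableI => //; exact: open_measurable.
rewrite big_cons addrC EFinD /=.
have -> : (v - u)%:E = lebesgue_measure (`]u, v[%classic : set R).
  by rewrite lebesgue_measure_itv /= lte_fin; case: ltP => // vu;
    rewrite -[0%E]/(0%:E); congr (_%:E); lra.
apply: (@le_trans _ _ (lebesgue_measure (U `&` `]-oo, t[%classic : set R) +
  lebesgue_measure (`]u, v[%classic : set R)))%E; first exact: leeD2r.
rewrite -measureU.
- apply: le_measure; rewrite ?inE; [by apply: measurableU; [exact: mU|exact: measurable_itv]|exact: mU|].
  move=> z [[Uz]|]; rewrite /= !in_itv /= => h.
    by split=> //=; lra.
  by split; [apply: uvU; rewrite /= in_itv /=; lra | rewrite /=; lra].
- exact: mU.
- exact: measurable_itv.
- by rewrite -subset0 => z /= [[_]]; rewrite !in_itv /=; lra.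
Qed.

End Chain.

(** * Monotonicity from an almost everywhere bound on the upper right slope *)

Section Dini.
Context (R : realType).

Lemma ac_fun_unif (T : R) (g : R -> R) (e : R) : ac_fun T g -> 0 < e ->
  exists2 d, 0 < d & forall s t, 0 <= s -> s <= t -> t <= T -> t - s < d ->
    `|g t - g s| < e.
Proof.
move=> acg /acg[d d0 H]; exists d => // s t s0 st tT std.
have := H 1%N (fun=> s) (fun=> t); rewrite !big_ord1; apply => //.
by move=> i j _ _ _; rewrite (ord1 i) (ord1 j).
Qed.

(** The total length of a chain in [U] is at most the measure of [U], so absolute continuity bounds
    its increments uniformly over all chains. *)
Lemma ac_chain (T a : R) (g : R -> R) (e : R) : ac_fun T g -> 0 <= a -> 0 < e ->
  exists2 d, 0 < d & forall U s, open U ->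
    (lebesgue_measure U < d%:E)%E -> chain U a T s ->
    \sum_(p <- s) (g p.2 - g p.1) < e.
Proof.
move=> acg a0 /acg[d d0 H]; exists d => // U s oU mUd cs.
have sd : \sum_(p <- s) (p.2 - p.1) < d.
  rewrite -lte_fin; apply: le_lt_trans mUd.
  apply: le_trans (chain_measure oU cs) _.
  rewrite le_measure ?inE //; first by apply: measurableI => //; exact: open_measurable.
  exact: open_measurable.
apply: (@le_lt_trans _ _ (\sum_(p <- s) `|g p.2 - g p.1|)).
  by apply: ler_sum => p _; exact: ler_norm.
have := H (size s) (fun i => (nth (0, 0) s i).1) (fun i => (nth (0, 0) s i).2).
rewrite (big_nth (0, 0)) big_mkord; apply.
- move=> i; have [h1 h2 h3] := chain_mem cs (mem_nth (0, 0) (ltn_ord i)); split => //.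
  lra.
- move=> i j _ _ [z []] /=; rewrite !in_itv /= => zi zj.
  have dj := chain_disjoint cs.
  apply/val_inj; case: (ltngtP (val i) (val j)) => // ij; exfalso.
    by have := dj i j; rewrite ij ltn_ord => /(_ isT); clear ij; lra.
  by have := dj j i; rewrite ij ltn_ord => /(_ isT); clear ij; lra.
- by move: sd; rewrite (big_nth (0, 0)) big_mkord.
Qed.

Lemma ac_dini_eps (T a : R) (g : R -> R) (e : R) : ac_fun T g -> 0 <= a -> a <= T ->
  {ae lebesgue_measure, forall t : R, a <= t -> t < T ->
     forall e, 0 < e -> exists2 d, 0 < d &
       forall h, 0 < h -> h < d -> g (t + h) <= g t + e * h} ->
  0 < e -> g T <= g a + e * (T - a) + e + e.
Proof.
move=> acg a0 aT [B [mB B0 subB]] e0.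
(* The exceptional set lies in an open [U] of small measure: outside [U] the slope
   is at most [e], and absolute continuity bounds the growth inside [U] by [e]. *)
have [d d0 Hd] := ac_chain acg a0 e0.
have muB : lebesgue_measure B = 0%E := B0.
have [|U [oU BU mU]] := @lebesgue_regularity_outer R B d mB _ d0.
  have leB : (lebesgue_measure B <= 0%:E)%E by rewrite muB.
  by apply: le_lt_trans (ltry 0); exact: leB.
have {}mU : (lebesgue_measure U < d%:E)%E.
  apply: le_lt_trans mU.
  have mUo : measurable U by exact: open_measurable.
  have mUB : measurable (U `\` B) by exact: measurableD.
  have : (lebesgue_measure U <= lebesgue_measure (U `\` B) + lebesgue_measure B)%E.
    rewrite -measureU //; last by rewrite setIC setDIK.
    apply: le_measure; rewrite ?inE //; first by apply: measurableU.
    by move=> z Uz; have [Bz|Bz] := pselect (B z); [right|left].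
  by rewrite muB adde0.
(* Continuity method on the times satisfying [G]. The slack [eta] lets [G] pass to the supremum [s],
   where the chain of a nearby earlier time is reused. If [s < T], a point [s] of [U] contributes a
   new interval to the chain, and a point outside [U] is passed with slope [e]. *)
pose G t := forall eta, 0 < eta -> exists2 s, chain U a t s &
  g t <= g a + e * (t - a) + \sum_(p <- s) (g p.2 - g p.1) + eta.
suff : G T by move=> /(_ _ e0)[s cs]; have := Hd U s oU mU cs; lra.
pose S := [set t | a <= t <= T /\ G t].
have Sa : S a.
  split; first by rewrite lexx.
  by move=> eta eta0; exists [::]; [exact: chain_nil | rewrite big_nil; lra].
have hS : has_sup S.
  by split; [exists a | exists T => t [/andP[]]].
set s := sup S.
have as_ : a <= s by exact: ub_le_sup hS.2 _ Sa.
have sT : s <= T by apply: sup_le_ub => [|t [/andP[]] //]; exists a.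
have Gs : G s.
  move=> eta eta0; have eta20 : 0 < eta / 2 by lra.
  have [r r0 Hr] := ac_fun_unif acg eta20.
  have [t [/andP[at_ tT] Gt] st] := sup_adherent r0 hS.
  have ts : t <= s by apply: ub_le_sup hS.2 _ _; split => //; lra.
  have [f cf Hf] := Gt _ eta20.
  exists f; first exact: chain_le cf ts.
  have := Hr t s; rewrite -/s in st * => /(_ _ _ _ _)/ltr_normlP[]; [lra|lra|lra|lra|].
  have : e * (t - a) <= e * (s - a) by rewrite ler_pM2l //; lra.
  lra.
have [sT'|Ts] := ltP s T; last by have -> : T = s by apply/eqP; rewrite eq_le Ts sT.
suff [t st [tT Gt]] : exists2 t, s < t & t <= T /\ G t.
  have : t <= s by apply: ub_le_sup hS.2 _ _; split => //; lra.
  by lra.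
have [Us|nUs] := pselect (U s).
  have [r /= r0 Hr] := (@nbhs_ballP R _ _ _).1 (oU _ Us).
  pose t := Num.min T (s + r / 2).
  have tT : t <= T by rewrite /t ge_min lexx.
  have tr : t <= s + r / 2 by rewrite /t ge_min lexx orbT.
  have st : s < t by rewrite /t lt_min; apply/andP; split => //; lra.
  exists t => //; split=> // eta eta0; have [f cf Hf] := Gs _ eta0.
  exists ((s, t) :: f).
    apply: (chain_cons cf) => //; first exact: ltW.
    move=> z /=; rewrite in_itv /= => zst; apply: Hr.
    by rewrite /ball /= ltr_norml; lra.
  have : e * (s - a) <= e * (t - a) by rewrite ler_pM2l //; lra.
  by rewrite big_cons /=; lra.
have [r r0 Hr] : exists2 d, 0 < d & forall h, 0 < h -> h < d -> g (s + h) <= g s + e * h.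
  have := contra_not (@subB s) (contra_not (@BU s) nUs).
  by rewrite /= => /contrapT; apply.
pose h := Num.min (T - s) (r / 2).
have hT : h <= T - s by rewrite /h ge_min lexx.
have hr : h <= r / 2 by rewrite /h ge_min lexx orbT.
have h0 : 0 < h by rewrite /h lt_min; apply/andP; split => //; lra.
exists (s + h); [lra|split; [lra|]] => eta eta0; have [f cf Hf] := Gs _ eta0.
exists f; first by apply: (chain_le cf); lra.
have := Hr h h0; have -> : e * (s + h - a) = e * (s - a) + e * h by ring.
by move=> /(_ _); lra.
Qed.

Lemma ac_dini (T a : R) (g : R -> R) : ac_fun T g -> 0 <= a -> a <= T ->
  {ae lebesgue_measure, forall t : R, a <= t -> t < T ->
     forall e, 0 < e -> exists2 d, 0 < d &
       forall h, 0 < h -> h < d -> g (t + h) <= g t + e * h} ->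
  g T <= g a.
Proof.
move=> acg a0 aT H; apply/ler_addgt0Pr => e e0.
have K0 : 0 < T - a + 2 by lra.
have := ac_dini_eps acg a0 aT H (divr_gt0 e0 K0).
have -> : g a + e / (T - a + 2) * (T - a) + e / (T - a + 2) + e / (T - a + 2)
  = g a + e by field; lra.
by [].
Qed.

End Dini.

Lemma ae_sub (R : realType) (P Q : R -> Prop) : (forall t, P t -> Q t) ->
  {ae lebesgue_measure, forall t, P t} -> {ae lebesgue_measure, forall t, Q t}.
Proof.
by move=> PQ [B [mB B0 sub]]; exists B; split=> // t nQ; apply: sub => /PQ.
Qed.

(** * Stability of scalar absolute continuity; first-order expansions *)

Section AcAlgebra.
Context (R : realType).
Implicit Types (T : R) (f g : R -> R).

Lemma ac_dominated T f (G : R -> R -> R) :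
  (forall e, 0 < e -> exists2 d : R, 0 < d & forall n (a b : 'I_n -> R),
      (forall i, [/\ 0 <= a i, a i <= b i & b i <= T]) ->
      trivIset setT (fun i => [set` `]a i, b i[]) ->
      \sum_i (b i - a i) < d -> \sum_i G (a i) (b i) < e) ->
  (forall s t, 0 <= s -> s <= t -> t <= T -> `|f t - f s| <= G s t) ->
  ac_fun T f.
Proof.
move=> acG fG e e0; have [d d0 H] := acG e e0; exists d => // n a b ab tri abd.
apply: le_lt_trans (H n a b ab tri abd); apply: ler_sum => i _.
by have [? ? ?] := ab i; apply: fG.
Qed.

(** A single domination principle behind Lipschitz functions, sums, products, truncations and
    distances to a set. *)
Lemma ac_comb T f g (h : R -> R) (L : R) : 0 < L -> ac_fun T f -> ac_fun T g ->
  (forall s t, 0 <= s -> s <= t -> t <= T ->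
    `|h t - h s| <= L * (`|f t - f s| + `|g t - g s|)) ->
  ac_fun T h.
Proof.
move=> L0 acf acg; apply: ac_dominated => e e0.
have e20 : 0 < e / L / 2 by rewrite !divr_gt0.
have [d1 d10 H1] := acf _ e20; have [d2 d20 H2] := acg _ e20.
exists (Num.min d1 d2); first by rewrite lt_min d10.
move=> n a b ab tri; rewrite lt_min => /andP[/(H1 n a b ab tri) {}H1 /(H2 n a b ab tri) {}H2].
rewrite -mulr_sumr big_split /= mulrC -ltr_pdivlMr //.
by apply: lt_le_trans (ltrD H1 H2) _; lra.
Qed.

Lemma ac_id T : ac_fun T id.
Proof.
move=> e e0; exists e => // n a b ab _; apply: le_lt_trans; apply: ler_sum => i _.
by have [_ ? _] := ab i; rewrite ger0_norm // subr_ge0.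
Qed.

Lemma ac_lip T f (L : R) :
  (forall s t, 0 <= s -> s <= t -> t <= T -> `|f t - f s| <= L * (t - s)) ->
  ac_fun T f.
Proof.
move=> H; apply: (@ac_comb T id id f (`|L| + 1)); [|exact: ac_id|exact: ac_id|].
  by rewrite ltr_wpDl.
move=> s t s0 st tT; apply: le_trans (H s t s0 st tT) _.
have ts : 0 <= t - s by lra.
change (L * (t - s) <= (`|L| + 1) * (`|t - s| + `|t - s|)).
rewrite (ger0_norm ts) -[leLHS]addr0 [leRHS]mulrDr; apply: lerD.
  by apply: ler_wpM2r => //; have := ler_norm L; lra.
by rewrite mulr_ge0 // addr_ge0.
Qed.

Lemma ac_bounded T f : ac_fun T f ->
  exists2 C, 0 < C & forall t, 0 <= t -> t <= T -> `|f t| <= C.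
Proof.
move=> /ac_fun_unif/(_ ltr01)[d d0 H].
have d20 : 0 < d / 2 by lra.
(* Walk from 0 to [t] in steps of length at most [d / 2], each changing [f] by less than 1. *)
have step n : forall t, 0 <= t -> t <= T -> t <= n%:R * (d / 2) ->
    `|f t| <= `|f 0| + n%:R.
  elim: n => [|n IH] t t0 tT tn.
    have -> : t = 0 by move: tn; rewrite mul0r; lra.
    by rewrite addr0.
  have [tle|tgt] := leP t (d / 2).
    have := H 0 t; rewrite lexx => /(_ isT t0 tT) h.
    have {}h : `|f t - f 0| < 1 by apply: h; lra.
    have := ler_normD (f t - f 0) (f 0); rewrite subrK -natr1.
    have : 0 <= n%:R :> R by [].
    lra.
  have := H (t - d / 2) t => h.
  have {}h : `|f t - f (t - d / 2)| < 1 by apply: h; lra.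
  have : `|f (t - d / 2)| <= `|f 0| + n%:R.
    by apply: IH; [lra|lra|]; move: tn; rewrite -natr1 mulrDl mul1r; lra.
  have := ler_normD (f t - f (t - d / 2)) (f (t - d / 2)); rewrite subrK -natr1.
  lra.
pose n := Num.truncn (`|T| / (d / 2)).
exists (`|f 0| + n.+1%:R) => [|t t0 tT].
  by rewrite ltr_wpDl // ltr0n.
apply: step => //; rewrite -ler_pdivrMr //.
have : `|T| / (d / 2) < n.+1%:R by exact: truncnS_gt.
have : t / (d / 2) <= `|T| / (d / 2).
  by rewrite ler_pM2r ?invr_gt0 // (le_trans tT) // ler_norm.
lra.
Qed.

Lemma ac_mul T f g : ac_fun T f -> ac_fun T g -> ac_fun T (fun t => f t * g t).
Proof.
move=> acf acg; have [C C0 HC] := ac_bounded acf; have [D D0 HD] := ac_bounded acg.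
apply: (@ac_comb T f g _ (C + D)) => //; first by lra.
move=> s t s0 st tT.
have -> : f t * g t - f s * g s = f t * (g t - g s) + (f t - f s) * g s by ring.
apply: le_trans (ler_normD _ _) _; rewrite !normrM.
have h1 := HC t (le_trans s0 st) tT; have h2 := HD s s0 (le_trans st tT).
have h3 := normr_ge0 (g t - g s); have h4 := normr_ge0 (f t - f s).
have h5 : `|f t| * `|g t - g s| <= C * `|g t - g s| by apply: ler_wpM2r.
have h6 : `|f t - f s| * `|g s| <= `|f t - f s| * D by apply: ler_wpM2l.
have h7 : 0 <= D * `|g t - g s| by apply: mulr_ge0 => //; lra.
have h8 : 0 <= C * `|f t - f s| by apply: mulr_ge0 => //; lra.
lra.
Qed.

Lemma ac_add T f g : ac_fun T f -> ac_fun T g -> ac_fun T (fun t => f t + g t).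
Proof.
move=> acf acg; apply: (@ac_comb T f g _ 1) => // s t _ _ _.
by rewrite mul1r opprD addrACA ler_normD.
Qed.

Lemma ac_cst T (c : R) : ac_fun T (cst c).
Proof. by apply: (@ac_lip _ _ 0) => s t _ _ _; rewrite subrr normr0 mul0r. Qed.

Lemma ac_derive T f f' (C : R) :
  (forall t : R, is_derive t 1 f (f' t)) ->
  (forall t, 0 <= t -> t <= T -> `|f' t| <= C) -> ac_fun T f.
Proof.
move=> df Cf'; apply: (@ac_lip _ _ C) => s t s0 st tT.
have [|c /[!in_itv]/= /andP[sc ct] ->] := @MVT_segment R f f' s t st (fun z _ => df z).
  by apply: derivable_within_continuous => z _; have [] := df z.
rewrite normrM (ger0_norm (_ : 0 <= t - s)); last by lra.
by apply: ler_wpM2r; [lra|apply: Cf'; lra].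
Qed.

Lemma is_derive_expRM (k t : R) : is_derive t 1 (fun t => expR (k * t)) (k * expR (k * t)).
Proof.
have h : is_derive t 1 (fun s : R => k * s) k.
  by apply: (is_derive_eq (is_deriveZ k (is_derive_id t 1))); rewrite /GRing.scale /= mulr1.
by apply: (is_derive_eq (is_derive1_comp (is_derive_expR (k * t)) h)); rewrite mulrC.
Qed.

Lemma ac_expR T (k : R) : ac_fun T (fun t => expR (k * t)).
Proof.
apply: (@ac_derive _ _ (fun t => k * expR (k * t)) (`|k| * expR (`|k| * T))).
  exact: is_derive_expRM.
move=> t t0 tT; rewrite normrM (ger0_norm (expR_ge0 (k * t))).
rewrite ler_wpM2l // ler_expR; apply: le_trans (ler_norm _) _.
by rewrite normrM (ger0_norm t0) ler_wpM2l.
Qed.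

Lemma derive_eps (f : R -> R) (t l e : R) : is_derive t 1 f l -> 0 < e ->
  exists2 d : R, 0 < d & forall h, `|h| < d -> `|f (t + h) - f t - h * l| <= e * `|h|.
Proof.
move=> [df dl] e0.
have : (fun h : R => h^-1 *: (f (h *: 1 + t) - f t)) @ 0^' --> l.
  by rewrite -dl; exact: df.
move=> /cvgrPdist_le /(_ _ e0) /= [d /= d0 H]; exists d => // h hd.
have [->|h0] := eqVneq h 0; first by rewrite addr0 subrr mul0r subrr normr0 mulr0.
have := H h; rewrite /ball_ /= sub0r normrN => /(_ hd h0).
have -> : f (t + h) - f t - h * l = - h * (l - h^-1 *: (f (h *: 1 + t) - f t)).
  by rewrite /GRing.scale /= mulr1 (addrC h t); field.
by rewrite normrM normrN mulrC => H'; exact: ler_wpM2r.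
Qed.

End AcAlgebra.

(** * Coordinates and norms in the plane *)

Section Plane.
Context (R : realType).
Implicit Types (u v w : 'cV[R]_2) (A B : 'M[R]_2).

Definition vec (a b : R) : 'cV[R]_2 := \col_i (if i == 0 then a else b).

Lemma vec0 a b : vec a b 0 0 = a. Proof. by rewrite mxE. Qed.
Lemma vec1 a b : vec a b 1 0 = b. Proof. by rewrite mxE. Qed.

Lemma col2P u v : u 0 0 = v 0 0 -> u 1 0 = v 1 0 -> u = v.
Proof.
move=> h0 h1; apply/colP => i; rewrite -[i]/(i : 'I_2).
case: i => [[|[|//]] hi]; first by rewrite (_ : Ordinal hi = 0) //; exact/val_inj.
by rewrite (_ : Ordinal hi = 1) //; exact/val_inj.
Qed.

Lemma mul_col0 A u : (A *m u) 0 0 = A 0 0 * u 0 0 + A 0 1 * u 1 0.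
Proof. by rewrite mxE big_ord_recl big_ord1; congr (_ + A _ _ * u _ _); exact/val_inj. Qed.

Lemma mul_col1 A u : (A *m u) 1 0 = A 1 0 * u 0 0 + A 1 1 * u 1 0.
Proof. by rewrite mxE big_ord_recl big_ord1; congr (_ + A _ _ * u _ _); exact/val_inj. Qed.

Lemma enormE u : enorm u = Num.sqrt (u 0 0 ^+ 2 + u 1 0 ^+ 2).
Proof.
rewrite /enorm big_ord_recl big_ord1; congr (Num.sqrt (_ + u _ _ ^+ _)).
exact/val_inj.
Qed.

Lemma coord_le_enorm u i : `|u i 0| <= enorm u.
Proof.
rewrite /enorm -sqrtr_sqr ler_wsqrtr // (bigD1 i) //= lerDl sumr_ge0 // => j _.
exact: sqr_ge0.
Qed.

Lemma enorm_le u : enorm u <= `|u 0 0| + `|u 1 0|.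
Proof.
rewrite enormE -[leRHS]ger0_norm ?addr_ge0 // -sqrtr_sqr ler_wsqrtr //.
have := normr_ge0 (u 0 0); have := normr_ge0 (u 1 0).
rewrite -(real_normK (num_real (u 0 0))) -(real_normK (num_real (u 1 0))) => h1 h2.
have := mulr_ge0 h1 h2; lra.
Qed.

Lemma mxnorm_leP m n (A : 'M[R]_(m, n)) (r : R) : 0 <= r ->
  `|A| <= r <-> forall i j, `|A i j| <= r.
Proof.
move=> r0; rewrite /Num.norm /= mx_normrE; split=> [/bigmax_leP[_ h] i j|h].
  exact: (h (i, j)).
by apply/bigmax_leP; split => // -[i j] _; exact: h.
Qed.

Lemma coord_le m n (A : 'M[R]_(m, n)) i j : `|A i j| <= `|A|.
Proof. exact: (mxnorm_leP A (normr_ge0 A)).1. Qed.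

Lemma norm_leP u (r : R) : `|u 0 0| <= r -> `|u 1 0| <= r -> `|u| <= r.
Proof.
move=> h0 h1; apply/mxnorm_leP; first exact: le_trans h0.
move=> i j; rewrite (ord1 j); case: i => [[|[|//]] hi].
  by rewrite (_ : Ordinal hi = 0) //; exact/val_inj.
by rewrite (_ : Ordinal hi = 1) //; exact/val_inj.
Qed.

Lemma norm_mul A u : `|A *m u| <= 2 * `|A| * `|u|.
Proof.
have h i j k : `|A i j * u j k| <= `|A| * `|u|.
  by rewrite normrM ler_pM // coord_le.
by apply: norm_leP; rewrite (mul_col0, mul_col1); apply: le_trans (ler_normD _ _) _;
  rewrite -mulrA mulr2n mulrDl mul1r; apply: lerD; apply: h.
Qed.

Lemma norm_le_enorm u : `|u| <= enorm u.
Proof. by apply: norm_leP; apply: coord_le_enorm. Qed.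

Lemma enorm_le_norm u : enorm u <= 2 * `|u|.
Proof.
by apply: le_trans (enorm_le u) _; rewrite mulr2n mulrDl mul1r lerD // coord_le.
Qed.

End Plane.

(** * Curves in the plane, coordinate by coordinate *)

Section Trajectories.
Context (R : realType).
Implicit Types (S : set 'M[R]_2) (x : R -> 'cV[R]_2).

Lemma ac_coord T x : abs_continuous_on T x <-> forall i, ac_fun T (fun t => x t i 0).
Proof.
split=> [acx i|acx].
  apply: (@ac_dominated _ _ _ (fun s t => enorm (x t - x s))) => // s t _ _ _.
  by have := coord_le_enorm (x t - x s) i; rewrite !mxE.
move=> e e0; have e20 : 0 < e / 2 by lra.
have [d1 d10 H1] := acx 0 _ e20; have [d2 d20 H2] := acx 1 _ e20.
exists (Num.min d1 d2); first by rewrite lt_min d10.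
move=> n a b ab tri; rewrite lt_min => /andP[/(H1 n a b ab tri) {}H1 /(H2 n a b ab tri) {}H2].
rewrite [ltRHS]splitr.
apply: le_lt_trans (ltrD H1 H2); rewrite -big_split; apply: ler_sum => i _.
by apply: le_trans (enorm_le _) _; rewrite !mxE.
Qed.

Lemma is_derive_coord x (t : R) (v : 'cV[R]_2) :
  is_derive t 1 x v <-> forall i, is_derive t 1 (fun t => x t i 0) (v i 0).
Proof.
split=> [[dx dv] i|H].
  apply: DeriveDef; first by have /derivable_mxP := dx; exact.
  by rewrite -dv derive_mx // mxE.
have dx : derivable x t 1.
  by apply/derivable_mxP => i j; rewrite (ord1 j); have [] := H i.
apply: DeriveDef => //; rewrite derive_mx //; apply/matrixP => i j.
by rewrite (ord1 j) mxE; have [] := H i.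
Qed.

Lemma derive_vec_eps x (t e : R) v : is_derive t 1 x v -> 0 < e ->
  exists2 d : R, 0 < d & forall h, `|h| < d -> `|x (t + h) - x t - h *: v| <= e * `|h|.
Proof.
move=> /is_derive_coord H e0.
have [d1 d10 H1] := derive_eps (H 0) e0; have [d2 d20 H2] := derive_eps (H 1) e0.
exists (Num.min d1 d2); first by rewrite lt_min d10.
move=> h; rewrite lt_min => /andP[/H1 {}H1 /H2 {}H2].
by apply: norm_leP; rewrite !mxE.
Qed.

End Trajectories.

(** * Nagumo's theorem and boundedness of all trajectories *)

Section Invariance.
Context (R : realType).
Implicit Types (S : set 'M[R]_2) (M N : set 'cV[R]_2) (x : R -> 'cV[R]_2).

Definition mdist M (y : 'cV[R]_2) : R := inf [set `|y - m| | m in M].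

Lemma mdist_le M y m : M m -> mdist M y <= `|y - m|.
Proof.
by move=> Mm; apply: ge_inf; [exists 0 => _ [z _ <-] | exists m].
Qed.

Lemma mdist_attained M y : compact M -> M !=set0 ->
  exists2 m, M m & mdist M y = `|y - m|.
Proof.
move=> cM M0; have [|m] := @compact_EVT_min _ R (fun m : 'cV[R]_2 => `|y - m|) M M0 cM.
  apply: continuous_subspaceT => m.
  apply: (@continuous_comp _ _ _ (fun m : 'cV[R]_2 => y - m) (@Num.norm R _)).
    by apply: continuousB; [exact: cst_continuous | move=> ?; exact: cvg_id].
  exact: norm_continuous.
rewrite inE => Mm H; exists m => //; apply/eqP; rewrite eq_le mdist_le //=.
apply: lb_le_inf; first by exists `|y - m|, m.
by move=> _ [z Mz <-]; apply: H; rewrite inE.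
Qed.

Lemma mdist_lip M y z : compact M -> M !=set0 ->
  `|mdist M y - mdist M z| <= `|y - z|.
Proof.
move=> cM M0; have [m Mm Hm] := mdist_attained y cM M0.
have [p Mp Hp] := mdist_attained z cM M0.
have h1 : mdist M y <= `|y - z| + `|z - p|.
  by apply: le_trans (mdist_le y Mp) _; have := ler_distD z y p.
have h2 : mdist M z <= `|y - z| + `|y - m|.
  by apply: le_trans (mdist_le z Mm) _; have := ler_distD y z m; rewrite (distrC z y).
by rewrite ler_norml; lra.
Qed.

(* Nagumo's condition: the vector [A *m m] is tangent to [M] at [m]. *)
Definition tangent S M := forall A m, S A -> M m -> forall e : R, 0 < e ->
  exists2 d : R, 0 < d & forall h, 0 < h -> h < d ->
    exists2 p, M p & `|m + h *: (A *m m) - p| <= e * h.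

Lemma ac_mdist T M x : compact M -> M !=set0 -> abs_continuous_on T x ->
  ac_fun T (fun t => mdist M (x t)).
Proof.
move=> cM M0 /ac_coord acx; apply: (@ac_comb _ _ _ _ _ 1 _ (acx 0) (acx 1)) => // s t _ _ _.
apply: le_trans (mdist_lip (x t) (x s) cM M0) _; rewrite mul1r.
by apply: norm_leP; rewrite !mxE ?lerDl ?lerDr.
Qed.

(** The point [m] of [M] nearest to [x t] is moved by the same matrix [A]. Tangency keeps
    [m + h *: (A *m m)] close to [M], while the gap [x t - m] evolves linearly, whence the factor
    [1 + 2 * K * h]; the 2 is that of [norm_mul]. *)
Lemma mdist_dini S M (K : R) x A (t : R) : compact M -> M !=set0 -> tangent S M ->
  S A -> `|A| <= K -> is_derive t 1 x (A *m x t) ->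
  forall e, 0 < e -> exists2 d : R, 0 < d & forall h, 0 < h -> h < d ->
    mdist M (x (t + h)) <= (1 + 2 * K * h) * mdist M (x t) + e * h.
Proof.
move=> cM M0 tSM SA AK dx e e0; have e20 : 0 < e / 2 by lra.
have [m Mm Hm] := mdist_attained (x t) cM M0.
have [d1 d10 H1] := tSM A m SA Mm _ e20; have [d2 d20 H2] := derive_vec_eps dx e20.
exists (Num.min d1 d2); first by rewrite lt_min d10.
move=> h h0; rewrite lt_min => /andP[hd1 hd2].
have [p Mp Hp] := H1 h h0 hd1.
have {}H2 : `|x (t + h) - x t - h *: (A *m x t)| <= e / 2 * h.
  by rewrite -[in leRHS](ger0_norm (ltW h0)); apply: H2; rewrite ger0_norm // ltW.
apply: le_trans (mdist_le _ Mp) _.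
have -> : x (t + h) - p = (x (t + h) - x t - h *: (A *m x t)) +
    ((x t - m) + h *: (A *m (x t - m)) + (m + h *: (A *m m) - p)).
  rewrite mulmxBr scalerBr; move: (h *: (A *m x t)) (h *: (A *m m)) (x (t + h)) (x t) => a b c d.
  by apply/matrixP => i j; rewrite !mxE; ring.
apply: le_trans (ler_normD _ _) _.
have h3 : `|x t - m + h *: (A *m (x t - m))| <= (1 + 2 * K * h) * mdist M (x t).
  apply: le_trans (ler_normD _ _) _; rewrite mulrDl mul1r Hm lerD2l.
  rewrite normrZ (ger0_norm (ltW h0)).
  have h4 := norm_mul A (x t - m).
  have h5 : 2 * `|A| * `|x t - m| <= 2 * K * `|x t - m|.
    by apply: ler_wpM2r => //; lra.
  have := ler_wpM2l (ltW h0) (le_trans h4 h5); lra.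
have := ler_normD (x t - m + h *: (A *m (x t - m))) (m + h *: (A *m m) - p).
lra.
Qed.

(** Gronwall's argument: the distance to [M], multiplied by [expR (- (2 * K) * t)], has nonpositive
    upper slope almost everywhere and vanishes at time 0. *)
Lemma invariant S M (K : R) x : compact M -> M !=set0 -> tangent S M ->
  (forall A, S A -> `|A| <= K) -> trajectory S x -> M (x 0) ->
  forall t, 0 <= t -> M (x t).
Proof.
move=> cM M0 tSM SK [acx [A [SA _ dx]]] Mx0 T T0.
have K0 : 0 <= K by apply: le_trans (SK _ (SA 0 (lexx _))).
pose G t := expR (- (2 * K) * t) * mdist M (x t).
have : G T <= G 0.
  apply: (@ac_dini _ T 0 G) => //.
    by apply: ac_mul; [exact: ac_expR | exact: ac_mdist].
  apply: ae_sub dx => t dx t0 tT e e0; have {}dx := dx t0.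
  have [d d0 H] := mdist_dini cM M0 tSM (SA t t0) (SK _ (SA t t0)) dx e0.
  exists d => // h h0 hd; rewrite /G.
  have D0 : 0 <= mdist M (x t).
    by have [m _ ->] := mdist_attained (x t) cM M0.
  have h1 : expR (- (2 * K) * (t + h)) * mdist M (x (t + h)) <=
      expR (- (2 * K) * (t + h)) * ((1 + 2 * K * h) * mdist M (x t) + e * h).
    by rewrite ler_wpM2l ?expR_ge0 //; exact: H.
  apply: le_trans h1 _; rewrite mulrDr; apply: lerD.
    rewrite mulrDr expRD -!mulrA ler_wpM2l ?expR_ge0 // mulrA -[leRHS]mul1r ler_wpM2r //.
    have -> : - (2 * K) * h = - (2 * K * h) by ring.
    rewrite mulrC expRN -ler_pdivlMr ?invr_gt0 ?expR_gt0 // invrK mul1r.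
    by rewrite mulrA; exact: expR_ge1Dx.
  rewrite -[leRHS]mul1r ler_wpM2r //; first by rewrite mulr_ge0 // ltW.
  rewrite -expR0 ler_expR mulNr oppr_le0 !mulr_ge0 //; lra.
rewrite /G mulr0 expR0 mul1r.
have -> : mdist M (x 0) = 0.
  apply/eqP; rewrite eq_le; have := mdist_le (x 0) Mx0; rewrite subrr normr0 => -> /=.
  by have [m _ ->] := mdist_attained (x 0) cM M0.
rewrite pmulr_rle0 ?expR_gt0 //; have [m Mm ->] := mdist_attained (x T) cM M0.
by rewrite normr_le0 subr_eq0 => /eqP ->.
Qed.

(** Used with a constant [c] and [k = 0] for the homogeneity of a system, and with an exponential
    for the passage to a system shifted by a scalar matrix. *)
Lemma traj_scale S x (c : R -> R) (k : R) :
  (forall t : R, is_derive t 1 c (k * c t)) -> (forall T, ac_fun T c) ->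
  trajectory S x -> trajectory [set A + k%:M | A in S] (fun t => c t *: x t).
Proof.
move=> dc acc [acx [A [SA mA dx]]]; split.
  move=> T; apply/ac_coord => i.
  rewrite (_ : (fun _ => _) = fun t => c t * x t i 0); last first.
    by apply/funext => t; rewrite mxE.
  by apply: ac_mul; [exact: acc | exact: (ac_coord T x).1].
exists (fun t => A t + k%:M); split.
- by move=> t t0; exists (A t) => //; exact: SA.
- move=> i j; rewrite (_ : (fun _ => _) = fun t => A t i j + k%:M i j); last first.
    by apply/funext => t; rewrite mxE.
  by apply: measurable_funD => //; exact: measurable_cst.
- apply: ae_sub dx => t dx t0; apply/is_derive_coord => i.
  rewrite (_ : (fun _ => _) = c * (fun t => x t i 0)); last first.
    by apply/funext => s; rewrite mxE.
  have dxi := (is_derive_coord x t (A t *m x t)).1 (dx t0) i.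
  apply: (is_derive_eq (is_deriveM (dc t) dxi)).
  by rewrite -scalemxAr mulmxDl mul_scalar_mx !mxE /GRing.scale /=; ring.
Qed.

(** [invariant] confines only trajectories that start in [M], and the origin may lie outside [M].
    The difference body [M - M] contains a neighbourhood of 0 and inherits tangency, so a small
    multiple of any trajectory starts there and remains there. *)
Lemma traj_bounded S M (K : R) x : compact M -> interior M !=set0 -> tangent S M ->
  (forall A, S A -> `|A| <= K) -> trajectory S x ->
  exists C, forall t, 0 <= t -> enorm (x t) <= C.
Proof.
move=> cM [z Mz] tSM SK tx.
have [r /= r0 Hr] := (@nbhs_ballP R _ _ _).1 Mz.
have M0 : M !=set0 by exists z; apply: Hr; exact: ballxx.
pose N := [set u.1 - u.2 | u in M `*` M].
have cN : compact N.
  apply: continuous_compact; last exact: compact_setX.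
  apply: continuous_subspaceT => u.
  by apply: cvgB; [exact: cvg_fst | exact: cvg_snd].
have N0 : N !=set0 by have [m Mm] := M0; exists (m - m), (m, m).
have tSN : tangent S N.
  move=> A _ SA [[m p] [/= Mm Mp] <-] e e0; have e20 : 0 < e / 2 by lra.
  have [d1 d10 H1] := tSM A m SA Mm _ e20; have [d2 d20 H2] := tSM A p SA Mp _ e20.
  exists (Num.min d1 d2); first by rewrite lt_min d10.
  move=> h h0; rewrite lt_min => /andP[/(H1 h h0)[m' Mm' {}H1] /(H2 h h0)[p' Mp' {}H2]].
  exists (m' - p'); first by exists (m', p').
  rewrite mulmxBr scalerBr.
  have -> : m - p + (h *: (A *m m) - h *: (A *m p)) - (m' - p') =
     (m + h *: (A *m m) - m') - (p + h *: (A *m p) - p').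
    move: (h *: (A *m m)) (h *: (A *m p)) => a b.
    by apply/matrixP => i j; rewrite !mxE; ring.
  by apply: le_trans (ler_normB _ _) _; lra.
have [C HC] : exists C, forall y, N y -> `|y| <= C.
  by have [B [_ HB]] := compact_bounded cN; exists (B + 1) => y Ny; apply: HB => //; rewrite ltrDl.
pose c : R := (r / 2) / (`|x 0| + 1).
have p1 : 0 < `|x 0| + 1 by rewrite ltr_wpDl.
have c0 : 0 < c by rewrite !divr_gt0.
have tcx : trajectory S (fun t => c *: x t).
  have := @traj_scale S x (cst c) 0 _ (fun T => ac_cst T c) tx.
  rewrite (_ : [set A + 0%:M | A in S] = S); last first.
    rewrite raddf0; apply/seteqP; split=> [_ [B SB <-]|B SB]; first by rewrite addr0.
    by exists B => //; rewrite addr0.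
  apply => t; rewrite mul0r; exact: is_derive_cst.
have Ncx : N (c *: x 0).
  exists (z + c *: x 0, z) => /=; last by rewrite addrC addKr.
  split => /=; apply: Hr; last exact: ballxx.
  rewrite -ball_normE /= opprD addNKr normrN normrZ (ger0_norm (ltW c0)) /c.
  have -> : r / 2 / (`|x 0| + 1) * `|x 0| = r / 2 * (`|x 0| / (`|x 0| + 1)) by ring.
  apply: (@le_lt_trans _ _ (r / 2 * 1)); last by lra.
  by apply: ler_wpM2l; [lra|rewrite ler_pdivrMr // mul1r lerDl].
exists (2 * (C / c)) => t t0; apply: le_trans (enorm_le_norm _) _.
rewrite ler_pM2l // ler_pdivlMr // mulrC -{1}(ger0_norm (ltW c0)) -normrZ.
exact: HC (invariant cN N0 tSN SK tcx Ncx t0).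
Qed.

End Invariance.

(** * Convexity, closedness and compactness in usable form *)

Section Topology.
Context (R : realType).

Lemma convexP (V : lmodType R) (C : set (convex_lmodType V)) :
  convex_set C <-> forall x y : V, forall t : R, C x -> C y -> 0 <= t -> t <= 1 ->
    C (((1 - t) *: x + t *: y : V) : convex_lmodType V).
Proof.
split=> [cC x y t Cx Cy t0 t1|H x y p].
  have := cC y x (Itv01 t0 t1); rewrite !inE => /(_ Cy Cx).
  by rewrite addrC.
rewrite !inE => Cx Cy.
have p0 : 0 <= p%:num by [].
have p1 : p%:num <= 1 by [].
by have := H y x p%:num Cy Cx p0 p1; rewrite addrC.
Qed.

Lemma closed_approx (V : normedModType R) (C : set V) :
  (forall p, (forall e, 0 < e -> exists2 q, C q & `|p - q| < e) -> C p) -> closed C.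
Proof.
move=> H p clp; apply: H => e e0.
have [|q [Cq]] := clp (ball p e); first exact: nbhsx_ballx.
by rewrite -ball_normE /=; exists q.
Qed.

Lemma closed_limit (V : normedModType R) (C : set V) : closed C ->
  forall p, (forall e, 0 < e -> exists2 q, C q & `|p - q| < e) -> C p.
Proof.
move=> clC p H; apply: clC => B /nbhs_ballP[e /= e0 eB].
by have [q Cq pq] := H e e0; exists q; split => //; apply: eB; rewrite -ball_normE.
Qed.

Lemma lip_continuous (V W : normedModType R) (f : V -> W) (L : R) :
  (forall x y, `|f x - f y| <= L * `|x - y|) -> continuous f.
Proof.
move=> H x; apply/cvgrPdist_lt => e e0.
have L0 : 0 < `|L| + 1 by rewrite ltr_wpDl.
apply/nbhs_ballP; exists (e / (`|L| + 1)); first by rewrite /= divr_gt0.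
move=> y; rewrite -ball_normE /= ltr_pdivlMr // mulrC; apply: le_lt_trans.
by apply: le_trans (H x y) _; apply: ler_wpM2r => //; have := ler_norm L; lra.
Qed.

Lemma compact_mxball m n (K : R) : compact [set A : 'M[R]_(m, n) | `|A| <= K].
Proof.
have [K0|K0] := leP 0 K; last first.
  rewrite (_ : mkset _ = set0); first exact: compact0.
  by rewrite -subset0 => A /= AK; have := normr_ge0 A; lra.
have -> : [set A : 'M[R]_(m, n) | `|A| <= K] =
    vec_mx @` [set r : 'rV[R]_(m * n) | `|r| <= K].
  apply/seteqP; split=> [A /= AK|_ [r /= rK <-]].
    exists (mxvec A); last exact: mxvecK.
    apply/mxnorm_leP => // i j; rewrite (ord1 i); case/mxvec_indexP: j => i' j'.
    by rewrite mxvecE; apply: le_trans (coord_le A i' j') AK.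
  apply/mxnorm_leP => // i j; rewrite mxE.
  by apply: le_trans (coord_le r _ _) rK.
apply: continuous_compact.
  apply: continuous_subspaceT; apply: (@lip_continuous _ _ _ 1) => r s.
  rewrite mul1r -linearB; apply/mxnorm_leP => // i j; rewrite mxE; exact: coord_le.
apply: bounded_closed_compact; last first.
  apply: closed_approx => p H /=; apply/ler_addgt0Pr => e e0.
  have [q /= qK pq] := H e e0; have := ler_normD (p - q) q; rewrite subrK; lra.
by exists K; split=> [|z Kz r /= rK]; [exact: num_real | apply: le_trans rK (ltW Kz)].
Qed.

Lemma compact_closed_norm (V : normedModType R) (C : set V) : compact C -> closed C.
Proof. by apply: compact_closed; exact: norm_hausdorff. Qed.

End Topology.

(** * A sufficient condition for realizability: sweeping segments *)

Section Realize.
Context (R : realType).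
Implicit Types (S : set 'M[R]_2) (M : set 'cV[R]_2) (u v w : 'cV[R]_2).

Definition det2 u v : R := u 0 0 * v 1 0 - u 1 0 * v 0 0.

Lemma det2_span u v w : det2 u v != 0 ->
  w = (det2 w v / det2 u v) *: u + (det2 u w / det2 u v) *: v.
Proof. by rewrite /det2 => D0; apply: col2P; rewrite !mxE; field. Qed.

(** A nonzero invariant subspace contains some nonzero [v] together with [A *m v], and these two
    already span the plane. *)
Lemma irreducible_of_det2 S :
  (forall v, v != 0 -> exists2 A, S A & det2 v (A *m v) != 0) -> irreducible_system S.
Proof.
move=> H V invV; have [->|V0] := eqVneq V 0%VS; [by left|right].
have vV := memv_pick V; have : vpick V != 0 by rewrite vpick0.
move=> /H[A SA D0]; apply/eqP; rewrite eqEsubv subvf; apply/subvP => w _.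
rewrite (det2_span w D0); apply: memvD; apply: memvZ => //; exact: invV.
Qed.

Lemma traj_const S A v : S A -> A *m v = 0 -> trajectory S (cst v).
Proof.
move=> SA Av; split=> [T|]; first by apply/ac_coord => i; exact: ac_cst.
exists (cst A); split=> [//|i j|]; first exact: measurable_cst.
by apply: aeW => t _; rewrite /= Av; exact: is_derive_cst.
Qed.

Lemma is_derive_near (f g : R -> R) (t l : R) : (\near t, f t = g t) ->
  is_derive t 1 g l -> is_derive t 1 f l.
Proof.
move=> fg [dg <-]; apply: DeriveDef; last exact: near_eq_derive.
by apply: near_eq_derivable dg; apply: filterS fg => z ->.
Qed.

(* The trajectory waits at [u] under [Au] and then follows the flow of [A] along
   the line through [u] and [v], where [A] acts on [(1 - s) u + s v] by
   [s' = l - k s]; [q = l / k] is the equilibrium and [s < q]. *)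
Lemma edge_traj_lt S u v A Au (l k s t : R) :
  S A -> S Au -> A *m u = l *: (v - u) -> A *m (v - u) = - k *: (v - u) -> Au *m u = 0 ->
  0 < k -> 0 <= s -> s < l / k -> l / k <= 1 -> 0 <= t ->
  exists x, [/\ trajectory S x, x t = u + s *: (v - u) &
    exists2 r, 0 <= r <= 1 & x 0 = u + r *: (v - u)].
Proof.
move=> SA SAu Au0 Av0 Auu k0 s0 sq q1 t0.
(* [g] is the solution of [g' = l - k g] with value [s] at time [t]. At early times it may be
   negative; [sg] then rests at 0, that is, at the point [u]. *)
pose q := l / k; pose g r := q - (q - s) * expR (k * t) * expR (- k * r).
pose sg r := Num.max 0 (g r).
have c0 : 0 < (q - s) * expR (k * t) by rewrite mulr_gt0 ?expR_gt0 // subr_gt0.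
have dg (r : R) : is_derive r 1 g (l - k * g r).
  have := is_deriveB (is_derive_cst q r 1)
    (is_deriveZ ((q - s) * expR (k * t)) (is_derive_expRM (- k) r)).
  move=> H; apply: (is_derive_eq H); rewrite /g /q /GRing.scale /=; field; exact: lt0r_neq0.
have acg T : ac_fun T g.
  apply: ac_add; first exact: ac_cst.
  rewrite (_ : (fun _ => _) = fun r => - ((q - s) * expR (k * t)) * expR (- k * r)); last first.
    by apply/funext => r; rewrite /=; ring.
  by apply: ac_mul; [exact: ac_cst | exact: ac_expR].
have cg : continuous g.
  by move=> r; apply/differentiable_continuous/derivable1_diffP; have [] := dg r.
have gmono r1 r2 : g r1 = g r2 -> r1 = r2.
  move=> h; have nk : - k != 0 by rewrite oppr_eq0 lt0r_neq0.
  have : g r1 - g r2 =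
      (q - s) * expR (k * t) * (expR (- k * r2) - expR (- k * r1)) by rewrite /g; ring.
  rewrite h subrr => /esym/eqP; rewrite mulf_eq0 (gt_eqF c0) /= subr_eq0.
  by move=> /eqP/expR_inj/(mulfI nk).
have gq r : g r <= q by rewrite /g lerBlDr lerDl mulr_ge0 ?expR_ge0 // ltW.
have q0 : 0 < q by apply: le_lt_trans sq.
pose B := [set r | 0 < g r].
have oB : open B.
  by apply: (@open_comp _ _ g [set z | 0 < z]) => [r _|]; [exact: cg | exact: open_gt].
pose C r := Au + \1_B r *: (A - Au).
have Cin r : B r -> C r = A.
  by move=> Br; rewrite /C indicE mem_set // scale1r addrC subrK.
have Cout r : ~ B r -> C r = Au.
  by move=> Br; rewrite /C indicE memNset // scale0r addr0.
exists (fun r => u + sg r *: (v - u)); split.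
- split=> [T|].
    apply/ac_coord => i.
    rewrite (_ : (fun _ => _) = fun r => u i 0 + sg r * (v - u) i 0); last first.
      by apply/funext => r; rewrite !mxE.
    apply: ac_add; [exact: ac_cst|apply: ac_mul; last exact: ac_cst].
    apply: (@ac_comb _ _ _ _ _ 1 _ (acg T) (acg T)) => // r1 r2 _ _ _.
    rewrite mul1r /sg; apply: (@le_trans _ _ `|g r2 - g r1|); last by rewrite lerDl.
    rewrite ler_norml; have := ler_norm (g r2 - g r1); have := ler_norm (- (g r2 - g r1)).
    by rewrite normrN /Num.max; case: ifP; case: ifP; lra.
  exists C; split.
  + move=> r _; have [Br|Br] := pselect (B r); first by rewrite Cin.
    by rewrite Cout.
  + move=> i j; rewrite (_ : (fun _ => _) = fun r => Au i j + \1_B r * (A - Au) i j); last first.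
      by apply/funext => r; rewrite !mxE.
    apply: measurable_funD; first exact: measurable_cst.
    apply: measurable_funM; last exact: measurable_cst.
    by apply: measurable_indic; exact: open_measurable.
  (* The curve has a corner where [g] crosses 0; since [g] is injective, this is at most one
     instant. *)
  + have nz : lebesgue_measure.-negligible [set r | g r = 0].
      have [[r0 gr0]|ng] := pselect (exists r, g r = 0).
        exists [set r0]; split; [exact: measurable_set1|exact: lebesgue_measure_set1|].
        by move=> r /= gr; apply: gmono; rewrite gr gr0.
      rewrite (_ : mkset _ = set0); first exact: negligible_set0.
      by rewrite -subset0 => r /= gr; apply: ng; exists r.
    apply: negligibleS nz => r /=; apply: contra_notP => gr0 _.
    apply/is_derive_coord => i.
    rewrite (_ : (fun _ => _) = fun r => u i 0 + sg r * (v - u) i 0); last first.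
      by apply/funext => z; rewrite !mxE.
    have [gr|gr] := ltP 0 (g r).
      rewrite Cin // mulmxDr -scalemxAr Au0 Av0.
      have sgr : sg r = g r by rewrite /sg; apply/max_idPr; exact: ltW.
      apply: (@is_derive_near _ (fun r => u i 0 + g r * (v - u) i 0)).
        have : nbhs r B by apply: open_nbhs_nbhs; split.
        by apply: filterS => z Bz; rewrite /sg; congr (_ + _ * _); apply/max_idPr; exact: ltW.
      have := is_deriveD (is_derive_cst (u i 0) r 1)
        (is_deriveM (dg r) (is_derive_cst ((v - u) i 0) r 1)).
      move=> H; apply: (is_derive_eq H); rewrite sgr !mxE /GRing.scale /=; ring.
    have {}gr : g r < 0 by rewrite lt_neqAle gr andbT; apply/eqP.
    rewrite Cout; last by rewrite /B /=; lra.
    have sgr : sg r = 0 by rewrite /sg; apply/max_idPl; exact: ltW.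
    apply: (@is_derive_near _ (cst (u i 0))).
      have : nbhs r [set z | g z < 0].
        apply: open_nbhs_nbhs; split => //.
        by apply: (@open_comp _ _ g [set z | z < 0]) => [z _|]; [exact: cg | exact: open_lt].
      apply: filterS => z gz; rewrite /sg (_ : Num.max 0 (g z) = 0) ?mul0r ?addr0 //.
      by apply/max_idPl; exact: ltW.
    by rewrite sgr scale0r addr0 Auu mxE; exact: is_derive_cst.
- congr (_ + _ *: _); rewrite /sg /g -mulrA -expRD mulNr subrr expR0 mulr1 opprB addrCA subrr addr0.
  exact/max_idPr.
- exists (sg 0) => //; rewrite /sg le_max lexx /= ge_max ler01 /=.
  exact: le_trans (gq 0) q1.
Qed.

(** [A] moves each end towards the other, at rates [l] and [r], so the segment stays invariant. [Au]
    and [Av] permit waiting at the ends, without which points could not be reached at arbitrarily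
    late times. *)
Definition edge_flow (T : 'M[R]_2 -> Prop) u v :=
  exists A Au Av l r, [/\ [/\ T A, T Au & T Av], 0 <= l, 0 <= r,
    A *m u = l *: (v - u) /\ A *m v = r *: (u - v) & Au *m u = 0 /\ Av *m v = 0].

(** On the point [u + s *: (v - u)] the matrix [A] acts by [s' = l - (l + r) s]. The equilibrium is
    reached by staying there, a point before it from [u], a point after it from [v] by symmetry. If
    [l + r = 0] every point is an equilibrium. *)
Lemma edge_traj S u v (s t : R) : edge_flow S u v -> 0 <= s -> s <= 1 -> 0 <= t ->
  exists x, [/\ trajectory S x, x t = u + s *: (v - u) &
    exists2 r, 0 <= r <= 1 & x 0 = u + r *: (v - u)].
Proof.
move=> [A [Au [Av [l [r [[SA SAu SAv] l0 r0 [Au0 Av0] [Auu Avv]]]]]]] s0 s1 t0.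
have Ad : A *m (v - u) = - (l + r) *: (v - u).
  by rewrite mulmxBr Au0 Av0; apply/matrixP => i j; rewrite !mxE; ring.
have [eqs|neqs] := eqVneq (s * (l + r)) l.
  exists (cst (u + s *: (v - u))); split => //; last by exists s => //; rewrite s0.
  apply: (traj_const SA); rewrite mulmxDr -scalemxAr Au0 Ad scalerA -scalerDl.
  by rewrite mulrN eqs subrr scale0r.
have k0 : 0 < l + r.
  rewrite lt_neqAle addr_ge0 // andbT; apply: contraNneq neqs => e0.
  by rewrite -e0 mulr0; apply/eqP; lra.
have [slt|sgt] := ltP (s * (l + r)) l.
  apply: (edge_traj_lt SA SAu Au0 Ad) => //; first by rewrite ltr_pdivlMr.
  by rewrite ler_pdivrMr // mul1r lerDl.
have {}sgt : l < s * (l + r) by rewrite lt_neqAle eq_sym neqs.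
have Ad' : A *m (u - v) = - (r + l) *: (u - v).
  by rewrite -[u - v]opprB mulmxN Ad scalerN addrC.
have [|||||x [tx xt [p /andP[p0 p1] x0]]] :=
  @edge_traj_lt S v u A Av r (r + l) (1 - s) t SA SAv Av0 Ad' Avv.
- by rewrite addrC.
- by rewrite subr_ge0.
- by rewrite ltr_pdivlMr; lra.
- by rewrite ler_pdivrMr ?mul1r ?lerDl // addrC.
- by [].
exists x; split=> //.
  by rewrite xt; apply/matrixP => i j; rewrite !mxE; ring.
exists (1 - p); first by apply/andP; lra.
by rewrite x0; apply/matrixP => i j; rewrite !mxE; ring.
Qed.

Lemma seq_bounds (Ts : seq 'M[R]_2) : (forall A, A \in Ts -> \tr A < 0) ->
  exists2 tau, 0 < tau & exists K, forall A, A \in Ts -> \tr A <= - tau /\ `|A| <= K.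
Proof.
elim: Ts => [_|A Ts IH H]; first by exists 1 => //; exists 0.
have [|tau tau0 [K HK]] := IH; first by move=> B BT; apply: H; rewrite inE BT orbT.
have trA : 0 < - \tr A by rewrite oppr_gt0; apply: H; rewrite inE eqxx.
exists (Num.min (- \tr A) tau); first by rewrite lt_min trA.
exists (Num.max `|A| K) => B; rewrite inE => /orP[/eqP ->|/HK[h1 h2]].
  by rewrite lerNr ge_min lexx le_max lexx.
by rewrite lerNr ge_min (lerNr tau) h1 orbT le_max h2 orbT.
Qed.

(** The Lyapunov exponent of the system is 0: all trajectories are bounded by [traj_bounded], and a
    nonzero end of a swept segment, annihilated by its waiting matrix, is a constant trajectory.
    Hence 0 is the scalar matrix that must be absent, and the trace excludes it. *)
Lemma realize M (Ts : seq 'M[R]_2) :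
  compact M -> convex_set M -> interior M !=set0 ->
  (forall A, A \in Ts -> \tr A < 0 /\ forall m, M m -> M (m + A *m m)) ->
  (forall v, v != 0 -> exists2 A, A \in Ts & det2 v (A *m v) != 0) ->
  (forall m, M m -> exists u v s, [/\ M u, M v, 0 <= s <= 1, m = u + s *: (v - u) &
     edge_flow [set` Ts] u v]) ->
  realizable M.
Proof.
move=> cM /convexP cvM iM HT irr edge.
have [tau tau0 [K HK]] := seq_bounds (fun A AT => (HT A AT).1).
pose S := [set A | [/\ forall m, M m -> M (m + A *m m), \tr A <= - tau & `|A| <= K]].
have TS A : A \in Ts -> S A.
  by move=> AT; have [? ?] := HK A AT; have [_ ?] := HT A AT.
have SK A : S A -> `|A| <= K by case.
have [m0 Mm0 m00] : exists2 m, M m & m != 0.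
  have [z Mz] := iM; have [r /= r0 Hr] := (@nbhs_ballP R _ _ _).1 Mz.
  have [z0|] := eqVneq z 0; last by exists z => //; apply: Hr; exact: ballxx.
  exists (vec (r / 2) 0).
    apply: Hr; rewrite -ball_normE /= z0 sub0r normrN.
    apply: (@le_lt_trans _ _ (r / 2)); last by lra.
    by apply: norm_leP; rewrite !mxE /= ?normr0 ?ger0_norm //; lra.
  apply/eqP => /matrixP/(_ 0 0); rewrite !mxE /=; lra.
have M0 : M !=set0 by exists m0.
have clM := compact_closed_norm cM.
have tSM : tangent S M.
  move=> A m [AM _ _] Mm e e0; exists 1 => // h h0 h1.
  exists ((1 - h) *: m + h *: (m + A *m m)).
    by apply: cvM => //; [exact: AM|exact: ltW|exact: ltW].
  rewrite (_ : m + _ - _ = 0) ?normr0; first by rewrite mulr_ge0 // ltW.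
  by move: (A *m m) => b; apply/matrixP => i j; rewrite !mxE; ring.
have eqv : exists2 v : 'cV[R]_2, v != 0 & exists2 A, S A & A *m v = 0.
  have [u [v [s [_ _ _ m0E [A [Au [Av [l [r [[SA SAu SAv] _ _ _ [Auu Avv]]]]]]]]]]] := edge m0 Mm0.
  have [u0|un0] := eqVneq u 0; last by exists u => //; exists Au => //; exact: TS.
  exists v; last by exists Av => //; exact: TS.
  by apply: contra_neq m00 => v0; rewrite m0E u0 v0 subrr scaler0 addr0.
have bnd x : trajectory S x -> exists C, forall t, 0 <= t -> enorm (x t) <= C.
  exact: (traj_bounded cM iM tSM SK).
have lyap : lyapunov_exponent S = 0.
  rewrite /lyapunov_exponent; set E := (X in inf X).
  have E0 : E 0.
    move=> x /bnd[C HC]; exists C => t t0; rewrite mul0r expR0 mulr1; exact: HC.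
  have lbE : lbound E 0.
    move=> b Eb; rewrite leNgt; apply/negP => b0.
    have [v v0 [A SA Av]] := eqv.
    have [C HC] := Eb _ (traj_const SA Av).
    have ev : 0 < enorm v.
      apply: lt_le_trans (norm_le_enorm v); by rewrite normr_gt0.
    (* At this time [expR (- (b * t))] is at least [1 + |C| / enorm v], so the supposed bound would
       give [enorm v + |C| <= C]. *)
    pose t := (`|C| / enorm v) / - b.
    have t0 : 0 <= t by rewrite !divr_ge0 // ?(ltW ev) // oppr_ge0 ltW.
    have := HC t t0; rewrite /= -[b * t]opprK expRN ler_pdivlMr ?expR_gt0 // => h.
    have h2 : 1 + - (b * t) <= expR (- (b * t)) by exact: expR_ge1Dx.
    have h3 : - (b * t) = `|C| / enorm v by rewrite /t; field; lra.
    have h4 : enorm v * (1 + `|C| / enorm v) <= C.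
      by apply: le_trans h; rewrite ler_wpM2l // ?(ltW ev) // -h3.
    have h5 : enorm v * (1 + `|C| / enorm v) = enorm v + `|C| by field; lra.
    have := ler_norm C; lra.
  apply/eqP; rewrite eq_le ge_inf //=; last by exists 0.
  by apply: lb_le_inf => //; exists 0.
exists S; split.
- split.
  + by have [A AT _] := irr m0 m00; exists A; exact: TS.
  + apply: (@subclosed_compact _ S [set A : 'M[R]_2 | `|A| <= K]); [|exact: compact_mxball|by move=> A []].
    apply: closed_approx => A H; split.
    * move=> m Mm; apply: (closed_limit clM) => e e0.
      have p1 : 0 < 2 * (`|m| + 1) by have := normr_ge0 m; lra.
      have [B [BM _ _] AB] := H _ (divr_gt0 e0 p1).
      exists (m + B *m m); first exact: BM.
      have -> : m + A *m m - (m + B *m m) = (A - B) *m m.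
        by rewrite mulmxBl opprD addrACA subrr add0r.
      apply: le_lt_trans (norm_mul _ _) _.
      move: AB; rewrite ltr_pdivlMr // => AB.
      apply: le_lt_trans AB; have := normr_ge0 (A - B); lra.
    * apply/ler_addgt0Pr => e e0; have e20 : 0 < e / 2 by lra.
      have [B [_ trB _] AB] := H _ e20.
      have : \tr (A - B) <= e / 2 + e / 2.
        rewrite /mxtrace big_ord_recl big_ord1; apply: lerD; apply: le_trans (ler_norm _) _;
        by apply: le_trans (coord_le _ _ _) (ltW AB).
      by rewrite linearB /=; lra.
    * apply/ler_addgt0Pr => e e0; have [B [_ _ BK] AB] := H _ e0.
      by have := ler_normD (A - B) B; rewrite subrK; lra.
  + apply/convexP => A B t [AM trA AK] [BM trB BK] t0 t1; split.
    * move=> m Mm; rewrite mulmxDl -!scalemxAl.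
      have -> : m + ((1 - t) *: (A *m m) + t *: (B *m m)) =
          (1 - t) *: (m + A *m m) + t *: (m + B *m m).
        by move: (A *m m) (B *m m) => a b; apply/matrixP => i j; rewrite !mxE; ring.
      by apply: cvM => //; [exact: AM | exact: BM].
    * rewrite mxtraceD !mxtraceZ.
      have t1' : 0 <= 1 - t by lra.
      have := ler_wpM2l t0 trB; have := ler_wpM2l t1' trA; lra.
    * apply: le_trans (ler_normD _ _) _; rewrite !normrZ.
      have t1' : 0 <= 1 - t by lra.
      rewrite (ger0_norm t0) (ger0_norm t1').
      have := ler_wpM2l t0 BK; have := ler_wpM2l t1' AK; lra.
  + by rewrite lyap => -[_]; rewrite raddf0 linear0; lra.
- by apply: irreducible_of_det2 => v /irr[A /TS SA D0]; exists A.
- split=> //.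
    by move=> eM; move: Mm0; rewrite eM /= => m0E; rewrite m0E eqxx in m00.
  exists 0 => t t0; rewrite mul0r expR0; apply/seteqP; split.
    move=> v [x [tx Mx0 ->]]; exists (x t); last by rewrite scale1r.
    exact: invariant cM M0 tSM SK tx Mx0 t t0.
  move=> _ [m Mm <-]; rewrite scale1r.
  have [u [v [s [Mu Mv /andP[s0 s1] mE ef]]]] := edge m Mm.
  have [|x [tx xt [r /andP[r0 r1] x0]]] := @edge_traj S u v s t _ s0 s1 t0.
    have [A [Au [Av [l [r [[TA TAu TAv] ? ? ? ?]]]]]] := ef.
    by exists A, Au, Av, l, r; split => //; split; exact: TS.
  exists x; split => //; last by rewrite xt mE.
  rewrite x0 (_ : u + _ = (1 - r) *: u + r *: v); first exact: cvM.
  by apply/matrixP => i j; rewrite !mxE; ring.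
Qed.

End Realize.

(** * Convex hulls of finite sets *)

Section Hull.
Context (R : realType).
Implicit Types (E C : set 'cV[R]_2) (u v w : 'cV[R]_2).

Lemma hull_mem E v : E v -> convex_hull E v.
Proof. by move=> Ev; exact: (sub_gen_smallest Ev). Qed.

Lemma hull_min E C : convex_set C -> E `<=` C -> convex_hull E `<=` C.
Proof. exact: smallest_sub. Qed.

Lemma hull_convex E : convex_set (convex_hull E).
Proof.
apply/convexP => x y t Hx Hy t0 t1 C [cC EC].
by apply: (convexP C).1 => //; [exact: Hx|exact: Hy].
Qed.

Lemma hull_comb E u v (t : R) : convex_hull E u -> convex_hull E v -> 0 <= t -> t <= 1 ->
  convex_hull E ((1 - t) *: u + t *: v).
Proof. by have /convexP := @hull_convex E; apply. Qed.

Lemma convex_sum C n (l : 'I_n -> R) (p : 'I_n -> 'cV[R]_2) : convex_set C ->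
  (forall i, 0 <= l i) -> \sum_i l i = 1 -> (forall i, C (p i)) ->
  C (\sum_i l i *: p i).
Proof.
move=> /convexP cC; elim: n l p => [|n IH] l p l0 l1 Cp.
  by move: l1; rewrite big_ord0 => /eqP; rewrite eq_sym oner_eq0.
move: l1; rewrite !big_ord_recr /= => l1.
have s0 : 0 <= \sum_(i < n) l (widen_ord (leqnSn n) i) by apply: sumr_ge0.
have [lt|ge] := ltP (l ord_max) 1; last first.
  have sE : \sum_(i < n) l (widen_ord (leqnSn n) i) = 0 by lra.
  have -> : l ord_max = 1 by lra.
  rewrite big1 ?add0r ?scale1r // => i _.
  by rewrite (psumr_eq0P _ sE) ?scale0r // => j _.
have k0 : 0 < 1 - l ord_max by lra.
have Cq : C (\sum_(i < n) (l (widen_ord (leqnSn n) i) / (1 - l ord_max)) *: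
    p (widen_ord (leqnSn n) i)).
  apply: IH => // [i|]; first by rewrite divr_ge0 // ltW.
  rewrite -mulr_suml (_ : \sum_(i < n) _ = 1 - l ord_max); last by lra.
  by rewrite divff // gt_eqF.
have := cC _ _ _ Cq (Cp ord_max) (l0 ord_max) (ltW lt); rewrite scaler_sumr.
congr (C (_ + _)); apply: eq_bigr => i _.
by rewrite scalerA mulrCA divff ?mulr1 // gt_eqF.
Qed.

Lemma hull_finite n (p : 'I_n -> 'cV[R]_2) : convex_hull (range p) =
  [set \sum_i l 0 i *: p i | l in [set l : 'rV[R]_n | (forall i, 0 <= l 0 i) /\ \sum_i l 0 i = 1]].
Proof.
apply/seteqP; split; last first.
  move=> _ [l [l0 l1] <-]; apply: convex_sum => //; first exact: hull_convex.
  by move=> i; apply: hull_mem; exists i.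
apply: hull_min; last first.
  move=> _ [i _ <-]; exists (\row_j (j == i)%:R); first split.
  - by move=> j; rewrite mxE ler0n.
  - by rewrite (bigD1 i) //= mxE eqxx big1 ?addr0 // => j /negbTE ji; rewrite mxE ji.
  - by rewrite (bigD1 i) //= mxE eqxx scale1r big1 ?addr0 // => j /negbTE ji; rewrite mxE ji scale0r.
apply/convexP => _ _ t [l [l0 l1] <-] [k [k0 k1] <-] t0 t1.
exists ((1 - t) *: l + t *: k); first split.
- by move=> i; rewrite !mxE addr_ge0 // mulr_ge0 // subr_ge0.
- under eq_bigr do rewrite !mxE.
  by rewrite big_split /= -!mulr_sumr l1 k1; ring.
- rewrite !scaler_sumr -big_split; apply: eq_bigr => i _ /=.
  by rewrite !mxE [LHS]scalerDl !scalerA.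
Qed.

(** The hull is the image of the simplex of weights, closed and bounded, under a linear and hence
    Lipschitz map. *)
Lemma hull_compact n (p : 'I_n -> 'cV[R]_2) : compact (convex_hull (range p)).
Proof.
rewrite hull_finite; apply: continuous_compact.
  apply: continuous_subspaceT.
  apply: (@lip_continuous _ _ _ _ (\sum_i `|p i|)) => l k.
  rewrite -sumrB mulr_suml; apply: le_trans (ler_norm_sum _ _ _) _.
  apply: ler_sum => i _; rewrite -scalerBl normrZ mulrC ler_wpM2l //.
  by have := coord_le (l - k) 0 i; rewrite !mxE.
apply: (@subclosed_compact _ _ [set l : 'rV[R]_n | `|l| <= 1]); last 2 first.
- exact: compact_mxball.
- move=> l [l0 l1] /=; apply/mxnorm_leP => // i j; rewrite (ord1 i) ger0_norm //.
  by rewrite -l1 (bigD1 j) //= lerDl sumr_ge0.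
apply: closed_approx => l H; split=> [i|].
  apply/ler_addgt0Pr => e e0; have [k [k0 _] lk] := H e e0.
  have := coord_le (l - k) 0 i; rewrite !mxE => h.
  have := k0 i; have := ler_norm (- (l 0 i - k 0 i)); rewrite normrN; lra.
have sumE e : 0 < e -> `|\sum_i l 0 i - 1| <= n%:R * e.
  move=> e0; have [k [_ k1] lk] := H e e0; rewrite -[X in _ - X]k1.
  rewrite -sumrB; apply: le_trans (ler_norm_sum _ _ _) _.
  apply: (@le_trans _ _ (\sum_(i < n) e)); last by rewrite sumr_const card_ord -[e *+ n]mulr_natl lexx.
  by apply: ler_sum => i _; have := coord_le (l - k) 0 i; rewrite !mxE; lra.
apply/eqP; rewrite -subr_eq0 -normr_le0; apply/ler_addgt0Pr => e e0.
have n0 : 0 < n%:R + 1 :> R by rewrite ltr_wpDl.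
have := sumE _ (divr_gt0 e0 n0); rewrite add0r => /le_trans; apply.
by rewrite mulrCA ger_pMr // ler_pdivrMr // mul1r lerDl.
Qed.

Lemma hull_seq_compact (vs : seq 'cV[R]_2) : compact (convex_hull [set` vs]).
Proof.
rewrite (_ : [set` vs] = range (fun i : 'I_(size vs) => nth 0 vs i)); first exact: hull_compact.
apply/seteqP; split=> [v /= /(nthP 0)[i ilt <-]|_ [i _ <-] /=].
  by exists (Ordinal ilt).
exact: mem_nth.
Qed.

Lemma hull_affine (g : 'cV[R]_2 -> 'cV[R]_2) E :
  (forall u v t, g ((1 - t) *: u + t *: v) = (1 - t) *: g u + t *: g v) ->
  [set g v | v in convex_hull E] = convex_hull [set g v | v in E].
Proof.
move=> ag; apply/seteqP; split.
  move=> _ [v Ev <-]; apply: (Ev [set v | convex_hull [set g v | v in E] (g v)]).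
  split=> [|w Ew]; last by apply: hull_mem; exists w.
  by apply/convexP => x y t /= Hx Hy t0 t1; rewrite ag; exact: hull_comb.
apply: hull_min; last by move=> _ [v Ev <-]; exists v => //; exact: hull_mem.
apply/convexP => _ _ t [v Hv <-] [w Hw <-] t0 t1.
by exists ((1 - t) *: v + t *: w); [exact: hull_comb | exact: ag].
Qed.

Lemma hull_translate E o : [set v - o | v in convex_hull E] =
  convex_hull [set v - o | v in E].
Proof.
by apply: (hull_affine (g := fun v => v - o)) => u v t; apply/matrixP => i j; rewrite !mxE; ring.
Qed.

End Hull.

(** * Affine coordinates: matrices as tuples, points as pairs *)

Section Coordinates.
Context (R : realType).
Implicit Types (a b o u v w : 'cV[R]_2).

Definition lmat (A : R * R * R * R) : 'M[R]_2 :=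
  \matrix_(i, j) (if i == 0 then if j == 0 then A.1.1.1 else A.1.1.2
                  else if j == 0 then A.1.2 else A.2).

Definition lapp (A : R * R * R * R) (c : R * R) : R * R :=
  (A.1.1.1 * c.1 + A.1.1.2 * c.2, A.1.2 * c.1 + A.2 * c.2).

Definition pt a b (c : R * R) := c.1 *: a + c.2 *: b.

Definition frame a b : 'M[R]_2 := \matrix_(i, j) (if j == 0 then a i 0 else b i 0).

Lemma frame_mul a b u : frame a b *m u = pt a b (u 0 0, u 1 0).
Proof. by apply: col2P; rewrite (mul_col0, mul_col1) !mxE /=; ring. Qed.

Lemma frame_unit a b : det2 a b != 0 -> frame a b \in unitmx.
Proof.
move=> D0; rewrite unitmxE unitfE (_ : \det _ = det2 a b) //.
rewrite (expand_det_row _ 0) big_ord_recl big_ord1 /cofactor !det_mx11 !mxE /= /det2.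
have -> : lift 0 0 = 1 :> 'I_2 by exact/val_inj.
by rewrite expr0 expr1; ring.
Qed.

Definition cmat a b A := frame a b *m lmat A *m invmx (frame a b).

Lemma cmat_pt a b A c : det2 a b != 0 -> cmat a b A *m pt a b c = pt a b (lapp A c).
Proof.
move=> D0; have -> : pt a b c = frame a b *m vec c.1 c.2.
  by rewrite frame_mul vec0 vec1; case: c.
rewrite /cmat mulmxA mulmxKV ?frame_unit // -mulmxA frame_mul mul_col0 mul_col1.
by rewrite !mxE.
Qed.

Lemma tr_cmat a b A : det2 a b != 0 -> \tr (cmat a b A) = A.1.1.1 + A.2.
Proof.
move=> D0; rewrite /cmat -mulmxA mxtrace_mulC mulmxKV ?frame_unit //.
by rewrite /mxtrace big_ord_recl big_ord1 !mxE.
Qed.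

Lemma det2_pt a b c d : det2 (pt a b c) (pt a b d) = det2 a b * (c.1 * d.2 - c.2 * d.1).
Proof. by rewrite /det2 !mxE; ring. Qed.

Lemma pt_coord a b v : det2 a b != 0 -> exists c, v = pt a b c.
Proof.
by move=> D0; exists (det2 v b / det2 a b, det2 a v / det2 a b); exact: det2_span.
Qed.

Lemma pt_inj a b c d : det2 a b != 0 -> pt a b c = pt a b d -> c = d.
Proof.
move=> D0 e; have := congr1 (fun z => det2 a z) e; have := congr1 (fun z => det2 z b) e.
rewrite /pt /det2 !mxE; case: c d {e} => [c1 c2] [d1 d2] /= e1 e2; move: D0; rewrite /det2 => D0.
congr (_, _); apply: (mulIf D0).
  transitivity ((c1 * a 0 0 + c2 * b 0 0) * b 1 0 - (c1 * a 1 0 + c2 * b 1 0) * b 0 0); first by ring.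
  by rewrite e1; ring.
transitivity (a 0 0 * (c1 * a 1 0 + c2 * b 1 0) - a 1 0 * (c1 * a 0 0 + c2 * b 0 0)); first by ring.
by rewrite e2; ring.
Qed.

Definition edge_flow2 (Ts : seq (R * R * R * R)) (u v : R * R) :=
  exists A Au Av l r, [/\ [/\ A \in Ts, Au \in Ts & Av \in Ts], 0 <= l, 0 <= r,
    lapp A u = (l * (v.1 - u.1), l * (v.2 - u.2)) /\
    lapp A v = (r * (u.1 - v.1), r * (u.2 - v.2)) &
    lapp Au u = (0, 0) /\ lapp Av v = (0, 0)].

(* All that is needed of the convex hull of [cs], in coordinates. *)
Definition conv_pred (H : R * R -> Prop) (cs : seq (R * R)) :=
  [/\ forall c, c \in cs -> H c,
     forall c d t, H c -> H d -> 0 <= t -> t <= 1 ->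
       H ((1 - t) * c.1 + t * d.1, (1 - t) * c.2 + t * d.2) &
     forall p q k, (forall c, c \in cs -> p * c.1 + q * c.2 <= k) ->
       forall c, H c -> p * c.1 + q * c.2 <= k].

(** The copy is the translate that brings [o] to the origin. By convexity a matrix need only point
    inwards at the vertices [cs]. By homogeneity a flow sweeping the segment [u v] also sweeps its
    multiple by [x + y], so all points of the triangle [0 u v] are reached and not only those of its
    side. *)
Lemma copy_coord a b o cs Ts : det2 a b != 0 ->
  interior (convex_hull [set` [seq o + pt a b c | c <- cs]]) !=set0 ->
  (forall H, conv_pred H cs ->
    [/\ forall A, A \in Ts -> A.1.1.1 + A.2 < 0 /\
          forall c, c \in cs -> exists2 k, 0 < k &
            H (c.1 + k * (lapp A c).1, c.2 + k * (lapp A c).2),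
        forall c : R * R, c.1 != 0 \/ c.2 != 0 -> exists2 A, A \in Ts &
          c.1 * (lapp A c).2 - c.2 * (lapp A c).1 != 0 &
        forall c, H c -> exists (u v : R * R) (x y : R),
          [/\ H u, H v, edge_flow2 Ts u v, [/\ 0 <= x, 0 <= y & x + y <= 1] &
             c = (x * u.1 + y * v.1, x * u.2 + y * v.2)] /\ H (0, 0)]) ->
  has_realizable_copy (convex_hull [set` [seq o + pt a b c | c <- cs]]).
Proof.
move=> D0 iP HH; set vs := [seq o + pt a b c | c <- cs]; set P := convex_hull _.
pose M := convex_hull [set` [seq pt a b c | c <- cs]].
have ME : M = [set v - o | v in P].
  rewrite hull_translate; congr convex_hull; apply/seteqP; split=> v /=.
    move=> /mapP[c ccs ->]; exists (o + pt a b c); last by rewrite addrC addKr.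
    by apply/mapP; exists c.
  move=> [w /mapP[c ccs ->] <-]; rewrite addrC addKr; by apply/mapP; exists c.
have cM u v t : M u -> M v -> 0 <= t -> t <= 1 -> M ((1 - t) *: u + t *: v).
  exact: hull_comb.
have ptD c d t : (1 - t) *: pt a b c + t *: pt a b d =
    pt a b ((1 - t) * c.1 + t * d.1, (1 - t) * c.2 + t * d.2).
  by rewrite /pt; apply/matrixP => i j; rewrite !mxE /=; ring.
pose H c := M (pt a b c).
have cH : conv_pred H cs.
  split.
  - by move=> c ccs; apply: hull_mem; apply/mapP; exists c.
  - by move=> c d t Hc Hd t0 t1; rewrite /H -ptD; exact: cM.
  - move=> p q k pqk c Hc.
    pose C : set 'cV[R]_2 := [set w | forall c, w = pt a b c -> p * c.1 + q * c.2 <= k].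
    apply: (Hc C _ c erefl); split; last first.
      by move=> _ /mapP[d dcs ->] e /(pt_inj D0) <-; exact: pqk.
    apply/convexP => x y t Cx Cy t0 t1 d.
    have [ex xE] := pt_coord x D0; have [ey yE] := pt_coord y D0.
    rewrite xE yE ptD => /(pt_inj D0) <- /=.
    have t1' : 0 <= 1 - t by lra.
    have := ler_wpM2l t0 (Cy _ yE); have := ler_wpM2l t1' (Cx _ xE); lra.
have memH c : c \in cs -> M (pt a b c) by case: cH => h _ _; exact: h.
have [HT irr edge] := HH H cH.
have conv_scale A v k k' : M v -> M (v + k *: (A *m v)) -> 0 < k' -> k' <= k ->
    M (v + k' *: (A *m v)).
  move=> Mv Mk k0 kk; have k1 : 0 < k by exact: lt_le_trans kk.
  have -> : v + k' *: (A *m v) = (1 - k' / k) *: v + (k' / k) *: (v + k *: (A *m v)).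
    move: (A *m v) => w; apply/matrixP => i j; rewrite !mxE; field; exact: lt0r_neq0.
  by apply: cM => //; [rewrite divr_ge0 // ltW | rewrite ler_pdivrMr // mul1r].
have step A : A \in Ts -> exists k, 0 < k /\ forall m, M m -> M (m + k *: (cmat a b A *m m)).
  move=> /HT[_ HA].
  have [k k0 Hk] : exists2 k, 0 < k & forall c, c \in cs ->
      M (pt a b c + k *: (cmat a b A *m pt a b c)).
    have : {subset cs <= cs} by [].
    elim: {-2}cs => [|c cs' IH] sub; first by exists 1.
    have [|k k0 Hk] := IH; first by move=> d dcs; apply: sub; rewrite inE dcs orbT.
    have ccs : c \in cs by apply: sub; rewrite inE eqxx.
    have [k' k'0 Hk'] := HA c ccs.
    exists (Num.min k k'); first by rewrite lt_min k0.
    have kk : Num.min k k' <= k by rewrite ge_min lexx.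
    have kk' : Num.min k k' <= k' by rewrite ge_min lexx orbT.
    have km : 0 < Num.min k k' by rewrite lt_min k0.
    move=> d; rewrite inE => /orP[/eqP ->|dcs].
      apply: (conv_scale _ _ k') => //; first exact: memH.
      rewrite cmat_pt //.
      have -> : pt a b c + k' *: pt a b (lapp A c) =
          pt a b (c.1 + k' * (lapp A c).1, c.2 + k' * (lapp A c).2).
        by rewrite /pt; apply/matrixP => i j; rewrite !mxE /=; ring.
      exact: Hk'.
    apply: (conv_scale _ _ k) => //; last exact: Hk.
    by apply: memH; apply: sub; rewrite inE dcs orbT.
  exists k; split=> // m Mm.
  apply: (Mm [set m | M (m + k *: (cmat a b A *m m))]); split; last first.
    by move=> _ /mapP[c ccs ->]; exact: Hk.
  apply/convexP => x y t /= Mx My t0 t1; rewrite mulmxDr -!scalemxAr.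
  have {Mx My} := cM _ _ _ Mx My t0 t1; congr M.
  by move: (_ *m x) (_ *m y) => z w; apply/matrixP => i j; rewrite !mxE; ring.
(* Rescaling each matrix separately turns small inward steps into the full step [m + A *m m] that
   [realize] asks for; kernels, sign of the trace and invariant lines are unaffected. *)
have [kap Hkap] : exists kap : R * R * R * R -> R, forall A, A \in Ts ->
    0 < kap A /\ forall m, M m -> M (m + kap A *: (cmat a b A *m m)).
  have /choice[f Hf] : forall A, exists k, A \in Ts ->
      0 < k /\ forall m, M m -> M (m + k *: (cmat a b A *m m)).
    move=> A; have [AT|/negP AT] := boolP (A \in Ts); last by exists 0.
    by have [k Hk] := step A AT; exists k.
  by exists f.
exists M.
  exists (fun v => v - o); split => // u v _ _.
  by congr enorm; rewrite opprB addrA subrK.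
apply: (@realize _ M [seq kap A *: cmat a b A | A <- Ts]).
- exact: hull_seq_compact.
- exact: hull_convex.
- have [z Pz] := iP; have [r /= r0 Hr] := (@nbhs_ballP R _ _ _).1 Pz.
  exists (z - o); apply/nbhs_ballP; exists r => //= w; rewrite -ball_normE /= => wz.
  rewrite ME; exists (w + o); last by rewrite addrK.
  by apply: Hr; rewrite -ball_normE /= opprD addrA addrAC.
- move=> _ /mapP[A AT ->]; have [kA HA] := Hkap A AT; split.
    by rewrite mxtraceZ tr_cmat // pmulr_rlt0 //; exact: (HT A AT).1.
  by move=> m Mm; rewrite -scalemxAl; exact: HA.
- move=> v v0; have [c vE] := pt_coord v D0.
  have [|A AT AD] := irr c.
    have [c1|] := eqVneq c.1 0; last by left.
    right; apply: contra_neq v0 => c2; by rewrite vE /pt c1 c2 !scale0r addr0.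
  exists (kap A *: cmat a b A); first by apply/mapP; exists A.
  rewrite -scalemxAl vE cmat_pt // (_ : det2 _ _ = kap A * det2 (pt a b c) (pt a b (lapp A c))).
    by rewrite det2_pt !mulf_neq0 // gt_eqF //; have [] := Hkap A AT.
  by rewrite /det2 !mxE; ring.
- move=> m Mm; have [c mE] := pt_coord m D0.
  have Hc : H c by rewrite /H -mE.
  have [u [v [x [y [[Hu Hv ef [x0 y0 xy1] cE] H0]]]]] := edge c Hc.
  have pt0 : pt a b (0, 0) = 0 by rewrite /pt !scale0r addr0.
  have M0 : M 0 by rewrite -pt0.
  have Mz w : M w -> M ((x + y) *: w).
    move=> Mw; have := cM 0 w (x + y) M0 Mw; rewrite scaler0 add0r; apply => //; lra.
  have [A [Au [Av [l [r [[AT AuT AvT] l0 r0 [Al Ar] [Auu Avv]]]]]]] := ef.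
  exists ((x + y) *: pt a b u), ((x + y) *: pt a b v), (y / (x + y)); split.
  + exact: Mz.
  + exact: Mz.
  + have [e0|] := eqVneq (x + y) 0; first by rewrite e0 invr0 mulr0 lexx ler01.
    move=> xy0; have xyp : 0 < x + y by rewrite lt_neqAle eq_sym xy0 addr_ge0.
    by rewrite divr_ge0 ?addr_ge0 //= ler_pdivrMr // mul1r lerDr.
  + rewrite mE cE -scalerBr scalerA.
    have -> : y / (x + y) * (x + y) = y.
      have [e0|xy0] := eqVneq (x + y) 0; last by rewrite mulfVK.
      by rewrite e0 mulr0; lra.
    by rewrite /pt; apply/matrixP => i j; rewrite !mxE /=; ring.
  + have memT B : B \in Ts -> [set` [seq kap A *: cmat a b A | A <- Ts]] (kap B *: cmat a b B).
      by move=> BT; apply/mapP; exists B.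
    have [kA _] := Hkap A AT.
    exists (kap A *: cmat a b A), (kap Au *: cmat a b Au), (kap Av *: cmat a b Av), (kap A * l), (kap A * r).
    split.
    * by split; exact: memT.
    * by rewrite mulr_ge0 // ltW.
    * by rewrite mulr_ge0 // ltW.
    * rewrite -!scalemxAl -!scalemxAr !cmat_pt // Al Ar.
      by split; rewrite /pt; apply/matrixP => i j; rewrite !mxE /=; ring.
    * by rewrite -!scalemxAl -!scalemxAr !cmat_pt // Auu Avv pt0 !scaler0.
Qed.

End Coordinates.

(** * Inward moves at a vertex, and the triangle *)

Section Configurations.
Context (R : realType).
Implicit Types (H : R * R -> Prop) (cs : seq (R * R)) (Ts : seq (R * R * R * R)).

Lemma all_nil (T : eqType) (P : T -> Prop) : forall x, x \in [::] -> P x.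
Proof. by []. Qed.

Lemma all_cons (T : eqType) (P : T -> Prop) a s : P a ->
  (forall x, x \in s -> P x) -> forall x, x \in a :: s -> P x.
Proof. by move=> Pa Ps x; rewrite inE => /orP[/eqP ->|/Ps]. Qed.

Lemma comb0 H cs (u v : R * R) (x y X Y : R) : conv_pred H cs -> H (0, 0) -> H u -> H v ->
  0 <= x -> 0 <= y -> x + y <= 1 -> X = x * u.1 + y * v.1 -> Y = x * u.2 + y * v.2 ->
  H (X, Y).
Proof.
move=> [_ cH _] H0 Hu Hv x0 y0 xy -> ->.
have [e0|ne] := eqVneq (x + y) 0.
  have -> : x = 0 by lra.
  have -> : y = 0 by lra.
  by rewrite !mul0r addr0.
have xyp : 0 < x + y by rewrite lt_neqAle eq_sym ne addr_ge0.
have t0 : 0 <= y / (x + y) by rewrite divr_ge0 // ltW.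
have t1 : y / (x + y) <= 1 by rewrite ler_pdivrMr // mul1r lerDr.
have := cH _ _ _ H0 (cH _ _ _ Hu Hv t0 t1) (addr_ge0 x0 y0) xy => /=.
by congr (H (_, _)); field.
Qed.

(** A velocity at [c] points inwards when it is a nonnegative combination of the directions towards
    another point [c'] and towards the origin: [p] and [g] are the two weights. The step
    [(1 + p + g)^-1] keeps the result a convex combination of [c], [c'] and 0. *)
Lemma move_in H cs (c c' d : R * R) (p g : R) : conv_pred H cs -> H (0, 0) -> H c -> H c' ->
  0 <= p -> 0 <= g -> d.1 = p * (c'.1 - c.1) - g * c.1 -> d.2 = p * (c'.2 - c.2) - g * c.2 ->
  exists2 k, 0 < k & H (c.1 + k * d.1, c.2 + k * d.2).
Proof.
move=> cH H0 Hc Hc' p0 g0 -> ->; have k0 : 0 < 1 + p + g by lra.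
exists (1 + p + g)^-1; first by rewrite invr_gt0.
apply: (comb0 (x := 1 - (p + g) / (1 + p + g)) (y := p / (1 + p + g)) cH H0 Hc Hc').
- by rewrite subr_ge0 ler_pdivrMr //; lra.
- by rewrite divr_ge0 // ltW.
- rewrite -addrA gerDl addrC -mulrBl mulr_le0_ge0 ?invr_ge0 //; lra.
- by field; exact: lt0r_neq0.
- by field; exact: lt0r_neq0.
Qed.

Lemma move_stay H (c d : R * R) : H c -> d.1 = 0 -> d.2 = 0 ->
  exists2 k, 0 < k & H (c.1 + k * d.1, c.2 + k * d.2).
Proof. by move=> Hc -> ->; exists 1 => //; rewrite mulr0 !addr0; case: c Hc. Qed.

Lemma zero_of_conv H cs u v t : conv_pred H cs -> H u -> H v -> 0 <= t -> t <= 1 ->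
  (1 - t) * u.1 + t * v.1 = 0 -> (1 - t) * u.2 + t * v.2 = 0 -> H (0, 0).
Proof.
by move=> [_ cH _] Hu Hv t0 t1 e1 e2; have := cH _ _ _ Hu Hv t0 t1; rewrite e1 e2.
Qed.

Lemma sum_le1 (x y k z : R) : 0 < k -> z <= k -> (x + y) * k = z -> x + y <= 1.
Proof.
by move=> k0 zk e; rewrite -(ler_pM2r k0) e mul1r.
Qed.

Lemma edge_flow2I Ts A Au Av (l r : R) u v : A \in Ts -> Au \in Ts -> Av \in Ts ->
  0 <= l -> 0 <= r ->
  lapp A u = (l * (v.1 - u.1), l * (v.2 - u.2)) ->
  lapp A v = (r * (u.1 - v.1), r * (u.2 - v.2)) ->
  lapp Au u = (0, 0) -> lapp Av v = (0, 0) -> edge_flow2 Ts u v.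
Proof. by move=> *; exists A, Au, Av, l, r. Qed.

(** Each of the three matrices annihilates one vertex and moves the other two towards each other. It
    is thus both the wait at that vertex and the sweep of the opposite edge. *)
Lemma copy_triangle (a b o : 'cV[R]_2) : det2 a b != 0 ->
  let vs := [seq o + pt a b c | c <- [:: (1, 0); (0, 1); (-1, -1)]] in
  interior (convex_hull [set` vs]) !=set0 -> has_realizable_copy (convex_hull [set` vs]).
Proof.
move=> D0 vs iP.
pose TA : R * R * R * R := (0, -1, 0, -2).
pose TB : R * R * R * R := (-2, 0, -1, 0).
pose TC : R * R * R * R := (-1, 1, 1, -1).
apply: (copy_coord (Ts := [:: TA; TB; TC]) D0 iP) => H cH.
have [HA HB HC] : [/\ H (1, 0), H (0, 1) & H (-1, -1)].
  by case: cH => h _ _; split; apply: h; rewrite !inE eqxx ?orbT.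
have H0 : H (0, 0).
  have Hm : H (1 / 2, 1 / 2).
    case: cH => _ h _; have /= := @h _ _ (1 / 2) HA HB; rewrite (_ : (1 - 1 / 2) * 1 + 1 / 2 * 0 = 1 / 2); last by field.
    by rewrite (_ : (1 - 1 / 2) * 0 + 1 / 2 * 1 = 1 / 2); [apply; lra | field].
  by apply: (zero_of_conv cH Hm HC (t := 1 / 3)) => /=; [lra|lra|field|field].
split.
- apply: all_cons; last apply: all_cons; last apply: all_cons; last exact: all_nil;
  (split; [rewrite /=; lra|apply: all_cons; last apply: all_cons; last apply: all_cons; last exact: all_nil]).
  + by apply: (move_stay HA); rewrite /lapp /=; ring.
  + by apply: (move_in cH H0 HB HC (p := 1) (g := 0)); rewrite /lapp /= //; ring.
  + by apply: (move_in cH H0 HC HB (p := 1) (g := 0)); rewrite /lapp /= //; ring.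
  + by apply: (move_in cH H0 HA HC (p := 1) (g := 0)); rewrite /lapp /= //; ring.
  + by apply: (move_stay HB); rewrite /lapp /=; ring.
  + by apply: (move_in cH H0 HC HA (p := 1) (g := 0)); rewrite /lapp /= //; ring.
  + by apply: (move_in cH H0 HA HB (p := 1) (g := 0)); rewrite /lapp /= //; ring.
  + by apply: (move_in cH H0 HB HA (p := 1) (g := 0)); rewrite /lapp /= //; ring.
  + by apply: (move_stay HC); rewrite /lapp /=; ring.
- move=> [x y] /= xy0.
  have [e|ne] := eqVneq (x * (lapp TB (x, y)).2 - y * (lapp TB (x, y)).1) 0; last first.
    by exists TB => //; rewrite !inE eqxx ?orbT.
  exists TA; first by rewrite !inE eqxx.
  move: e; rewrite /lapp /= => e; apply/eqP => e'.
  have : x * (2 * y - x) = 0 by rewrite -[RHS]e; ring.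
  have : y * (y - 2 * x) = 0 by rewrite -[RHS]e'; ring.
  move=> /eqP; rewrite mulf_eq0 => /orP[]/eqP h1 /eqP; rewrite mulf_eq0 => /orP[]/eqP h2;
    (have ex : x = 0 by lra); (have ey : y = 0 by lra);
    by case: xy0; rewrite ?ex ?ey eqxx.
- have ef A Au Av (l r : R) u v : A \in [:: TA; TB; TC] -> Au \in [:: TA; TB; TC] ->
      Av \in [:: TA; TB; TC] -> 0 <= l -> 0 <= r ->
      lapp A u = (l * (v.1 - u.1), l * (v.2 - u.2)) ->
      lapp A v = (r * (u.1 - v.1), r * (u.2 - v.2)) ->
      lapp Au u = (0, 0) -> lapp Av v = (0, 0) -> edge_flow2 [:: TA; TB; TC] u v.
    by move=> *; exists A, Au, Av, l, r.
  move=> [x y] Hc.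
  have hp (p q k : R) : p * 1 + q * 0 <= k -> p * 0 + q * 1 <= k -> p * -1 + q * -1 <= k ->
      p * x + q * y <= k.
    move=> h1 h2 h3; case: cH => _ _ h; apply: (h _ _ _ _ _ Hc).
    by apply: all_cons => //; apply: all_cons => //; apply: all_cons => //; exact: all_nil.
  have [yx|xy] := leP y x; [have [y0|y0] := leP 0 y | have [x0|x0] := leP 0 x].
  + exists (1, 0), (0, 1), x, y; split => //; split => //=.
    * by apply: (@ef TC TA TB 1 1); rewrite ?inE ?eqxx ?orbT // /lapp /=; congr (_, _); ring.
    * by have := hp 1 1 1; split; lra.
    * by congr (_, _); ring.
  + exists (-1, -1), (1, 0), (- y), (x - y); split => //; split => //=.
    * by apply: (@ef TB TC TA 1 1); rewrite ?inE ?eqxx ?orbT // /lapp /=; congr (_, _); ring.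
    * by have := hp 1 (-2) 1; split; lra.
    * by congr (_, _); ring.
  + exists (1, 0), (0, 1), x, y; split => //; split => //=.
    * by apply: (@ef TC TA TB 1 1); rewrite ?inE ?eqxx ?orbT // /lapp /=; congr (_, _); ring.
    * by have := hp 1 1 1; split; lra.
    * by congr (_, _); ring.
  + exists (-1, -1), (0, 1), (- x), (y - x); split => //; split => //=.
    * by apply: (@ef TA TC TB 1 1); rewrite ?inE ?eqxx ?orbT // /lapp /=; congr (_, _); ring.
    * by have := hp (-2) 1 1; split; lra.
    * by congr (_, _); ring.
Qed.

End Configurations.

(** * Quadrilaterals, with the diagonals as axes *)

Section Quadrilateral.
Context (R : realType).

(** The sweeps [T1] to [T4] have their image along an edge and a diagonal as kernel. Such a matrix
    fixes one end of the edge, pulls the other end to it and displaces one further vertex; comparing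
    [c] with [d], or [c * d] with 1, tells for which diagonal that vertex is displaced inwards. *)
Lemma copy_quadrilateral (a b o : 'cV[R]_2) (c d : R) : det2 a b != 0 -> 0 < c -> 0 < d ->
  let vs := [seq o + pt a b c | c <- [:: (1, 0); (0, 1); (- c, 0); (0, - d)]] in
  interior (convex_hull [set` vs]) !=set0 -> has_realizable_copy (convex_hull [set` vs]).
Proof.
move=> D0 c0 d0 vs iP.
have cd0 : 0 < c + d by lra.
have cn0 : c != 0 by exact: lt0r_neq0.
have dn0 : d != 0 by exact: lt0r_neq0.
have cdn0 : c + d != 0 by exact: lt0r_neq0.
have cdp : 0 < c * d by exact: mulr_gt0.
(* Opaque names, since [lra] would otherwise unfold the tuples. *)
have [KA eKA] : exists A : R * R * R * R, A = (0, 0, 0, -1) by exists (0, 0, 0, -1).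
have [KB eKB] : exists A : R * R * R * R, A = (-1, 0, 0, 0) by exists (-1, 0, 0, 0).
(* [KA] and [KB] are the waits on the two diagonals. The invariant lines of [KA] are the two axes;
   [SA] tilts the first axis and [SB] the second, which gives irreducibility. *)
have [SA eSA] : exists A : R * R * R * R, A = (-1, 0, d / (c + d), -1) by exists (-1, 0, d / (c + d), -1).
have [SB eSB] : exists A : R * R * R * R, A = (-1, c / (c + d), 0, -1) by exists (-1, c / (c + d), 0, -1).
have [T1 eT1] : exists A : R * R * R * R, (d <= c /\ A = (0, 1, 0, -1)) \/ (c <= d /\ A = (-1, 0, 1, 0)).
  by have /orP[h|h] := le_total (d) (c); eexists; [left|right].
have [T2 eT2] : exists A : R * R * R * R, (c * d <= 1 /\ A = (0, - c, 0, -1)) \/ (1 <= c * d /\ A = (- c, 0, -1, 0)).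
  by have /orP[h|h] := le_total (c * d) (1); eexists; [left|right].
have [T3 eT3] : exists A : R * R * R * R, (d <= c /\ A = (- c, 0, d, 0)) \/ (c <= d /\ A = (0, c, 0, - d)).
  by have /orP[h|h] := le_total (d) (c); eexists; [left|right].
have [T4 eT4] : exists A : R * R * R * R, (c * d <= 1 /\ A = (-1, 0, - d, 0)) \/ (1 <= c * d /\ A = (0, -1, 0, - d)).
  by have /orP[h|h] := le_total (c * d) (1); eexists; [left|right].
pose Ts := [:: KA; KB; SA; SB; T1; T2; T3; T4].
apply: (copy_coord (Ts := Ts) D0 iP) => H cH.
have [HA HB HC HD] : [/\ H (1, 0), H (0, 1), H (- c, 0) & H (0, - d)].
  by case: cH => h _ _; split; apply: h; rewrite !inE eqxx ?orbT.
have H0 : H (0, 0).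
  apply: (zero_of_conv cH HA HC (t := (1 + c)^-1)) => /=.
  - by rewrite invr_ge0; lra.
  - by rewrite invf_le1; lra.
  - by field; rewrite gt_eqF //; lra.
  - by field; rewrite gt_eqF //; lra.
have dc0 : d <= c -> 0 <= 1 - d / c by move=> h; rewrite subr_ge0 ler_pdivrMr // mul1r.
have cd1 : c <= d -> 0 <= 1 - c / d by move=> h; rewrite subr_ge0 ler_pdivrMr // mul1r.
have i1 : 1 <= c * d -> 0 <= c - d^-1.
  by move=> h; rewrite subr_ge0 -div1r ler_pdivrMr.
have i2 : 1 <= c * d -> 0 <= d - c^-1.
  by move=> h; rewrite subr_ge0 -div1r ler_pdivrMr // mulrC.
have r1 : 0 <= d / (c + d) by rewrite divr_ge0 // ltW.
have r2 : 0 <= c / (c + d) by rewrite divr_ge0 // ltW.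
have r3 : 0 <= d / c by rewrite divr_ge0 // ltW.
have r4 : 0 <= c / d by rewrite divr_ge0 // ltW.
have r5 : 0 <= c^-1 by rewrite invr_ge0 ltW.
have r6 : 0 <= d^-1 by rewrite invr_ge0 ltW.
have r7 : 1 - d / (c + d) = c / (c + d) by field.
have r8 : 1 - c / (c + d) = d / (c + d) by field.
have sq1 : 0 <= c * c by apply: mulr_ge0; exact: ltW.
have sq2 : 0 <= d * d by apply: mulr_ge0; exact: ltW.
split.
- apply: all_cons; last apply: all_cons; last apply: all_cons; last apply: all_cons;
  last apply: all_cons; last apply: all_cons; last apply: all_cons; last apply: all_cons;
  last exact: all_nil.
  + rewrite eKA; split; first by clear; rewrite /=; lra.
    apply: all_cons; last apply: all_cons; last apply: all_cons; last apply: all_cons; last exact: all_nil.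
    * by apply: (move_stay HA); rewrite /lapp /=; ring.
    * by apply: (move_in cH H0 HB HB (p := 0) (g := 1)); rewrite /lapp /= //; ring.
    * by apply: (move_stay HC); rewrite /lapp /=; ring.
    * by apply: (move_in cH H0 HD HD (p := 0) (g := 1)); rewrite /lapp /= //; ring.
  + rewrite eKB; split; first by clear; rewrite /=; lra.
    apply: all_cons; last apply: all_cons; last apply: all_cons; last apply: all_cons; last exact: all_nil.
    * by apply: (move_in cH H0 HA HA (p := 0) (g := 1)); rewrite /lapp /= //; ring.
    * by apply: (move_stay HB); rewrite /lapp /=; ring.
    * by apply: (move_in cH H0 HC HC (p := 0) (g := 1)); rewrite /lapp /= //; ring.
    * by apply: (move_stay HD); rewrite /lapp /=; ring.
  + rewrite eSA; split; first by clear; rewrite /=; lra.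
    apply: all_cons; last apply: all_cons; last apply: all_cons; last apply: all_cons; last exact: all_nil.
    * by apply: (move_in cH H0 HA HB (p := d / (c + d)) (g := c / (c + d))); rewrite /lapp /= //; field.
    * by apply: (move_in cH H0 HB HB (p := 0) (g := 1)); rewrite /lapp /= //; ring.
    * by apply: (move_in cH H0 HC HD (p := c / (c + d)) (g := d / (c + d))); rewrite /lapp /= //; field.
    * by apply: (move_in cH H0 HD HD (p := 0) (g := 1)); rewrite /lapp /= //; ring.
  + rewrite eSB; split; first by clear; rewrite /=; lra.
    apply: all_cons; last apply: all_cons; last apply: all_cons; last apply: all_cons; last exact: all_nil.
    * by apply: (move_in cH H0 HA HA (p := 0) (g := 1)); rewrite /lapp /= //; ring.
    * by apply: (move_in cH H0 HB HA (p := c / (c + d)) (g := d / (c + d))); rewrite /lapp /= //; field.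
    * by apply: (move_in cH H0 HC HC (p := 0) (g := 1)); rewrite /lapp /= //; ring.
    * by apply: (move_in cH H0 HD HC (p := d / (c + d)) (g := c / (c + d))); rewrite /lapp /= //; field.
  + case: eT1 => -[dc ->]; (split; first by clear -c0 d0; rewrite /=; lra);
    (apply: all_cons; last apply: all_cons; last apply: all_cons; last apply: all_cons; last exact: all_nil).
    * by apply: (move_stay HA); rewrite /lapp /=; ring.
    * by apply: (move_in cH H0 HB HA (p := 1) (g := 0)); rewrite /lapp /= //; ring.
    * by apply: (move_stay HC); rewrite /lapp /=; ring.
    * by apply: (move_in cH H0 HD HC (p := d / c) (g := 1 - d / c)); rewrite /lapp /= ?dc0 //; field.
    * by apply: (move_in cH H0 HA HB (p := 1) (g := 0)); rewrite /lapp /= //; ring.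
    * by apply: (move_stay HB); rewrite /lapp /=; ring.
    * by apply: (move_in cH H0 HC HD (p := c / d) (g := 1 - c / d)); rewrite /lapp /= ?cd1 //; field.
    * by apply: (move_stay HD); rewrite /lapp /=; ring.
  + case: eT2 => -[dc ->]; (split; first by clear -c0 d0; rewrite /=; lra);
    (apply: all_cons; last apply: all_cons; last apply: all_cons; last apply: all_cons; last exact: all_nil).
    * by apply: (move_stay HA); rewrite /lapp /=; ring.
    * by apply: (move_in cH H0 HB HC (p := 1) (g := 0)); rewrite /lapp /= //; ring.
    * by apply: (move_stay HC); rewrite /lapp /=; ring.
    * by apply: (move_in cH H0 HD HA (p := c * d) (g := 1 - c * d)); rewrite /lapp /= ?subr_ge0 ?(ltW cdp) //; ring.
    * by apply: (move_in cH H0 HA HD (p := d^-1) (g := c - d^-1)); rewrite /lapp /= ?i1 //; field.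
    * by apply: (move_stay HB); rewrite /lapp /=; ring.
    * by apply: (move_in cH H0 HC HB (p := c) (g := 0)); rewrite /lapp /= ?(ltW c0) //; ring.
    * by apply: (move_stay HD); rewrite /lapp /=; ring.
  + case: eT3 => -[dc ->]; (split; first by clear -c0 d0; rewrite /=; lra);
    (apply: all_cons; last apply: all_cons; last apply: all_cons; last apply: all_cons; last exact: all_nil).
    * by apply: (move_in cH H0 HA HB (p := d) (g := c - d)); rewrite /lapp /= ?subr_ge0 ?(ltW d0) //; ring.
    * by apply: (move_stay HB); rewrite /lapp /=; ring.
    * by apply: (move_in cH H0 HC HD (p := c) (g := 0)); rewrite /lapp /= ?(ltW c0) //; ring.
    * by apply: (move_stay HD); rewrite /lapp /=; ring.
    * by apply: (move_stay HA); rewrite /lapp /=; ring.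
    * by apply: (move_in cH H0 HB HA (p := c) (g := d - c)); rewrite /lapp /= ?subr_ge0 ?(ltW c0) //; ring.
    * by apply: (move_stay HC); rewrite /lapp /=; ring.
    * by apply: (move_in cH H0 HD HC (p := d) (g := 0)); rewrite /lapp /= ?(ltW d0) //; ring.
  + case: eT4 => -[dc ->]; (split; first by clear -c0 d0; rewrite /=; lra);
    (apply: all_cons; last apply: all_cons; last apply: all_cons; last apply: all_cons; last exact: all_nil).
    * by apply: (move_in cH H0 HA HD (p := 1) (g := 0)); rewrite /lapp /= //; ring.
    * by apply: (move_stay HB); rewrite /lapp /=; ring.
    * by apply: (move_in cH H0 HC HB (p := c * d) (g := 1 - c * d)); rewrite /lapp /= ?subr_ge0 ?(ltW cdp) //; ring.
    * by apply: (move_stay HD); rewrite /lapp /=; ring.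
    * by apply: (move_stay HA); rewrite /lapp /=; ring.
    * by apply: (move_in cH H0 HB HC (p := c^-1) (g := d - c^-1)); rewrite /lapp /= ?i2 //; field.
    * by apply: (move_stay HC); rewrite /lapp /=; ring.
    * by apply: (move_in cH H0 HD HA (p := d) (g := 0)); rewrite /lapp /= ?(ltW d0) //; ring.
- move=> [x y] /= xy0.
  have [ey|ny] := eqVneq y 0.
    exists SA; first by rewrite !inE eqxx ?orbT.
    have nx : x != 0 by case: xy0 => //; rewrite ey eqxx.
    rewrite eSA /lapp /= ey (_ : _ - _ = x * x * (d / (c + d))); last by ring.
    by rewrite !mulf_neq0 // invr_neq0.
  have [ex|nx] := eqVneq x 0.
    exists SB; first by rewrite !inE eqxx ?orbT.
    rewrite eSB /lapp /= ex (_ : _ - _ = - (y * y * (c / (c + d)))); last by ring.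
    by rewrite oppr_eq0 !mulf_neq0 // invr_neq0.
  exists KA; first by rewrite !inE eqxx ?orbT.
  rewrite eKA /lapp /= (_ : _ - _ = - (x * y)); last by ring.
  by rewrite oppr_eq0 mulf_neq0.
- move=> [x y] Hc.
  have hp (p q k : R) : p * 1 + q * 0 <= k -> p * 0 + q * 1 <= k -> p * - c + q * 0 <= k ->
      p * 0 + q * - d <= k -> p * x + q * y <= k.
    move=> h1 h2 h3 h4; case: cH => _ _ h; apply: (h _ _ _ _ _ Hc).
    by apply: all_cons => //; apply: all_cons => //; apply: all_cons => //; apply: all_cons => //; exact: all_nil.
  have /orP[x0|x0] := le_total 0 x; have /orP[y0|y0] := le_total 0 y.
  + exists (1, 0), (0, 1), x, y; split => //; split => //=.
    * case: eT1 => -[dc eT1].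
        by apply: (@edge_flow2I _ _ T1 KA KB 0 1); rewrite ?inE ?eqxx ?orbT // /lapp ?eT1 ?eKA ?eKB /=; congr (_, _); ring.
      by apply: (@edge_flow2I _ _ T1 KA KB 1 0); rewrite ?inE ?eqxx ?orbT // /lapp ?eT1 ?eKA ?eKB /=; congr (_, _); ring.
    * have {}hp := hp 1 1 1; clear -hp x0 y0 c0 d0; split; lra.
    * by congr (_, _); ring.
  + exists (0, - d), (1, 0), (- y / d), x; split => //; split => //=.
    * case: eT4 => -[dc eT4].
        by apply: (@edge_flow2I _ _ T4 KB KA 0 1); rewrite ?inE ?eqxx ?orbT // /lapp ?eT4 ?eKA ?eKB /=; congr (_, _); ring.
      by apply: (@edge_flow2I _ _ T4 KB KA d 0); rewrite ?inE ?eqxx ?orbT ?(ltW d0) // /lapp ?eT4 ?eKA ?eKB /=; congr (_, _); ring.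
    * have h : d * x + (- 1) * y <= d by apply: hp; rewrite ?mulr0 ?mulr1 ?add0r; clear -c0 d0 cdp; lra.
      split => //; first by rewrite divr_ge0 ?oppr_ge0 // ltW.
      by apply: (sum_le1 d0 h); field.
    * by congr (_, _); field.
  + exists (0, 1), (- c, 0), y, (- x / c); split => //; split => //=.
    * case: eT2 => -[dc eT2].
        by apply: (@edge_flow2I _ _ T2 KB KA 1 0); rewrite ?inE ?eqxx ?orbT // /lapp ?eT2 ?eKA ?eKB /=; congr (_, _); ring.
      by apply: (@edge_flow2I _ _ T2 KB KA 0 c); rewrite ?inE ?eqxx ?orbT ?(ltW c0) // /lapp ?eT2 ?eKA ?eKB /=; congr (_, _); ring.
    * have h : (- 1) * x + c * y <= c by apply: hp; rewrite ?mulr0 ?mulr1 ?add0r; clear -c0 d0 cdp; lra.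
      split => //; first by rewrite divr_ge0 ?oppr_ge0 // ltW.
      by apply: (sum_le1 c0 h); field.
    * by congr (_, _); field.
  + exists (- c, 0), (0, - d), (- x / c), (- y / d); split => //; split => //=.
    * case: eT3 => -[dc eT3].
        by apply: (@edge_flow2I _ _ T3 KA KB c 0); rewrite ?inE ?eqxx ?orbT ?(ltW c0) // /lapp ?eT3 ?eKA ?eKB /=; congr (_, _); ring.
      by apply: (@edge_flow2I _ _ T3 KA KB 0 d); rewrite ?inE ?eqxx ?orbT ?(ltW d0) // /lapp ?eT3 ?eKA ?eKB /=; congr (_, _); ring.
    * have h : (- d) * x + (- c) * y <= c * d by apply: hp; rewrite ?mulr0 ?mulr1 ?add0r; clear -c0 d0 cdp; lra.
      split; [by rewrite divr_ge0 ?oppr_ge0 // ltW|by rewrite divr_ge0 ?oppr_ge0 // ltW|].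
      by apply: (sum_le1 cdp h); field; rewrite dn0 cn0.
    * by congr (_, _); field; rewrite ?cn0 ?dn0.
Qed.

End Quadrilateral.

(** * Pentagons, with the origin at the crossing of two diagonals *)

Section CrossPentagon.
Context (R : realType).

Lemma move_scale (H : R * R -> Prop) (c d d' : R * R) (k : R) : 0 < k ->
  (exists2 t, 0 < t & H (c.1 + t * d.1, c.2 + t * d.2)) ->
  d'.1 = k * d.1 -> d'.2 = k * d.2 ->
  exists2 t, 0 < t & H (c.1 + t * d'.1, c.2 + t * d'.2).
Proof.
move=> k0 [t t0 Ht] -> ->; exists (t / k); first by rewrite divr_gt0.
by rewrite !mulrA mulfVK // lt0r_neq0.
Qed.

Lemma ge0_div (p q : R) : 0 < q -> 0 <= p -> 0 <= p / q.
Proof. by move=> q0 p0; rewrite divr_ge0 // ltW. Qed.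

(* The pentagon [A B C D E] in the coordinates in which the diagonals [AC] and
   [BE] are the axes. *)
Lemma copy_cross_pentagon (a b o : 'cV[R]_2) (c e x y : R) : det2 a b != 0 ->
  0 < c -> 0 < e -> 0 < x -> 0 < y ->
  x <= c * (1 + y) -> y <= e * (1 + x) -> c * e < x * e + y * c ->
  c <= x + y -> e <= x + y -> e * (x - c) <= y -> c * (y - e) <= x ->
  let vs := [seq o + pt a b c | c <- [:: (1, 0); (0, 1); (- c, 0); (- x, - y); (0, - e)]] in
  interior (convex_hull [set` vs]) !=set0 -> has_realizable_copy (convex_hull [set` vs]).
Proof.
move=> D0 c0 e0 x0 y0 cvx cvy cvd h1 h2 h3 h4 vs iP.
have [cn0 en0 xn0 yn0] : [/\ c != 0, e != 0, x != 0 & y != 0] by split; exact: lt0r_neq0.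
have [c0' e0' x0' y0'] : [/\ 0 <= c, 0 <= e, 0 <= x & 0 <= y] by split; exact: ltW.
have yc0 : 0 < y * c by exact: mulr_gt0.
have xe0 : 0 < x * e by exact: mulr_gt0.
have ce0 : 0 < c * e by exact: mulr_gt0.
(* Each matrix is named after the edge it sweeps. The kernel of [AB] is the line through [D], that
   of [CD] the diagonal [AC], that of [DE] the diagonal [BE], so these three also provide a wait at
   every vertex. For [BC] and [EA] the kernel is one of the two diagonals, chosen as for a
   quadrilateral. *)
have [AB eAB] : exists A : R * R * R * R, A = (- y, x, y, - x) by eexists.
have [CD eCD] : exists A : R * R * R * R, A = (0, c - x, 0, - y) by eexists.
have [DE eDE] : exists A : R * R * R * R, A = (- x, 0, e - y, 0) by eexists.
have [BC eBC] : exists A : R * R * R * R,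
    (c * e <= 1 /\ A = (0, - c, 0, -1)) \/ (1 <= c * e /\ A = (- c, 0, -1, 0)).
  by have /orP[h|h] := le_total (c * e) 1; eexists; [left|right].
have [EA eEA] : exists A : R * R * R * R,
    (c * e <= 1 /\ A = (-1, 0, - e, 0)) \/ (1 <= c * e /\ A = (0, -1, 0, - e)).
  by have /orP[h|h] := le_total (c * e) 1; eexists; [left|right].
pose Ts := [:: AB; CD; DE; BC; EA].
apply: (copy_coord (Ts := Ts) D0 iP) => H cH.
have [HA HB HC HD HE] : [/\ H (1, 0), H (0, 1), H (- c, 0), H (- x, - y) & H (0, - e)].
  by case: cH => h _ _; split; apply: h; rewrite !inE eqxx ?orbT.
have H0 : H (0, 0).
  have c1 : 0 < 1 + c by clear -c0; lra.
  apply: (zero_of_conv cH HA HC (t := (1 + c)^-1)) => /=.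
  - by rewrite invr_ge0 ltW.
  - by rewrite invf_le1 // lerDl.
  - by field; rewrite lt0r_neq0.
  - by field; rewrite lt0r_neq0.
(* [(c, 1)] is the direction from [C] to [B]. At [D] it lies between the direction to the origin and
   that to [C] or [E], by [cvx] or [h4] respectively. [mve] is the mirror statement for the
   direction from [E] to [A]. *)
have mvc : exists2 t, 0 < t & H (- x + t * c, - y + t * 1).
  have /orP[h|h] := le_total (c * y) x.
    apply: (move_in (d := (c, 1)) (p := (x - c * y) / (y * c)) (g := (c * (1 + y) - x) / (y * c)) cH H0 HD HC).
    - by apply: ge0_div => //; rewrite subr_ge0.
    - by apply: ge0_div => //; rewrite subr_ge0.
    - by rewrite /=; field; rewrite yn0 cn0.
    - by rewrite /=; field; rewrite yn0 cn0.
  apply: (move_in (d := (c, 1)) (p := (c * y - x) / (x * e)) (g := (x - c * (y - e)) / (x * e)) cH H0 HD HE).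
  - by apply: ge0_div => //; rewrite subr_ge0.
  - by apply: ge0_div => //; rewrite subr_ge0.
  - by rewrite /=; field; rewrite xn0 en0.
  - by rewrite /=; field; rewrite xn0 en0.
have mve : exists2 t, 0 < t & H (- x + t * 1, - y + t * e).
  have /orP[h|h] := le_total (e * x) y.
    apply: (move_in (d := (1, e)) (p := (y - e * x) / (x * e)) (g := (e * (1 + x) - y) / (x * e)) cH H0 HD HE).
    - by apply: ge0_div => //; rewrite subr_ge0.
    - by apply: ge0_div => //; rewrite subr_ge0.
    - by rewrite /=; field; rewrite xn0 en0.
    - by rewrite /=; field; rewrite xn0 en0.
  apply: (move_in (d := (1, e)) (p := (e * x - y) / (y * c)) (g := (y - e * (x - c)) / (y * c)) cH H0 HD HC).
  - by apply: ge0_div => //; rewrite subr_ge0.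
  - by apply: ge0_div => //; rewrite subr_ge0.
  - by rewrite /=; field; rewrite yn0 cn0.
  - by rewrite /=; field; rewrite yn0 cn0.
split.
- apply: all_cons; last apply: all_cons; last apply: all_cons; last apply: all_cons;
  last apply: all_cons; last exact: all_nil.
  + rewrite eAB; split; first by clear -x0 y0; rewrite /=; lra.
    apply: all_cons; last apply: all_cons; last apply: all_cons; last apply: all_cons; last apply: all_cons; last exact: all_nil.
    * by apply: (move_in cH H0 HA HB (p := y) (g := 0)); rewrite /lapp /= //; ring.
    * by apply: (move_in cH H0 HB HA (p := x) (g := 0)); rewrite /lapp /= //; ring.
    * by apply: (move_in cH H0 HC HD (p := c) (g := x + y - c)); rewrite /lapp /= ?subr_ge0 //; ring.
    * by apply: (move_stay HD); rewrite /lapp /=; ring.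
    * by apply: (move_in cH H0 HE HD (p := e) (g := x + y - e)); rewrite /lapp /= ?subr_ge0 //; ring.
  + rewrite eCD; split; first by clear -y0; rewrite /=; lra.
    apply: all_cons; last apply: all_cons; last apply: all_cons; last apply: all_cons; last apply: all_cons; last exact: all_nil.
    * by apply: (move_stay HA); rewrite /lapp /=; ring.
    * have /orP[h|h] := le_total x c.
        by apply: (move_in cH H0 HB HA (p := c - x) (g := x + y - c)); rewrite /lapp /= ?subr_ge0 //; ring.
      apply: (move_in cH H0 HB HC (p := (x - c) / c) (g := (c * (1 + y) - x) / c)).
      - by apply: ge0_div => //; rewrite subr_ge0.
      - by apply: ge0_div => //; rewrite subr_ge0.
      - by rewrite /lapp /=; field.
      - by rewrite /lapp /=; field.
    * by apply: (move_stay HC); rewrite /lapp /=; ring.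
    * by apply: (move_in cH H0 HD HC (p := y) (g := 0)); rewrite /lapp /= //; ring.
    * have /orP[h|h] := le_total c x.
        by apply: (move_in cH H0 HE HA (p := e * (x - c)) (g := y - e * (x - c))); rewrite /lapp /= ?mulr_ge0 ?subr_ge0 //; ring.
      apply: (move_in cH H0 HE HC (p := e * (c - x) / c) (g := (x * e + y * c - c * e) / c)).
      - by apply: ge0_div => //; rewrite mulr_ge0 // subr_ge0.
      - by apply: ge0_div => //; rewrite subr_ge0 ltW.
      - by rewrite /lapp /=; field.
      - by rewrite /lapp /=; field.
  + rewrite eDE; split; first by clear -x0; rewrite /=; lra.
    apply: all_cons; last apply: all_cons; last apply: all_cons; last apply: all_cons; last apply: all_cons; last exact: all_nil.
    * have /orP[h|h] := le_total y e.
        by apply: (move_in cH H0 HA HB (p := e - y) (g := x + y - e)); rewrite /lapp /= ?subr_ge0 //; ring.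
      apply: (move_in cH H0 HA HE (p := (y - e) / e) (g := (e * (1 + x) - y) / e)).
      - by apply: ge0_div => //; rewrite subr_ge0.
      - by apply: ge0_div => //; rewrite subr_ge0.
      - by rewrite /lapp /=; field.
      - by rewrite /lapp /=; field.
    * by apply: (move_stay HB); rewrite /lapp /=; ring.
    * have /orP[h|h] := le_total e y.
        by apply: (move_in cH H0 HC HB (p := c * (y - e)) (g := x - c * (y - e))); rewrite /lapp /= ?mulr_ge0 ?subr_ge0 //; ring.
      apply: (move_in cH H0 HC HE (p := c * (e - y) / e) (g := (x * e + y * c - c * e) / e)).
      - by apply: ge0_div => //; rewrite mulr_ge0 // subr_ge0.
      - by apply: ge0_div => //; rewrite subr_ge0 ltW.
      - by rewrite /lapp /=; field.
      - by rewrite /lapp /=; field.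
    * by apply: (move_in cH H0 HD HE (p := x) (g := 0)); rewrite /lapp /= //; ring.
    * by apply: (move_stay HE); rewrite /lapp /=; ring.
  + case: eBC => -[h ->]; (split; first by clear -c0; rewrite /=; lra);
    (apply: all_cons; last apply: all_cons; last apply: all_cons; last apply: all_cons; last apply: all_cons; last exact: all_nil).
    * by apply: (move_stay HA); rewrite /lapp /=; ring.
    * by apply: (move_in cH H0 HB HC (p := 1) (g := 0)); rewrite /lapp /= //; ring.
    * by apply: (move_stay HC); rewrite /lapp /=; ring.
    * by apply: (move_scale (c := (- x, - y)) (d := (c, 1)) y0 mvc); rewrite /lapp /=; ring.
    * by apply: (move_in cH H0 HE HA (p := c * e) (g := 1 - c * e)); rewrite /lapp /= ?subr_ge0 ?(ltW ce0) //; ring.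
    * apply: (move_in cH H0 HA HE (p := e^-1) (g := (c * e - 1) / e)).
      - by rewrite invr_ge0.
      - by apply: ge0_div => //; rewrite subr_ge0.
      - by rewrite /lapp /=; field.
      - by rewrite /lapp /=; field.
    * by apply: (move_stay HB); rewrite /lapp /=; ring.
    * by apply: (move_in cH H0 HC HB (p := c) (g := 0)); rewrite /lapp /= //; ring.
    * by apply: (move_scale (c := (- x, - y)) (d := (c, 1)) x0 mvc); rewrite /lapp /=; ring.
    * by apply: (move_stay HE); rewrite /lapp /=; ring.
  + case: eEA => -[h ->]; (split; first by clear -e0; rewrite /=; lra);
    (apply: all_cons; last apply: all_cons; last apply: all_cons; last apply: all_cons; last apply: all_cons; last exact: all_nil).
    * by apply: (move_in cH H0 HA HE (p := 1) (g := 0)); rewrite /lapp /= //; ring.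
    * by apply: (move_stay HB); rewrite /lapp /=; ring.
    * by apply: (move_in cH H0 HC HB (p := c * e) (g := 1 - c * e)); rewrite /lapp /= ?subr_ge0 ?(ltW ce0) //; ring.
    * by apply: (move_scale (c := (- x, - y)) (d := (1, e)) x0 mve); rewrite /lapp /=; ring.
    * by apply: (move_stay HE); rewrite /lapp /=; ring.
    * by apply: (move_stay HA); rewrite /lapp /=; ring.
    * apply: (move_in cH H0 HB HC (p := c^-1) (g := (c * e - 1) / c)).
      - by rewrite invr_ge0.
      - by apply: ge0_div => //; rewrite subr_ge0.
      - by rewrite /lapp /=; field.
      - by rewrite /lapp /=; field.
    * by apply: (move_stay HC); rewrite /lapp /=; ring.
    * by apply: (move_scale (c := (- x, - y)) (d := (1, e)) y0 mve); rewrite /lapp /=; ring.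
    * by apply: (move_in cH H0 HE HA (p := e) (g := 0)); rewrite /lapp /= //; ring.
- move=> [X Y] /= XY0.
  have [e1|n1] := eqVneq (X * (lapp AB (X, Y)).2 - Y * (lapp AB (X, Y)).1) 0; last first.
    by exists AB => //; rewrite !inE eqxx.
  have [e2|n2] := eqVneq (X * (lapp CD (X, Y)).2 - Y * (lapp CD (X, Y)).1) 0; last first.
    by exists CD => //; rewrite !inE eqxx orbT.
  exists DE; first by rewrite !inE eqxx !orbT.
  apply/eqP => e3; move: e1 e2 e3; rewrite eAB eCD eDE /lapp /= => e1 e2 e3.
  have {}e1 : (X + Y) * (y * X - x * Y) = 0 by rewrite -[RHS]e1; ring.
  have {}e2 : Y * (y * X + (c - x) * Y) = 0 by apply/eqP; rewrite -oppr_eq0 -[X in _ == X]e2; apply/eqP; ring.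
  have {}e3 : X * ((e - y) * X + x * Y) = 0 by rewrite -[RHS]e3; ring.
  have [X0 Y0] : X = 0 /\ Y = 0.
    clear -xn0 yn0 cvd e1 e2 e3.
    have [Y0|Yn] := eqVneq Y 0.
      split=> //; move: e1; rewrite Y0 mulr0 subr0 addr0 mulrCA => /eqP.
      by rewrite mulf_eq0 (negbTE yn0) /= mulf_eq0 orbb => /eqP.
    have [X0|Xn] := eqVneq X 0.
      split=> //; move: e1; rewrite X0 mulr0 sub0r add0r mulrN => /eqP; rewrite oppr_eq0 mulrCA.
      by rewrite mulf_eq0 (negbTE xn0) /= mulf_eq0 orbb => /eqP.
    move: e2 => /eqP; rewrite mulf_eq0 (negbTE Yn) /= => /eqP e2.
    move: e3 => /eqP; rewrite mulf_eq0 (negbTE Xn) /= => /eqP e3.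
    (* Off the axes, an eigenvector of both [CD] and [DE] would be parallel to both edges, against
       the strict convexity [cvd] at [D]. *)
    have : (x * e + y * c - c * e) * Y = (e - y) * (y * X + (c - x) * Y) * -1 + y * ((e - y) * X + x * Y).
      by ring.
    rewrite e2 e3 !mulr0 mul0r addr0 => /eqP; rewrite mulf_eq0 (negbTE Yn) orbF subr_eq0 => /eqP h.
    by move: cvd; rewrite h ltxx.
  by case: XY0; rewrite ?X0 ?Y0 eqxx.
- move=> [X Y] Hc.
  have hp (p q k : R) : p * 1 + q * 0 <= k -> p * 0 + q * 1 <= k -> p * - c + q * 0 <= k ->
      p * - x + q * - y <= k -> p * 0 + q * - e <= k -> p * X + q * Y <= k.
    move=> g1 g2 g3 g4 g5; case: cH => _ _ h; apply: (h _ _ _ _ _ Hc).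
    by apply: all_cons => //; apply: all_cons => //; apply: all_cons => //; apply: all_cons => //; apply: all_cons => //; exact: all_nil.
  (* The five triangles with apex at the origin: three of them are quadrants, and the ray through
     [D] divides the remaining quadrant into two. *)
  have /orP[X0|X0] := le_total 0 X; have /orP[Y0|Y0] := le_total 0 Y; last first.
  + have /orP[XY|XY] := le_total (y * X) (x * Y).
      exists (- c, 0), (- x, - y), ((x * Y - y * X) / (y * c)), (- Y / y); split => //; split => //=.
      * by apply: (@edge_flow2I _ _ CD CD AB 0 y); rewrite ?inE ?eqxx ?orbT // /lapp ?eCD ?eAB /=; congr (_, _); ring.
      * have h : - y * X + (x - c) * Y <= y * c by apply: hp; clear -c0 e0 x0 y0 cvx cvd h1 yc0; lra.
        split; [by apply: ge0_div => //; rewrite subr_ge0|by apply: ge0_div => //; rewrite oppr_ge0|].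
        by apply: (sum_le1 yc0 h); field; rewrite ?yn0 ?cn0.
      * by congr (_, _); field; rewrite ?yn0 ?cn0.
    exists (- x, - y), (0, - e), (- X / x), ((y * X - x * Y) / (x * e)); split => //; split => //=.
    * by apply: (@edge_flow2I _ _ DE AB DE x 0); rewrite ?inE ?eqxx ?orbT // /lapp ?eDE ?eAB /=; congr (_, _); ring.
    * have h : (y - e) * X + - x * Y <= x * e by apply: hp; clear -c0 e0 x0 y0 cvy cvd h2 xe0; lra.
      split; [by apply: ge0_div => //; rewrite oppr_ge0|by apply: ge0_div => //; rewrite subr_ge0|].
      by apply: (sum_le1 xe0 h); field; rewrite ?xn0 ?en0.
    * by congr (_, _); field; rewrite ?xn0 ?en0.
  + exists (0, 1), (- c, 0), Y, (- X / c); split => //; split => //=.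
    * case: eBC => -[h eBC].
        by apply: (@edge_flow2I _ _ BC DE CD 1 0); rewrite ?inE ?eqxx ?orbT // /lapp ?eBC ?eDE ?eCD /=; congr (_, _); ring.
      by apply: (@edge_flow2I _ _ BC DE CD 0 c); rewrite ?inE ?eqxx ?orbT // /lapp ?eBC ?eDE ?eCD /=; congr (_, _); ring.
    * have h : (- 1) * X + c * Y <= c by apply: hp; clear -c0 e0 x0 y0 cvx ce0; lra.
      split; [by []|by apply: ge0_div => //; rewrite oppr_ge0|].
      by apply: (sum_le1 c0 h); field.
    * by congr (_, _); field.
  + exists (0, - e), (1, 0), (- Y / e), X; split => //; split => //=.
    * case: eEA => -[h eEA].
        by apply: (@edge_flow2I _ _ EA DE CD 0 1); rewrite ?inE ?eqxx ?orbT // /lapp ?eEA ?eDE ?eCD /=; congr (_, _); ring.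
      by apply: (@edge_flow2I _ _ EA DE CD e 0); rewrite ?inE ?eqxx ?orbT // /lapp ?eEA ?eDE ?eCD /=; congr (_, _); ring.
    * have h : e * X + (- 1) * Y <= e by apply: hp; clear -c0 e0 x0 y0 cvy ce0; lra.
      split; [by apply: ge0_div => //; rewrite oppr_ge0|by []|].
      by apply: (sum_le1 e0 h); field.
    * by congr (_, _); field.
  + exists (1, 0), (0, 1), X, Y; split => //; split => //=.
    * by apply: (@edge_flow2I _ _ AB CD DE y x); rewrite ?inE ?eqxx ?orbT // /lapp ?eAB ?eDE ?eCD /=; congr (_, _); ring.
    * have h : 1 * X + 1 * Y <= 1 by apply: hp; clear -c0 e0 x0 y0; lra.
      by split=> //; move: h; rewrite !mul1r.
    * by congr (_, _); ring.
Qed.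

End CrossPentagon.

(** * Pentagons, with the origin at a vertex *)

Section FanPentagon.
Context (R : realType).

(* The pentagon [A B C D E] in the coordinates with origin [A] and basis
   [C - A], [D - A]; here [A] is farthest from each of the lines [BC], [CD], [DE]. *)
Lemma copy_fan_pentagon (a b o : 'cV[R]_2) (be de ep ph : R) : det2 a b != 0 ->
  0 < de -> 0 < ep -> be < 1 + de -> ph < 1 + ep -> 1 <= be -> 1 <= ph ->
  ph <= be * ph - de * ep -> be <= be * ph - de * ep ->
  be * ph - de * ep <= be + ph - 1 -> de <= be -> ep <= ph ->
  let vs := [seq o + pt a b c | c <- [:: (0, 0); (be, - de); (1, 0); (0, 1); (- ep, ph)]] in
  interior (convex_hull [set` vs]) !=set0 -> has_realizable_copy (convex_hull [set` vs]).
Proof.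
move=> D0 de0 ep0 cvb cvp be1 ph1 w1 w2 w3 deb epp vs iP.
have [den0 epn0] : de != 0 /\ ep != 0 by split; exact: lt0r_neq0.
have [be0 ph0] : 0 < be /\ 0 < ph by clear -be1 ph1; split; lra.
have W0 : 0 < be * ph - de * ep by exact: lt_le_trans w1.
(* [A1] and [A2] have image along [BC], [A5] and [A6] along [CD], [A3] and [A4] along [DE]; in each
   pair the two kernels pass through the two ends of the edge. The edges at [A] are covered as sides
   of the triangles [A B C] and [A D E]. *)
have [A1 eA1] : exists A : R * R * R * R, A = (0, be - 1, 0, - de) by eexists.
have [A2 eA2] : exists A : R * R * R * R,
  A = (de * (be - 1), be * (be - 1), - (de * de), - (de * be)) by eexists.
have [A3 eA3] : exists A : R * R * R * R,
  A = (- (ph * ep), - (ep * ep), ph * (ph - 1), ep * (ph - 1)) by eexists.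
have [A4 eA4] : exists A : R * R * R * R, A = (- ep, 0, ph - 1, 0) by eexists.
have [A5 eA5] : exists A : R * R * R * R, A = (0, 1, 0, -1) by eexists.
have [A6 eA6] : exists A : R * R * R * R, A = (-1, 0, 1, 0) by eexists.
pose Ts := [:: A1; A2; A3; A4; A5; A6].
apply: (copy_coord (Ts := Ts) D0 iP) => H cH.
have [H0 HB HC HD HE] : [/\ H (0, 0), H (be, - de), H (1, 0), H (0, 1) & H (- ep, ph)].
  by case: cH => h _ _; split; apply: h; rewrite !inE eqxx ?orbT.
(* In these names the letter is a vertex and the number a matrix: the image direction of that
   matrix, with the appropriate sign, points inwards at that vertex. *)
have mD1 : exists2 t, 0 < t & H (0 + t * (be - 1), 1 + t * - de).
  by apply: (move_in (d := (be - 1, - de)) (p := be - 1) (g := 1 + de - be) cH H0 HD HC);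
    rewrite /= ?subr_ge0 ?(ltW cvb) //; ring.
have mC3 : exists2 t, 0 < t & H (1 + t * - ep, 0 + t * (ph - 1)).
  by apply: (move_in (d := (- ep, ph - 1)) (p := ph - 1) (g := 1 + ep - ph) cH H0 HC HD);
    rewrite /= ?subr_ge0 ?(ltW cvp) //; ring.
have mE1 : exists2 t, 0 < t & H (- ep + t * (be - 1), ph + t * - de).
  apply: (move_in (d := (be - 1, - de)) (p := (be * ph - de * ep - ph) / ep)
    (g := (be + ph - 1 - (be * ph - de * ep)) / ep) cH H0 HE HD).
  - by apply: ge0_div => //; rewrite subr_ge0.
  - by apply: ge0_div => //; rewrite subr_ge0.
  - by rewrite /=; field.
  - by rewrite /=; field.
have mB3 : exists2 t, 0 < t & H (be + t * - ep, - de + t * (ph - 1)).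
  apply: (move_in (d := (- ep, ph - 1)) (p := (be * ph - de * ep - be) / de)
    (g := (be + ph - 1 - (be * ph - de * ep)) / de) cH H0 HB HC).
  - by apply: ge0_div => //; rewrite subr_ge0.
  - by apply: ge0_div => //; rewrite subr_ge0.
  - by rewrite /=; field.
  - by rewrite /=; field.
have mB5 : exists2 t, 0 < t & H (be + t * -1, - de + t * 1).
  apply: (move_in (d := (-1, 1)) (p := (be - de) / de) (g := (1 + de - be) / de) cH H0 HB HC).
  - by apply: ge0_div => //; rewrite subr_ge0.
  - by apply: ge0_div => //; rewrite subr_ge0 ltW.
  - by rewrite /=; field.
  - by rewrite /=; field.
have mE5 : exists2 t, 0 < t & H (- ep + t * 1, ph + t * -1).
  apply: (move_in (d := (1, -1)) (p := (ph - ep) / ep) (g := (1 + ep - ph) / ep) cH H0 HE HD).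
  - by apply: ge0_div => //; rewrite subr_ge0.
  - by apply: ge0_div => //; rewrite subr_ge0 ltW.
  - by rewrite /=; field.
  - by rewrite /=; field.
split.
- apply: all_cons; last apply: all_cons; last apply: all_cons; last apply: all_cons;
  last apply: all_cons; last apply: all_cons; last exact: all_nil.
  + rewrite eA1; split; first by clear -de0; rewrite /=; lra.
    apply: all_cons; last apply: all_cons; last apply: all_cons; last apply: all_cons; last apply: all_cons; last exact: all_nil.
    * by apply: (move_stay H0); rewrite /lapp /=; ring.
    * by apply: (move_in cH H0 HB HC (p := de) (g := 0)); rewrite /lapp /= ?(ltW de0) //; ring.
    * by apply: (move_stay HC); rewrite /lapp /=; ring.
    * by apply: (move_scale (c := (0, 1)) (d := (be - 1, - de)) ltr01 mD1); rewrite /lapp /=; ring.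
    * by apply: (move_scale (c := (- ep, ph)) (d := (be - 1, - de)) ph0 mE1); rewrite /lapp /=; ring.
  + rewrite eA2; split; first by clear -de0; rewrite /=; lra.
    apply: all_cons; last apply: all_cons; last apply: all_cons; last apply: all_cons; last apply: all_cons; last exact: all_nil.
    * by apply: (move_stay H0); rewrite /lapp /=; ring.
    * by apply: (move_stay HB); rewrite /lapp /=; ring.
    * by apply: (move_in cH H0 HC HB (p := de) (g := 0)); rewrite /lapp /= ?(ltW de0) //; ring.
    * by apply: (move_scale (c := (0, 1)) (d := (be - 1, - de)) be0 mD1); rewrite /lapp /=; ring.
    * by apply: (move_scale (c := (- ep, ph)) (d := (be - 1, - de)) W0 mE1); rewrite /lapp /=; ring.
  + rewrite eA3; split; first by clear -ep0; rewrite /=; lra.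
    apply: all_cons; last apply: all_cons; last apply: all_cons; last apply: all_cons; last apply: all_cons; last exact: all_nil.
    * by apply: (move_stay H0); rewrite /lapp /=; ring.
    * by apply: (move_scale (c := (be, - de)) (d := (- ep, ph - 1)) W0 mB3); rewrite /lapp /=; ring.
    * by apply: (move_scale (c := (1, 0)) (d := (- ep, ph - 1)) ph0 mC3); rewrite /lapp /=; ring.
    * by apply: (move_in cH H0 HD HE (p := ep) (g := 0)); rewrite /lapp /= ?(ltW ep0) //; ring.
    * by apply: (move_stay HE); rewrite /lapp /=; ring.
  + rewrite eA4; split; first by clear -ep0; rewrite /=; lra.
    apply: all_cons; last apply: all_cons; last apply: all_cons; last apply: all_cons; last apply: all_cons; last exact: all_nil.
    * by apply: (move_stay H0); rewrite /lapp /=; ring.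
    * by apply: (move_scale (c := (be, - de)) (d := (- ep, ph - 1)) be0 mB3); rewrite /lapp /=; ring.
    * by apply: (move_scale (c := (1, 0)) (d := (- ep, ph - 1)) ltr01 mC3); rewrite /lapp /=; ring.
    * by apply: (move_stay HD); rewrite /lapp /=; ring.
    * by apply: (move_in cH H0 HE HD (p := ep) (g := 0)); rewrite /lapp /= ?(ltW ep0) //; ring.
  + rewrite eA5; split; first by clear; rewrite /=; lra.
    apply: all_cons; last apply: all_cons; last apply: all_cons; last apply: all_cons; last apply: all_cons; last exact: all_nil.
    * by apply: (move_stay H0); rewrite /lapp /=; ring.
    * by apply: (move_scale (c := (be, - de)) (d := (-1, 1)) de0 mB5); rewrite /lapp /=; ring.
    * by apply: (move_stay HC); rewrite /lapp /=; ring.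
    * by apply: (move_in cH H0 HD HC (p := 1) (g := 0)); rewrite /lapp /= //; ring.
    * by apply: (move_scale (c := (- ep, ph)) (d := (1, -1)) ph0 mE5); rewrite /lapp /=; ring.
  + rewrite eA6; split; first by clear; rewrite /=; lra.
    apply: all_cons; last apply: all_cons; last apply: all_cons; last apply: all_cons; last apply: all_cons; last exact: all_nil.
    * by apply: (move_stay H0); rewrite /lapp /=; ring.
    * by apply: (move_scale (c := (be, - de)) (d := (-1, 1)) be0 mB5); rewrite /lapp /=; ring.
    * by apply: (move_in cH H0 HC HD (p := 1) (g := 0)); rewrite /lapp /= //; ring.
    * by apply: (move_stay HD); rewrite /lapp /=; ring.
    * by apply: (move_scale (c := (- ep, ph)) (d := (1, -1)) ep0 mE5); rewrite /lapp /=; ring.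
- move=> [X Y] /= XY0.
  have [q0|qn] := eqVneq (de * X + (be - 1) * Y) 0.
    have XYn : X + Y != 0.
      apply/eqP => h; have hX : X = - Y by clear -h; lra.
      move: q0; rewrite hX (_ : _ + _ = - (1 + de - be) * Y); last by ring.
      move=> /eqP; rewrite mulf_eq0 oppr_eq0 subr_eq0 (gt_eqF cvb) /= => /eqP Y0.
      by case: XY0; rewrite ?hX Y0 ?oppr0 eqxx.
    have [Y0|Yn] := eqVneq Y 0.
      have Xn : X != 0 by case: XY0 => //; rewrite Y0 eqxx.
      exists A6; first by rewrite !inE eqxx !orbT.
      by rewrite eA6 /lapp /= (_ : _ - _ = X * (X + Y)) ?mulf_neq0 //; ring.
    exists A5; first by rewrite !inE eqxx !orbT.
    by rewrite eA5 /lapp /= (_ : _ - _ = - (Y * (X + Y))) ?oppr_eq0 ?mulf_neq0 //; ring.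
  have [Y0|Yn] := eqVneq Y 0.
    have Xn : X != 0 by case: XY0 => //; rewrite Y0 eqxx.
    exists A2; first by rewrite !inE eqxx !orbT.
    rewrite eA2 /lapp /= (_ : _ - _ = - ((be * Y + de * X) * (de * X + (be - 1) * Y))); last by ring.
    by rewrite oppr_eq0 mulf_neq0 // Y0 mulr0 add0r mulf_neq0.
  exists A1; first by rewrite !inE eqxx.
  by rewrite eA1 /lapp /= (_ : _ - _ = - (Y * (de * X + (be - 1) * Y))) ?oppr_eq0 ?mulf_neq0 //; ring.
- move=> [X Y] Hc.
  have hp (p q k : R) : p * 0 + q * 0 <= k -> p * be + q * - de <= k -> p * 1 + q * 0 <= k ->
      p * 0 + q * 1 <= k -> p * - ep + q * ph <= k -> p * X + q * Y <= k.
    move=> g1 g2 g3 g4 g5; case: cH => _ _ h; apply: (h _ _ _ _ _ Hc).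
    by apply: all_cons => //; apply: all_cons => //; apply: all_cons => //; apply: all_cons => //; apply: all_cons => //; exact: all_nil.
  have hB : 0 <= de * X + be * Y.
    have : - de * X + - be * Y <= 0 by apply: hp; clear -de0 be0 W0; lra.
    by clear; lra.
  have hE : 0 <= ph * X + ep * Y.
    have : - ph * X + - ep * Y <= 0 by apply: hp; clear -ph0 ep0 W0; lra.
    by clear; lra.
  have /orP[Y0|Y0] := le_total Y 0.
    exists (be, - de), (1, 0), (- Y / de), ((de * X + be * Y) / de); split => //; split => //=.
    * by apply: (@edge_flow2I _ _ A1 A2 A1 de 0); rewrite ?inE ?eqxx ?orbT ?(ltW de0) // /lapp ?eA1 ?eA2 /=; congr (_, _); ring.
    * have h : de * X + (be - 1) * Y <= de by apply: hp; clear -de0 cvb w3; lra.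
      split; [by apply: ge0_div => //; rewrite oppr_ge0|by apply: ge0_div|].
      by apply: (sum_le1 de0 h); field.
    * by congr (_, _); field.
  have /orP[X0|X0] := le_total X 0.
    exists (0, 1), (- ep, ph), ((ph * X + ep * Y) / ep), (- X / ep); split => //; split => //=.
    * by apply: (@edge_flow2I _ _ A4 A4 A3 0 ep); rewrite ?inE ?eqxx ?orbT ?(ltW ep0) // /lapp ?eA3 ?eA4 /=; congr (_, _); ring.
    * have h : (ph - 1) * X + ep * Y <= ep by apply: hp; clear -ep0 cvp w3; lra.
      split; [by apply: ge0_div|by apply: ge0_div => //; rewrite oppr_ge0|].
      by apply: (sum_le1 ep0 h); field.
    * by congr (_, _); field.
  exists (1, 0), (0, 1), X, Y; split => //; split => //=.
  * by apply: (@edge_flow2I _ _ A6 A5 A6 1 0); rewrite ?inE ?eqxx ?orbT // /lapp ?eA5 ?eA6 /=; congr (_, _); ring.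
  * have h : 1 * X + 1 * Y <= 1 by apply: hp; clear -de0 ep0 cvb cvp; lra.
    by split=> //; move: h; rewrite !mul1r.
  * by congr (_, _); ring.
Qed.

End FanPentagon.

(** * Signed areas, convex position and cyclic order *)

Section Orientation.
Context (R : realType).
Implicit Types (A B C D E o a b u v w : 'cV[R]_2) (X : set 'cV[R]_2).

(* Twice the signed area of the triangle [A B C]. *)
Definition orient A B C := det2 (B - A) (C - A).

Lemma orient_pt o a b p q r :
  orient (o + pt a b p) (o + pt a b q) (o + pt a b r) =
  det2 a b * ((q.1 - p.1) * (r.2 - p.2) - (q.2 - p.2) * (r.1 - p.1)).
Proof. by rewrite /orient /det2 !mxE; ring. Qed.

Lemma orient_rot A B C : orient B C A = orient A B C.
Proof. by rewrite /orient /det2 !mxE; ring. Qed.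

Lemma orient_swap A B C : orient B A C = - orient A B C.
Proof. by rewrite /orient /det2 !mxE; ring. Qed.

Lemma orient_rot2 A B C : orient C A B = orient A B C.
Proof. by rewrite /orient /det2 !mxE; ring. Qed.

Lemma orient_swap2 A B C : orient A C B = - orient A B C.
Proof. by rewrite /orient /det2 !mxE; ring. Qed.

Lemma orient_swap3 A B C : orient C B A = - orient A B C.
Proof. by rewrite /orient /det2 !mxE; ring. Qed.

Lemma orient_four A B C D :
  orient A B C + orient C D A = orient A B D + orient B C D.
Proof. by rewrite /orient /det2 !mxE; ring. Qed.

(** Cramer's rule: the signed areas are the coefficients of the affine dependency of four points. *)
Lemma affine_dep A B C D :
  orient B C D *: A + orient A B D *: C = orient A C D *: B + orient A B C *: D.
Proof. by apply: col2P; rewrite /orient /det2 !mxE; ring. Qed.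

Definition conv_pos X := forall v, X v -> ~ convex_hull (X `\ v) v.

Lemma hull_mono X Y : X `<=` Y -> convex_hull X `<=` convex_hull Y.
Proof.
by move=> XY; apply: hull_min; [exact: hull_convex|move=> v /XY; exact: hull_mem].
Qed.

Lemma conv_pos_comb2 X A B C (p q : R) : conv_pos X -> X A -> X B -> X C ->
  B != A -> C != A -> 0 <= p -> 0 <= q -> 0 < p + q ->
  (p + q) *: A = p *: B + q *: C -> False.
Proof.
move=> cX XA XB XC BA CA p0 q0 pq e; apply: (cX A XA).
have AE : A = (1 - q / (p + q)) *: B + (q / (p + q)) *: C.
  rewrite (_ : 1 - _ = p / (p + q)); last by field; exact: lt0r_neq0.
  rewrite mulrC (mulrC q) -!scalerA -scalerDr -e scalerA mulVf ?scale1r //.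
  exact: lt0r_neq0.
rewrite [X in convex_hull _ X]AE; apply: hull_comb.
- by apply: hull_mem; split => //= e'; case/eqP: BA.
- by apply: hull_mem; split => //= e'; case/eqP: CA.
- by apply: ge0_div.
- by rewrite ler_pdivrMr // mul1r lerDr.
Qed.

Lemma conv_pos_comb3 X A B C D (p q r : R) : conv_pos X -> X A -> X B -> X C -> X D ->
  B != A -> C != A -> D != A -> 0 < p -> 0 < q -> 0 < r ->
  (p + q + r) *: A = p *: B + q *: C + r *: D -> False.
Proof.
move=> cX XA XB XC XD BA CA DA p0 q0 r0 e; apply: (cX A XA).
have s0 : 0 < p + q + r by lra.
have t0 : 0 < p + q by lra.
have AE : A = (1 - r / (p + q + r)) *: ((1 - q / (p + q)) *: B + (q / (p + q)) *: C) +
     (r / (p + q + r)) *: D.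
  apply: (scalerI (lt0r_neq0 s0)); rewrite e.
  by apply/matrixP => i j; rewrite !mxE; field; rewrite !lt0r_neq0.
rewrite [X in convex_hull _ X]AE; apply: hull_comb.
- apply: hull_comb; [| | |by rewrite ler_pdivrMr // mul1r lerDr ltW].
  + by apply: hull_mem; split => //= e'; case/eqP: BA.
  + by apply: hull_mem; split => //= e'; case/eqP: CA.
  + by apply: ge0_div => //; exact: ltW.
- by apply: hull_mem; split => //= e'; case/eqP: DA.
- by apply: ge0_div => //; exact: ltW.
- by rewrite ler_pdivrMr // mul1r lerDr ltW.
Qed.

(** Of three collinear points one is between the other two. With [n] the squared length of [B - A]
    and [t] its inner product with [C - A], the ratio [t / n] locates [C] on the line and decides
    which point is the middle one. *)
Lemma orient_neq0 X A B C : conv_pos X -> X A -> X B -> X C ->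
  A != B -> A != C -> B != C -> orient A B C != 0.
Proof.
move=> cX XA XB XC AB AC BC; apply/eqP => o0.
pose n := (B - A) 0 0 ^+ 2 + (B - A) 1 0 ^+ 2.
pose t := ((B - A) 0 0 * (C - A) 0 0 + (B - A) 1 0 * (C - A) 1 0).
have n0 : 0 < n.
  rewrite lt_neqAle addr_ge0 ?sqr_ge0 // andbT eq_sym paddr_eq0 ?sqr_ge0 // !sqrf_eq0.
  apply/negP => /andP[/eqP h1 /eqP h2]; case/eqP: AB; apply/esym/eqP; rewrite -subr_eq0.
  by apply/eqP; apply: col2P; rewrite ?h1 ?h2 mxE.
have eC : n *: (C - A) = t *: (B - A).
  move: o0; rewrite /orient /det2 /n /t; move: (B - A) (C - A) => u v e.
  apply: col2P; rewrite !mxE.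
    transitivity ((u 0 0 * v 0 0 + u 1 0 * v 1 0) * u 0 0 - u 1 0 * (u 0 0 * v 1 0 - u 1 0 * v 0 0)); first by ring.
    by rewrite e; ring.
  transitivity ((u 0 0 * v 0 0 + u 1 0 * v 1 0) * u 1 0 + u 0 0 * (u 0 0 * v 1 0 - u 1 0 * v 0 0)); first by ring.
  by rewrite e; ring.
have CA : C != A by rewrite eq_sym.
have BA : B != A by rewrite eq_sym.
have CB : C != B by rewrite eq_sym.
clearbody n t; have nC : n *: C = t *: (B - A) + n *: A by rewrite -eC -scalerDr subrK.
have [t0|t0] := ltP t 0.
  have [a1 a2 a3] : [/\ 0 <= - t, 0 <= n & 0 < - t + n] by clear -t0 n0; split; lra.
  apply: (conv_pos_comb2 cX XA XB XC BA CA a1 a2 a3); rewrite nC.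
  by apply/matrixP => i j; rewrite !mxE; ring.
have [tn|tn] := leP t n.
  have [a1 a3] : 0 <= n - t /\ 0 < n - t + t by clear -tn n0; split; lra.
  apply: (conv_pos_comb2 cX XC XA XB AC BC a1 t0 a3); rewrite subrK nC.
  by apply/matrixP => i j; rewrite !mxE; ring.
have [a1 a2 a3] : [/\ 0 <= t - n, 0 <= n & 0 < t - n + n] by clear -tn n0; split; lra.
apply: (conv_pos_comb2 cX XB XA XC AB CB a1 a2 a3); rewrite nC.
by apply/matrixP => i j; rewrite !mxE; ring.
Qed.

(** A dependency with a single negative coefficient puts the corresponding point inside the triangle
    of the other three. *)
Lemma dep_signs X A B C D (k p q r : R) : conv_pos X -> X A -> X B -> X C -> X D ->
  uniq [:: A; B; C; D] -> 0 < p -> 0 < q -> 0 < r -> k + p + q + r = 0 ->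
  (forall i, k * A i 0 + p * B i 0 + q * C i 0 + r * D i 0 = 0) -> False.
Proof.
move=> cX XA XB XC XD; rewrite /= !inE !negb_or -!andbA => /and5P[AB AC AD _ _] p0 q0 r0 s0 e.
apply: (conv_pos_comb3 cX XA XB XC XD _ _ _ p0 q0 r0); rewrite 1?eq_sym //.
have -> : p + q + r = - k by clear -s0; lra.
by apply: col2P; rewrite !mxE; [have := e 0 | have := e 1]; clear; lra.
Qed.

(* The affine dependency of four points in convex position has two positive and
   two negative coefficients. *)
Lemma orient_signs X A B C D : conv_pos X -> X A -> X B -> X C -> X D ->
  uniq [:: A; B; C; D] ->
  ((0 < orient B C D)%R + (0 < orient A B D)%R + ~~ (0 < orient A C D)%R +
   ~~ (0 < orient A B C)%R = 2)%N.
Proof.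
move=> cX XA XB XC XD un.
have dep i := congr1 (fun M : 'cV[R]_2 => M i 0) (affine_dep A B C D).
have sm := orient_four A B C D.
rewrite (_ : orient C D A = orient A C D) in sm; last exact: orient_rot.
have [AB AC AD [BC BD CD]] : [/\ A != B, A != C, A != D & [/\ B != C, B != D & C != D]].
  by move: un; rewrite /= !inE !negb_or -!andbA => /and5P[? ? ? ? /and3P[? ? _]].
have [h1 h2 h3 h4] : [/\ orient B C D != 0, orient A B D != 0, orient A C D != 0 & orient A B C != 0].
  by split; apply: (orient_neq0 cX).
have [u1 u2 u3] : [/\ uniq [:: B; A; C; D], uniq [:: C; A; B; D] & uniq [:: D; A; B; C]].
  split; rewrite /= !inE !negb_or !andbT.
  - by rewrite eq_sym AB BC BD AC AD CD.
  - by rewrite (eq_sym C A) (eq_sym C B) AB BC BD AC AD CD.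
  - by rewrite (eq_sym D A) (eq_sym D B) (eq_sym D C) AB BC BD AC AD CD.
move: h1 h2 h3 h4 dep sm; move: (orient B C D) (orient A B D) (orient A C D) (orient A B C).
move=> l1 l2 l3 l4 n1 n2 n3 n4 dep sm.
have {}dep i : l1 * A i 0 + l2 * C i 0 = l3 * B i 0 + l4 * D i 0.
  by have := dep i; rewrite !mxE.
have neg (l : R) : l != 0 -> l <= 0 -> l < 0 by rewrite lt_neqAle => -> ->.
have [p1|/(neg _ n1) p1] := ltP 0 l1; have [p2|/(neg _ n2) p2] := ltP 0 l2;
have [p3|/(neg _ n3) p3] := ltP 0 l3; have [p4|/(neg _ n4) p4] := ltP 0 l4 => //; exfalso; clear AB AC AD BC BD CD.
- by apply: (dep_signs (k := - l3) (p := l1) (q := l2) (r := - l4) cX XB XA XC XD u1); rewrite ?oppr_gt0 //;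
    [clear dep; lra | move=> i; have := dep i; clear; lra].
- by apply: (dep_signs (k := - l4) (p := l1) (q := - l3) (r := l2) cX XD XA XB XC u3); rewrite ?oppr_gt0 //;
    [clear dep; lra | move=> i; have := dep i; clear; lra].
- by clear dep; lra.
- by apply: (dep_signs (k := - l1) (p := l3) (q := - l2) (r := l4) cX XA XB XC XD un); rewrite ?oppr_gt0 //;
    [clear dep; lra | move=> i; have := dep i; clear; lra].
- by apply: (dep_signs (k := l2) (p := l1) (q := - l3) (r := - l4) cX XC XA XB XD u2); rewrite ?oppr_gt0 //;
    [clear dep; lra | move=> i; have := dep i; clear; lra].
- by apply: (dep_signs (k := - l2) (p := - l1) (q := l3) (r := l4) cX XC XA XB XD u2); rewrite ?oppr_gt0 //;
    [clear dep; lra | move=> i; have := dep i; clear; lra].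
- by apply: (dep_signs (k := l1) (p := - l3) (q := l2) (r := - l4) cX XA XB XC XD un); rewrite ?oppr_gt0 //;
    [clear dep; lra | move=> i; have := dep i; clear; lra].
- by clear dep; lra.
- by apply: (dep_signs (k := l4) (p := - l1) (q := l3) (r := - l2) cX XD XA XB XC u3); rewrite ?oppr_gt0 //;
    [clear dep; lra | move=> i; have := dep i; clear; lra].
- by apply: (dep_signs (k := l3) (p := - l1) (q := - l2) (r := l4) cX XB XA XC XD u1); rewrite ?oppr_gt0 //;
    [clear dep; lra | move=> i; have := dep i; clear; lra].
Qed.

Definition ccw4 A B C D := [/\ 0 < orient A B C, 0 < orient A B D, 0 < orient A C D &
  0 < orient B C D].

Definition ccw5 A B C D E :=
  [/\ 0 < orient A B C, 0 < orient A B D, 0 < orient A B E, 0 < orient A C D & 0 < orient A C E] /\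
  [/\ 0 < orient A D E, 0 < orient B C D, 0 < orient B C E, 0 < orient B D E & 0 < orient C D E].

Lemma lt0_of_le (l : R) : l != 0 -> l <= 0 -> l < 0.
Proof. by rewrite lt_neqAle => -> ->. Qed.

(** [orient_signs] leaves six of the sixteen sign patterns, one for each order of [B], [C], [D]
    after [A]. *)
Lemma ccw4_exists X A B C D : conv_pos X -> X A -> X B -> X C -> X D ->
  uniq [:: A; B; C; D] ->
  exists P Q S T, perm_eq [:: P; Q; S; T] [:: A; B; C; D] /\ ccw4 P Q S T.
Proof.
move=> cX XA XB XC XD un; have := orient_signs cX XA XB XC XD un.
have [AB AC AD [BC BD CD]] : [/\ A != B, A != C, A != D & [/\ B != C, B != D & C != D]].
  by move: un; rewrite /= !inE !negb_or -!andbA => /and5P[? ? ? ? /and3P[? ? _]].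
have n1 := orient_neq0 cX XA XB XC AB AC BC; have n2 := orient_neq0 cX XA XB XD AB AD BD.
have n3 := orient_neq0 cX XA XC XD AC AD CD; have n4 := orient_neq0 cX XB XC XD BC BD CD.
have [p1|/(lt0_of_le n1) p1] := ltP 0 (orient A B C);
have [p2|/(lt0_of_le n2) p2] := ltP 0 (orient A B D);
have [p3|/(lt0_of_le n3) p3] := ltP 0 (orient A C D);
have [p4|/(lt0_of_le n4) p4] := ltP 0 (orient B C D) => // _.
- exists A, B, C, D; split; [by apply/permP => f /=; ring|].
  by split; [by [] | by [] | by [] | by []].
- exists A, B, D, C; split; [by apply/permP => f /=; ring|].
  by split; [by [] | by [] | by rewrite orient_swap2 oppr_gt0 | by rewrite orient_swap2 oppr_gt0].
- exists A, D, B, C; split; [by apply/permP => f /=; ring|].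
  by split; [by rewrite orient_swap2 oppr_gt0 | by rewrite orient_swap2 oppr_gt0 | by [] | by rewrite orient_rot2].
- exists A, C, B, D; split; [by apply/permP => f /=; ring|].
  by split; [by rewrite orient_swap2 oppr_gt0 | by [] | by [] | by rewrite orient_swap oppr_gt0].
- exists A, C, D, B; split; [by apply/permP => f /=; ring|].
  by split; [by [] | by rewrite orient_swap2 oppr_gt0 | by rewrite orient_swap2 oppr_gt0 | by rewrite orient_rot].
- exists A, D, C, B; split; [by apply/permP => f /=; ring|].
  by split; [by rewrite orient_swap2 oppr_gt0 | by rewrite orient_swap2 oppr_gt0 | by rewrite orient_swap2 oppr_gt0 | by rewrite orient_swap3 oppr_gt0].
Qed.

(** For the four quadruples that contain [E], [orient_signs] leaves four patterns: [E] falls into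
    one of the four gaps of the cycle [A B C D]. *)
Lemma ccw5_exists X A B C D E : conv_pos X -> X A -> X B -> X C -> X D -> X E ->
  uniq [:: A; B; C; D; E] -> ccw4 A B C D ->
  exists P Q S T U, perm_eq [:: P; Q; S; T; U] [:: A; B; C; D; E] /\ ccw5 P Q S T U.
Proof.
move=> cX XA XB XC XD XE un [q1 q2 q3 q4].
have [AB AC AD [AE BC BD [BE CD CE DE]]] : [/\ A != B, A != C, A != D &
    [/\ A != E, B != C, B != D & [/\ B != E, C != D, C != E & D != E]]].
  move: un; rewrite /= !inE !negb_or -!andbA.
  by move=> /and5P[? ? ? ? /and5P[? ? ? ? /and3P[? ? _]]].
have [u1 u2 u3 u4] : [/\ uniq [:: A; B; C; E], uniq [:: A; B; D; E], uniq [:: A; C; D; E] &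
    uniq [:: B; C; D; E]].
  by split; rewrite /= !inE !negb_or ?AB ?AC ?AD ?AE ?BC ?BD ?BE ?CD ?CE ?DE.
have := orient_signs cX XA XB XC XE u1; have := orient_signs cX XA XB XD XE u2.
have := orient_signs cX XA XC XD XE u3; have := orient_signs cX XB XC XD XE u4.
have n1 := orient_neq0 cX XA XB XE AB AE BE; have n2 := orient_neq0 cX XA XC XE AC AE CE.
have n3 := orient_neq0 cX XA XD XE AD AE DE; have n4 := orient_neq0 cX XB XC XE BC BE CE.
have n5 := orient_neq0 cX XB XD XE BD BE DE; have n6 := orient_neq0 cX XC XD XE CD CE DE.
rewrite q1 q2 q3 q4.
have [p1|/(lt0_of_le n1) p1] := ltP 0 (orient A B E);
have [p2|/(lt0_of_le n2) p2] := ltP 0 (orient A C E);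
have [p3|/(lt0_of_le n3) p3] := ltP 0 (orient A D E);
have [p4|/(lt0_of_le n4) p4] := ltP 0 (orient B C E);
have [p5|/(lt0_of_le n5) p5] := ltP 0 (orient B D E);
have [p6|/(lt0_of_le n6) p6] := ltP 0 (orient C D E) => // _ _ _ _.
- exists A, B, C, D, E; split; [by apply/permP => f /=; ring|].
  split; split; [by [] | by [] | by [] | by [] | by [] | by [] | by [] | by [] | by [] | by []].
- exists A, B, C, E, D; split; [by apply/permP => f /=; ring|].
  split; split; [by [] | by [] | by [] | by [] | by [] | by rewrite orient_swap2 oppr_gt0 | by [] | by [] | by rewrite orient_swap2 oppr_gt0 | by rewrite orient_swap2 oppr_gt0].
- exists A, B, E, C, D; split; [by apply/permP => f /=; ring|].
  split; split; [by [] | by [] | by [] | by rewrite orient_swap2 oppr_gt0 | by rewrite orient_swap2 oppr_gt0 | by [] | by rewrite orient_swap2 oppr_gt0 | by rewrite orient_swap2 oppr_gt0 | by [] | by rewrite orient_rot2].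
- exists A, E, B, C, D; split; [by apply/permP => f /=; ring|].
  split; split; [by rewrite orient_swap2 oppr_gt0 | by rewrite orient_swap2 oppr_gt0 | by rewrite orient_swap2 oppr_gt0 | by [] | by [] | by [] | by rewrite orient_rot2 | by rewrite orient_rot2 | by rewrite orient_rot2 | by []].
Qed.

End Orientation.

(** * Triangles, quadrilaterals and pentagons in general position *)

Section SmallPolygons.
Context (R : realType).
Implicit Types (A B C D E o a b u v w : 'cV[R]_2) (X P : set 'cV[R]_2).

Definition copyable (vs : seq 'cV[R]_2) :=
  interior (convex_hull [set` vs]) !=set0 -> has_realizable_copy (convex_hull [set` vs]).

Lemma pt_eq o a b c v : v - o = pt a b c -> v = o + pt a b c.
Proof. by move=> <-; rewrite addrC subrK. Qed.

(** The origin is the crossing of [AC] and [BE]. By [affine_dep] it divides the diagonals in ratios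
    of triangle areas, and these ratios are [c] and [e]. *)
Lemma cross_frame A B C E : ccw4 A B C E -> exists o a b (c e : R),
  [/\ 0 < det2 a b, 0 < c, 0 < e, A = o + pt a b (1, 0) /\ B = o + pt a b (0, 1) &
     C = o + pt a b (- c, 0) /\ E = o + pt a b (0, - e)].
Proof.
move=> [p1 p2 p3 p4].
have dep i := congr1 (fun M : 'cV[R]_2 => M i 0) (affine_dep A B C E).
have sm := orient_four A B C E; rewrite (orient_rot A C E) in sm.
have D2 : det2 (A - C) (B - E) = orient A B E + orient B C E.
  by rewrite /orient /det2 !mxE; ring.
have {}dep i : orient B C E * A i 0 + orient A B E * C i 0 = orient A C E * B i 0 + orient A B C * E i 0.
  by have := dep i; rewrite !mxE.
move: p1 p2 p3 p4 dep sm D2.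
move: (orient A B C) (orient A B E) (orient A C E) (orient B C E) => b a g e b0 a0 g0 e0 dep sm D2.
have S0 : 0 < a + e by exact: addr_gt0.
have [Sn an bn] : [/\ a + e != 0, a != 0 & b != 0] by split; exact: lt0r_neq0.
exists ((e / (a + e)) *: A + (a / (a + e)) *: C), ((a / (a + e)) *: (A - C)),
  ((b / (a + e)) *: (B - E)), (e / a), (g / b).
have eB i : (a + e) * B i 0 = e * A i 0 + a * C i 0 + b * (B i 0 - E i 0).
  rewrite -sm mulrDl; have := dep i; clear; lra.
split.
- rewrite /det2 !mxE (_ : _ - _ = a / (a + e) * (b / (a + e)) * det2 (A - C) (B - E)).
    by rewrite D2 !mulr_gt0 ?invr_gt0.
  by rewrite /det2 !mxE; ring.
- exact: divr_gt0.
- exact: divr_gt0.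
- split; apply: col2P; rewrite !mxE /=.
  + by field.
  + by field.
  + by apply: (mulfI Sn); rewrite eB; field.
  + by apply: (mulfI Sn); rewrite eB; field.
- have eE i : (a + e) * E i 0 = e * A i 0 + a * C i 0 - g * (B i 0 - E i 0).
    rewrite -sm mulrDl; have := dep i; clear; lra.
  split; apply: col2P; rewrite !mxE /=.
  + by field; rewrite an Sn.
  + by field; rewrite an Sn.
  + by apply: (mulfI Sn); rewrite eE; field; rewrite bn Sn.
  + by apply: (mulfI Sn); rewrite eE; field; rewrite bn Sn.
Qed.

Lemma copyable_quad A B C D : ccw4 A B C D -> copyable [:: A; B; C; D].
Proof.
move=> /cross_frame[z [a [b [c [d [D0 c0 d0 [-> ->] [-> ->]]]]]]].
exact: (copy_quadrilateral (lt0r_neq0 D0) c0 d0).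
Qed.

(** In the frame of [cross_frame] the four comparisons of areas are exactly the last four
    inequalities of [copy_cross_pentagon]. The first two say that neither [C] nor [E] is farther
    than [D] from the line [AB]. *)
Lemma copyable_cross A B C D E : ccw5 A B C D E ->
  orient A B C <= orient A B D -> orient A B E <= orient A B D ->
  orient C D E <= orient A C D -> orient C D E <= orient B D E ->
  copyable [:: A; B; C; D; E].
Proof.
move=> [[abc abd abe acd ace] [ade bcd bce bde cde]].
have /cross_frame[z [a [b [c [e [D0 c0 e0 [eA eB] [eC eE]]]]]]] : ccw4 A B C E by [].
have [[x y] Dxy] := pt_coord (z - D) (lt0r_neq0 D0).
have eD : D = z + pt a b (- x, - y).
  apply: pt_eq; rewrite -opprB Dxy /pt; apply/matrixP => i j; rewrite !mxE /=; ring.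
move: abc abd abe acd ace ade bcd bce bde cde; rewrite eA eB eC eD eE !orient_pt /=.
rewrite !pmulr_rgt0 // => abc abd abe acd ace ade bcd bce bde cde.
rewrite !ler_pM2l // => h1 h2 h3 h4.
have x0 : 0 < x.
  move: bde; rewrite (_ : _ - _ = x * (1 + e)); last by ring.
  by rewrite pmulr_lgt0 //; clear -e0; lra.
have y0 : 0 < y.
  move: acd; rewrite (_ : _ - _ = y * (1 + c)); last by ring.
  by rewrite pmulr_lgt0 //; clear -c0; lra.
apply: (copy_cross_pentagon (lt0r_neq0 D0) c0 e0 x0 y0).
- by clear -bcd; lra.
- by clear -ade; lra.
- by clear -cde; lra.
- by clear -h1; lra.
- by clear -h2; lra.
- by clear -h3; lra.
- by clear -h4; lra.
Qed.

Lemma copyable_fan A B C D E : ccw5 A B C D E ->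
  orient B C D <= orient A B C -> orient B C E <= orient A B C ->
  orient B C D <= orient B C E -> orient B C D <= orient A C D ->
  orient C D E <= orient A C D -> orient C D E <= orient A D E ->
  orient B D E <= orient A D E -> copyable [:: A; B; C; D; E].
Proof.
move=> [[abc abd abe acd ace] [ade bcd bce bde cde]].
pose a := C - A; pose b := D - A; have D0 : 0 < det2 a b by exact: acd.
have eA : A = A + pt a b (0, 0) by rewrite /pt !scale0r !addr0.
have eC : C = A + pt a b (1, 0) by rewrite /pt scale0r scale1r addr0 addrC subrK.
have eD : D = A + pt a b (0, 1) by rewrite /pt scale0r scale1r add0r addrC subrK.
have [[be nde] Bxy] := pt_coord (B - A) (lt0r_neq0 D0).
have [[nep ph] Exy] := pt_coord (E - A) (lt0r_neq0 D0).
pose de := - nde; pose ep := - nep.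
have eB : B = A + pt a b (be, - de) by apply: pt_eq; rewrite Bxy opprK.
have eE : E = A + pt a b (- ep, ph) by apply: pt_eq; rewrite Exy opprK.
clearbody de ep; clear Bxy Exy.
move: D0 abc abd abe acd ace ade bcd bce bde cde; rewrite /copyable.
move: a b eA eB eC eD eE => a b eA eB eC eD eE D0.
move: (A) eA eB eC eD eE => o eA eB eC eD eE.
rewrite eA eB eC eD eE !orient_pt /=.
rewrite !pmulr_rgt0 // => abc abd abe acd ace ade bcd bce bde cde.
rewrite !ler_pM2l // => h1 h2 h3 h4 h5 h6 h7.
apply: (copy_fan_pentagon (lt0r_neq0 D0)).
- by clear -abc; lra.
- by clear -ade; lra.
- by clear -bcd; lra.
- by clear -cde; lra.
- by clear -h1; lra.
- by clear -h6; lra.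
- by clear -h2; lra.
- by clear -h7; lra.
- by clear -h3; lra.
- by clear -h4; lra.
- by clear -h5; lra.
Qed.

Lemma ccw5_rot A B C D E : ccw5 A B C D E -> ccw5 B C D E A.
Proof.
move=> [[abc abd abe acd ace] [ade bcd bce bde cde]].
by split; split=> //; rewrite orient_rot.
Qed.

Lemma copyable_rot A B C D E : copyable [:: B; C; D; E; A] -> copyable [:: A; B; C; D; E].
Proof.
rewrite /copyable (_ : [set` [:: B; C; D; E; A]] = [set` [:: A; B; C; D; E]]) //.
by apply/seteqP; split=> v /=; rewrite !inE => /or4P[->|->|->|/orP[]->]; rewrite ?orbT.
Qed.

(* [C D E] is the smallest of the five triangles cut off by a diagonal. *)
Lemma copyable_ear A B C D E : ccw5 A B C D E ->
  orient C D E <= orient A B C -> orient C D E <= orient B C D ->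
  orient C D E <= orient A D E -> orient C D E <= orient A B E ->
  copyable [:: A; B; C; D; E].
Proof.
move=> ccw mb mc me ma.
have ccwB := ccw5_rot ccw; have ccwC := ccw5_rot ccwB; have ccwD := ccw5_rot ccwC.
have ccwE := ccw5_rot ccwD.
have [[abc abd abe acd ace] [ade bcd bce bde cde]] := ccw.
have i1 := orient_four A B C D; have i2 := orient_four A B D E.
have i3 := orient_four A C D E; have i4 := orient_four B C D E.
have i5 := orient_four A B C E.
rewrite (orient_rot A C D) in i1; rewrite (orient_rot A D E) in i2.
rewrite (orient_rot A D E) in i3; rewrite (orient_rot B D E) in i4.
rewrite (orient_rot A C E) in i5.
(* Plücker relations for the directions seen from [C], [E] and [A]. They are quadratic and
   complement the linear relations [i1] to [i5]. *)
have k1 : orient B C E * orient A C D = orient A C E * orient B C D + orient A B C * orient C D E.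
  by rewrite /orient /det2 !mxE; ring.
have k2 : orient A C E * orient B D E = orient B C E * orient A D E + orient A B E * orient C D E.
  by rewrite /orient /det2 !mxE; ring.
have k3 : orient A C E * orient A B D = orient A D E * orient A B C + orient A C D * orient A B E.
  by rewrite /orient /det2 !mxE; ring.
have al : orient C D E <= orient A C D.
  rewrite -(ler_pM2l bce) k1; apply: le_trans (_ : (orient A C E + orient A B C) * orient C D E <= _).
    by rewrite ler_pM2r //; clear -i5 abe; lra.
  by rewrite mulrDl lerD2r ler_pM2l.
have bt : orient C D E <= orient B D E.
  rewrite -(ler_pM2l ace) k2; apply: le_trans (_ : (orient B C E + orient A B E) * orient C D E <= _).
    by rewrite ler_pM2r //; clear -i5 abc; lra.
  by rewrite mulrDl lerD2r ler_pM2l.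
have rot := (orient_rot A B C, orient_rot2 A B C, orient_rot A B D, orient_rot2 A B D,
  orient_rot A B E, orient_rot2 A B E, orient_rot A C D, orient_rot2 A C D,
  orient_rot A C E, orient_rot2 A C E, orient_rot A D E, orient_rot2 A D E,
  orient_rot B C D, orient_rot2 B C D, orient_rot B C E, orient_rot2 B C E,
  orient_rot B D E, orient_rot2 B D E, orient_rot C D E, orient_rot2 C D E).
(* If [D] is farthest from [AB], the frame given by the crossing of [AC] and [BE] works. If [C] is
   farther, either the frame rotated by one vertex works or [B] is the apex of a fan; if [E] is
   farther, the mirror image holds with apex [A]. Both at once contradict [k3]. *)
have [ha|ha] := leP (orient A B E) (orient A B D); have [hb|hb] := leP (orient A B C) (orient A B D).
- exact: copyable_cross.
- have [hg|hg] := leP (orient A B C) (orient B C E).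
    by apply: copyable_rot; apply: copyable_cross => //;
      rewrite ?rot; clear -i1 i2 i3 i4 i5 al bt ma mb mc me ha hb hg; lra.
  by apply: copyable_rot; apply: copyable_fan => //;
    rewrite ?rot; clear -i1 i2 i3 i4 i5 al bt ma mb mc me ha hb hg; lra.
- have [hg|hg] := leP (orient A B E) (orient A C E).
    by do 4 apply: copyable_rot; apply: copyable_cross => //;
      rewrite ?rot; clear -i1 i2 i3 i4 i5 al bt ma mb mc me ha hb hg; lra.
  by apply: copyable_fan => //;
    rewrite ?rot; clear -i1 i2 i3 i4 i5 al bt ma mb mc me ha hb hg; lra.
- exfalso; move: k3; rewrite (_ : orient A C E = orient A C D + orient A D E - orient C D E).
    have g1 : orient A D E * orient A B D < orient A D E * orient A B C by rewrite ltr_pM2l.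
    have g2 : orient A C D * orient A B D < orient A C D * orient A B E by rewrite ltr_pM2l.
    have g3 : 0 < orient C D E * orient A B D by exact: mulr_gt0.
    by clear -g1 g2 g3; lra.
  by clear -i3; lra.
Qed.

Lemma seq_min (s : seq R) : s != [::] -> exists2 m, m \in s & forall x, x \in s -> m <= x.
Proof.
elim: s => // x [|y s] IH _; first by exists x => [|z]; rewrite inE ?eqxx // => /eqP ->.
have [m ms mle] := IH isT; have [xm|/ltW mx] := leP x m.
  exists x => [|z]; first by rewrite inE eqxx.
  by rewrite inE => /orP[/eqP ->//|/mle]; exact: le_trans.
exists m => [|z]; first by rewrite inE ms orbT.
by rewrite inE => /orP[/eqP ->//|/mle].
Qed.

Lemma copyable_pentagon A B C D E : ccw5 A B C D E -> copyable [:: A; B; C; D; E].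
Proof.
move=> ccw.
have ccwB := ccw5_rot ccw; have ccwC := ccw5_rot ccwB; have ccwD := ccw5_rot ccwC.
have ccwE := ccw5_rot ccwD.
have rot := (orient_rot A B C, orient_rot2 A B C, orient_rot A B D, orient_rot2 A B D,
  orient_rot A B E, orient_rot2 A B E, orient_rot A C D, orient_rot2 A C D,
  orient_rot A C E, orient_rot2 A C E, orient_rot A D E, orient_rot2 A D E,
  orient_rot B C D, orient_rot2 B C D, orient_rot B C E, orient_rot2 B C E,
  orient_rot B D E, orient_rot2 B D E, orient_rot C D E, orient_rot2 C D E).
have [m] := @seq_min [:: orient C D E; orient A D E; orient A B E; orient A B C; orient B C D] isT.
rewrite !inE => mE mle.
have {mle} [l1 l2 l3 l4 l5] : [/\ m <= orient C D E, m <= orient A D E, m <= orient A B E,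
   m <= orient A B C & m <= orient B C D] by split; apply: mle; rewrite !inE eqxx ?orbT.
case/or4P: mE => [/eqP e|/eqP e|/eqP e|/orP[]/eqP e]; rewrite {m}e in l1 l2 l3 l4 l5.
- exact: copyable_ear.
- by do 1 apply: copyable_rot; apply: copyable_ear => //; rewrite ?rot.
- by do 2 apply: copyable_rot; apply: copyable_ear => //; rewrite ?rot.
- by do 3 apply: copyable_rot; apply: copyable_ear => //; rewrite ?rot.
- by do 4 apply: copyable_rot; apply: copyable_ear => //; rewrite ?rot.
Qed.

Lemma copyable_triangle A B C : orient A B C != 0 -> copyable [:: A; B; C].
Proof.
move=> D0; pose o := 3^-1 *: (A + B + C).
have n3 : 3 != 0 :> R by rewrite pnatr_eq0.
have D0' : det2 (A - o) (B - o) != 0.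
  rewrite (_ : det2 _ _ = orient A B C / 3); first by rewrite mulf_neq0 // invr_neq0.
  by rewrite /orient /det2 !mxE; field.
have eA : A = o + pt (A - o) (B - o) (1, 0) by rewrite /pt scale1r scale0r addr0 addrC subrK.
have eB : B = o + pt (A - o) (B - o) (0, 1) by rewrite /pt scale1r scale0r add0r addrC subrK.
have eC : C = o + pt (A - o) (B - o) (-1, -1) by apply: col2P; rewrite !mxE /=; field.
by have := copy_triangle (o := o) D0'; rewrite /= -eA -eB -eC.
Qed.

Lemma copyable_perm vs ws : perm_eq vs ws -> copyable vs -> copyable ws.
Proof.
move=> /perm_mem vw; rewrite /copyable (_ : [set` vs] = [set` ws]) //.
by apply/seteqP; split=> v /=; rewrite vw.
Qed.

Lemma ngon_conv_pos n (p : 'I_n -> 'cV[R]_2) :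
  (forall i, ~ convex_hull [set p j | j in [set j | j != i]] (p i)) ->
  injective p /\ conv_pos (range p).
Proof.
move=> vp; split=> [i j pij|_ [i _ <-]].
  apply/eqP/negPn/negP => ij; apply: (vp i); rewrite pij; apply: hull_mem.
  by exists j => //=; rewrite eq_sym.
apply: contra_not (vp i); apply: hull_mono => _ [[j _ <-] /= ji].
by exists j => //=; apply/eqP => e; apply: ji; rewrite e.
Qed.

Lemma small_ngon n P : n \in [:: 3; 4; 5]%N -> convex_ngon n P -> has_realizable_copy P.
Proof.
move=> n345 [p [-> vp]]; have [injp cp] := ngon_conv_pos vp.
have rE : range p = [set` [seq p i | i <- enum 'I_n]].
  apply/seteqP; split=> [_ [i _ <-]|v] /=; first by apply: map_f; rewrite mem_enum.
  by move=> /mapP[i _ ->]; exists i.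
have un : uniq [seq p i | i <- enum 'I_n] by rewrite map_inj_uniq // enum_uniq.
have sz : size [seq p i | i <- enum 'I_n] = n by rewrite size_map size_enum_ord.
rewrite -/(copyable _) {}rE in cp *.
move: [seq p i | i <- enum 'I_n] un sz cp => vs un sz cp; rewrite -/(copyable vs).
move: n345; rewrite !inE -sz => /or3P[]; move: un cp; case: vs {sz p vp injp} => [|A [|B [|C [|D [|E [|F vs]]]]]] //= un cp _.
- apply: copyable_triangle; move: un; rewrite !inE !negb_or -!andbA => /and4P[AB AC BC _].
  by apply: (orient_neq0 cp); rewrite //= !inE eqxx ?orbT.
- have [XA XB XC XD] : [/\ [set` [:: A; B; C; D]] A, [set` [:: A; B; C; D]] B,
      [set` [:: A; B; C; D]] C & [set` [:: A; B; C; D]] D].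
    by split; rewrite /= !inE eqxx ?orbT.
  have [P' [Q [S [T [pe ccw]]]]] := ccw4_exists cp XA XB XC XD un.
  by apply: copyable_perm pe _; exact: copyable_quad.
- have [XA XB XC [XD XE]] : [/\ [set` [:: A; B; C; D; E]] A, [set` [:: A; B; C; D; E]] B,
      [set` [:: A; B; C; D; E]] C & [set` [:: A; B; C; D; E]] D /\ [set` [:: A; B; C; D; E]] E].
    by split; [| | |split]; rewrite /= !inE eqxx ?orbT.
  have un4 : uniq [:: A; B; C; D].
    by have un5 : uniq [:: A; B; C; D; E] := un; exact: (take_uniq 4 un5).
  have [P' [Q [S [T [pe ccw4]]]]] := ccw4_exists cp XA XB XC XD un4.
  have pe5 : perm_eq [:: P'; Q; S; T; E] [:: A; B; C; D; E].
    have := perm_cat2r [:: E] [:: P'; Q; S; T] [:: A; B; C; D]; rewrite pe /= => ->.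
    by [].
  have mX v : v \in [:: P'; Q; S; T; E] -> [set` [:: A; B; C; D; E]] v.
    by rewrite (perm_mem pe5).
  have [|||||||P5 [Q5 [S5 [T5 [U5 [pe5' ccw]]]]]] :=
    ccw5_exists (A := P') (B := Q) (C := S) (D := T) (E := E) cp; try by apply: mX; rewrite !inE eqxx ?orbT.
  + by rewrite (perm_uniq pe5).
  + exact: ccw4.
  + by apply: (copyable_perm (perm_trans pe5' pe5)); exact: copyable_pentagon.
Qed.

End SmallPolygons.

(** * Trajectories of a constant matrix *)

Section Flow.
Context (R : realType).
Implicit Types (S : set 'M[R]_2) (M : set 'cV[R]_2) (A B : 'M[R]_2) (u v : 'cV[R]_2).

Lemma is_derive_scaled (k t : R) : is_derive t 1 (fun s : R => k * s) k.
Proof.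
by apply: (is_derive_eq (is_deriveZ k (is_derive_id t 1))); rewrite /GRing.scale /= mulr1.
Qed.

(* The solutions of [y'' = d y] with initial data [(1, 0)] and [(0, 1)]. *)
Lemma oscillator (d : R) : exists c s : R -> R, [/\ c 0 = 1, s 0 = 0,
  forall t : R, is_derive t 1 c (d * s t) & forall t : R, is_derive t 1 s (c t)].
Proof.
have [d0|d0|->] := ltrgt0P d.
- pose k := Num.sqrt d; have k0 : k != 0 by rewrite sqrtr_eq0 -ltNge.
  have dk : d = k * k by rewrite -expr2 sqr_sqrtr // ltW.
  exists (2^-1 \*: ((fun t => expR (k * t)) + (fun t => expR (- k * t)))),
    ((2 * k)^-1 \*: ((fun t => expR (k * t)) - (fun t => expR (- k * t)))); split.
  + by rewrite /GRing.scale /= !fctE /GRing.scale /= !mulr0 expR0; field.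
  + by rewrite /GRing.scale /= !fctE /GRing.scale /= !mulr0 expR0 subrr mulr0.
  + move=> t; have h := is_deriveZ (2^-1) (is_deriveD (is_derive_expRM k t) (is_derive_expRM (- k) t)).
    by apply: (is_derive_eq h); rewrite /GRing.scale /= !fctE /GRing.scale /= dk; field.
  + move=> t; have h := is_deriveZ ((2 * k)^-1) (is_deriveB (is_derive_expRM k t) (is_derive_expRM (- k) t)).
    by apply: (is_derive_eq h); rewrite /GRing.scale /= !fctE /GRing.scale /=; field.
- pose k := Num.sqrt (- d); have k0 : k != 0 by rewrite sqrtr_eq0 -ltNge oppr_gt0.
  have dk : d = - (k * k) by rewrite -expr2 sqr_sqrtr ?opprK // oppr_ge0 ltW.
  exists (fun t => cos (k * t)), (k^-1 \*: (fun t => sin (k * t))); split.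
  + by rewrite mulr0 cos0.
  + by rewrite /= /GRing.scale /= mulr0 sin0 mulr0.
  + move=> t; have h := is_derive1_comp (is_derive_cos (k * t)) (is_derive_scaled k t).
    by apply: (is_derive_eq h); rewrite /= /GRing.scale /= dk; field.
  + move=> t; have h := is_deriveZ (k^-1)
      (is_derive1_comp (is_derive_sin (k * t)) (is_derive_scaled k t)).
    by apply: (is_derive_eq h); rewrite /= /GRing.scale /=; field.
- exists (cst 1), id; split => // t; first by rewrite mul0r; exact: is_derive_cst.
  exact: is_derive_id.
Qed.

(* By Cayley-Hamilton the traceless part of [A] squares to a scalar matrix. *)
Lemma flow_exists A u : exists x : R -> 'cV[R]_2,
  x 0 = u /\ forall t : R, is_derive t 1 x (A *m x t).
Proof.
pose tau := (A 0 0 + A 1 1) / 2.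
pose d := tau ^+ 2 - (A 0 0 * A 1 1 - A 0 1 * A 1 0).
pose w := A *m u - tau *: u.
have [c [s [c0 s0 dc ds]]] := oscillator d.
have Au : A *m u = tau *: u + w by rewrite /w addrC subrK.
have w0 : w 0 0 = A 0 0 * u 0 0 + A 0 1 * u 1 0 - tau * u 0 0.
    by rewrite /w [LHS]mxE mul_col0 !mxE.
have w1 : w 1 0 = A 1 0 * u 0 0 + A 1 1 * u 1 0 - tau * u 1 0.
    by rewrite /w [LHS]mxE mul_col1 !mxE.
clearbody w.
have Aw : A *m w = d *: u + tau *: w.
  by apply: col2P; rewrite (mul_col0, mul_col1) !mxE w0 w1 /d /tau; field.
exists (fun t => expR (tau * t) *: (c t *: u + s t *: w)); split.
  by rewrite mulr0 expR0 scale1r c0 s0 scale1r scale0r addr0.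
move=> t; apply/is_derive_coord => i.
rewrite (_ : (fun _ => _) = (fun t => expR (tau * t)) * ((u i 0) \*: c + (w i 0) \*: s)); last first.
  by apply/funext => r; rewrite !mxE !fctE /= /GRing.scale /=; ring.
have h := is_deriveM (is_derive_expRM tau t)
  (is_deriveD (is_deriveZ (u i 0) (dc t)) (is_deriveZ (w i 0) (ds t))).
apply: (is_derive_eq h).
rewrite -scalemxAr mulmxDr -!scalemxAr Au Aw !mxE !fctE /= /GRing.scale /=; ring.
Qed.

Lemma traj_flow S A (x : R -> 'cV[R]_2) : S A ->
  (forall t : R, is_derive t 1 x (A *m x t)) -> trajectory S x.
Proof.
move=> SA dx.
have dxi i (t : R) : is_derive t 1 (fun t => x t i 0) ((A *m x t) i 0).
  exact: (is_derive_coord x t (A *m x t)).1.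
have cx i : continuous (fun t => x t i 0).
  by move=> t; apply/differentiable_continuous/derivable1_diffP; have [] := dxi i t.
split=> [T|]; last first.
  exists (cst A); split=> [//|i j|]; first exact: measurable_cst.
  by apply: aeW => t _.
apply/ac_coord => i.
have [C HC] : exists C, forall t, 0 <= t -> t <= T -> `|(A *m x t) i 0| <= C.
  have [T0|T0] := leP 0 T; last by exists 0 => t t0 tT; exfalso; lra.
  have [b0 _ H0] := EVT_max T0 (continuous_subspaceT (fun t =>
     continuous_comp (cx 0 t) (@norm_continuous R R^o _))).
  have [b1 _ H1] := EVT_max T0 (continuous_subspaceT (fun t =>
     continuous_comp (cx 1 t) (@norm_continuous R R^o _))).
  exists (2 * `|A| * (`|x b0 0 0| + `|x b1 1 0|)) => t t0 tT.
  apply: le_trans (coord_le _ _ _) _; apply: le_trans (norm_mul _ _) _.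
  apply: ler_wpM2l; first by rewrite mulr_ge0.
  have tI : t \in `[0, T]%R by rewrite in_itv /= t0.
  have := H0 t tI; have := H1 t tI; rewrite /= => h1 h0.
  apply: norm_leP.
    by apply: le_trans h0 _; rewrite lerDl.
  by apply: le_trans h1 _; rewrite lerDr.
exact: (ac_derive (dxi i) HC).
Qed.

End Flow.

(** * Necessary conditions at the boundary of an eigenset *)

Section Eigenset.
Context (R : realType).
Implicit Types (S : set 'M[R]_2) (M : set 'cV[R]_2) (A B : 'M[R]_2) (u v : 'cV[R]_2).

Lemma enormZ (k : R) v : 0 <= k -> enorm (k *: v) = k * enorm v.
Proof.
move=> k0; rewrite !enormE !mxE !exprMn -mulrDr sqrtrM ?sqr_ge0 //.
by rewrite sqrtr_sqr ger0_norm.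
Qed.

Definition shift S (k : R) := [set A + k%:M | A in S].

Lemma shiftK S k : shift (shift S k) (- k) = S.
Proof.
apply/seteqP; split=> [_ [_ [A SA <-] <-]|A SA].
  by rewrite -addrA -raddfD /= subrr raddf0 addr0.
exists (A + k%:M); first by exists A.
by rewrite -addrA -raddfD /= subrr raddf0 addr0.
Qed.

Lemma shiftNK S k : shift (shift S (- k)) k = S.
Proof. by rewrite -{2}[k]opprK shiftK. Qed.

Lemma traj_shift S (k : R) (x : R -> 'cV[R]_2) : trajectory S x ->
  trajectory (shift S k) (fun t => expR (k * t) *: x t).
Proof.
exact: (@traj_scale R S x (fun t => expR (k * t)) k (is_derive_expRM k)
  (fun T => @ac_expR R T k)).
Qed.

Lemma shift_stays S M (al : R) (y : R -> 'cV[R]_2) :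
  (forall t, 0 <= t -> reachable_set S M t = [set expR (al * t) *: v | v in M]) ->
  trajectory (shift S (- al)) y -> M (y 0) -> forall t, 0 <= t -> M (y t).
Proof.
move=> eig ty My t t0; have := traj_shift al ty.
rewrite shiftNK => tx.
have : reachable_set S M t (expR (al * t) *: y t).
  by exists (fun t => expR (al * t) *: y t); split => //; rewrite mulr0 expR0 scale1r.
by rewrite eig // => -[v Mv /(scalerI (lt0r_neq0 (expR_gt0 _))) <-].
Qed.

Lemma shift_reaches S M (al : R) :
  (forall t, 0 <= t -> reachable_set S M t = [set expR (al * t) *: v | v in M]) ->
  forall m, M m -> forall t, 0 <= t ->
    exists y, [/\ trajectory (shift S (- al)) y, M (y 0) & y t = m].
Proof.
move=> eig m Mm t t0.
have : reachable_set S M t (expR (al * t) *: m) by rewrite eig //; exists m.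
move=> [x [tx Mx0 xt]]; exists (fun t => expR (- al * t) *: x t).
split; [exact: traj_shift|by rewrite mulr0 expR0 scale1r|].
by rewrite -xt scalerA -expRD mulNr addNr expR0 scale1r.
Qed.

Section Normalized.
(* The two hypotheses say that [M] is an eigenset of [S] with exponent 0. *)
Context (S : set 'M[R]_2) (M : set 'cV[R]_2)
  (stay : forall y, trajectory S y -> M (y 0) -> forall t, 0 <= t -> M (y t))
  (reach : forall m, M m -> forall t, 0 <= t ->
    exists y, [/\ trajectory S y, M (y 0) & y t = m]).

(** The constant control [A] is admissible; its trajectory from [m] stays in [M] and starts with
    velocity [A *m m]. *)
Lemma eigenset_tangent : tangent S M.
Proof.
move=> A m SA Mm e e0; have [x [x0 dx]] := flow_exists A m.
have tx := traj_flow SA dx; have dx0 := dx 0; rewrite x0 in dx0.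
have [d d0 Hd] := derive_vec_eps dx0 e0; exists d => // h h0 hd.
exists (x h); first by apply: (stay tx); [rewrite x0 | exact: ltW].
have := Hd h; rewrite (ger0_norm (ltW h0)) add0r x0 => /(_ hd).
rewrite (_ : m + h *: (A *m m) - x h = - (x h - m - h *: (A *m m))) ?normrN //.
by move: (A *m m) (x h) => w z; apply/matrixP => i j; rewrite !mxE; ring.
Qed.

Lemma eigenset_support_le A u (p q : R) : S A -> M u ->
  (forall m, M m -> p * m 0 0 + q * m 1 0 <= p * u 0 0 + q * u 1 0) ->
  p * (A *m u) 0 0 + q * (A *m u) 1 0 <= 0.
Proof.
move=> SA Mu sup; apply/ler_addgt0Pr => e e0; rewrite add0r.
have pq0 : 0 < `|p| + `|q| + 1 by rewrite ltr_wpDl // addr_ge0.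
have [d d0 Hd] := eigenset_tangent SA Mu (divr_gt0 e0 pq0).
have h0 : 0 < d / 2 by rewrite divr_gt0.
have [|m Mm] := Hd (d / 2) h0; first by lra.
have := sup m Mm; set h := d / 2 in h0 *; move: (A *m u) => w sm close.
have c0 := le_trans (coord_le _ 0 0) close; have c1 := le_trans (coord_le _ 1 0) close.
rewrite !mxE in c0 c1.
rewrite -(ler_pM2l h0); apply: (@le_trans _ _ (`|p| * `|u 0 0 + h * w 0 0 - m 0 0| + `|q| * `|u 1 0 + h * w 1 0 - m 1 0|)).
  rewrite -!normrM; apply: le_trans (lerD (ler_norm _) (ler_norm _)); lra.
apply: (@le_trans _ _ ((`|p| + `|q|) * (e / (`|p| + `|q| + 1) * h))).
  by rewrite mulrDl; apply: lerD; apply: ler_wpM2l.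
rewrite (_ : _ * _ = h * e * ((`|p| + `|q|) / (`|p| + `|q| + 1))); last by ring.
by rewrite ger_pMr ?mulr_gt0 // ler_pdivrMr // mul1r lerDl.
Qed.

Lemma traj_lip (C K : R) (y : R -> 'cV[R]_2) i (t : R) : (forall A, S A -> `|A| <= K) ->
  (forall m, M m -> `|m| <= C) -> trajectory S y -> M (y 0) -> 0 <= t ->
  `|y t i 0 - y 0 i 0| <= 2 * K * C * t.
Proof.
move=> SK MC ty My0 t0; have [acy [A [SA _ dy]]] := ty.
have acyi := (ac_coord t y).1 (acy t) i.
have K0 : 0 <= K by apply: le_trans (SK _ (SA 0 (lexx _))).
have bnd r : 0 <= r -> `|(A r *m y r) i 0| <= 2 * K * C.
  move=> r0; apply: le_trans (coord_le _ _ _) _; apply: le_trans (norm_mul _ _) _.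
  have := MC _ (stay ty My0 r0); have := SK _ (SA r r0) => a1 a2.
  by apply: ler_pM => //; rewrite ?mulr_ge0 // ler_pM2l.
have one (s : R) : `|s| <= 1 -> s * (y t i 0 - y 0 i 0) <= 2 * K * C * t.
  move=> s1; pose g r := s * y r i 0 + - (2 * K * C) * r.
  suff : g t <= g 0 by rewrite /g mulr0 addr0; lra.
  apply: (ac_dini (T := t)) => //.
    by apply: ac_add; apply: ac_mul => //; [exact: ac_cst | exact: ac_cst | exact: ac_id].
  apply: ae_sub dy => r dy r0 rt e e0.
  have dyi := (is_derive_coord y r (A r *m y r)).1 (dy r0) i.
  have [d d0 Hd] := derive_eps dyi e0; exists d => // h h0 hd.
  have := Hd h; rewrite (ger0_norm (ltW h0)) => /(_ hd) close.
  have b := bnd r r0; rewrite /g.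
  have : `|s * (y (r + h) i 0 - y r i 0 - h * (A r *m y r) i 0)| <= e * h.
    by rewrite normrM -[leRHS]mul1r ler_pM.
  have : `|s * (h * (A r *m y r) i 0)| <= h * (2 * K * C).
    rewrite normrM -[leRHS]mul1r ler_pM // normrM (ger0_norm (ltW h0)).
    by rewrite ler_pM2l.
  move=> /ler_normlP[_ b1] /ler_normlP[_ b2]; move: b1 b2; clear; lra.
have h1 := one 1; have h2 := one (-1); rewrite normrN1 normr1 in h1 h2.
have := h1 (lexx _); have := h2 (lexx _); rewrite ler_norml; clear; lra.
Qed.

(** If every velocity at [u] pointed strictly inwards, compactness of [S] would give a common inward
    speed [eta], of which half persists near [u]. A trajectory that arrives at [u] after a short
    time has stayed near [u], so it would have started beyond the support line, outside [M]. *)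
Lemma eigenset_support_ge u (p q : R) : compact S -> compact M -> M u ->
  (forall m, M m -> p * m 0 0 + q * m 1 0 <= p * u 0 0 + q * u 1 0) ->
  exists2 A, S A & 0 <= p * (A *m u) 0 0 + q * (A *m u) 1 0.
Proof.
move=> cS cM Mu sup; apply: contrapT => H.
pose l (v : 'cV[R]_2) := p * v 0 0 + q * v 1 0.
have lE v : `|l v| <= (`|p| + `|q|) * `|v|.
  rewrite mulrDl; apply: le_trans (ler_normD _ _) _.
  by rewrite !normrM; apply: lerD; apply: ler_wpM2l => //; exact: coord_le.
have lB v w : l (v - w) = l v - l w by rewrite /l !mxE; ring.
have [A0 SA0] : S !=set0.
  have [y [[_ [A [SA _ _]]] _ _]] := reach Mu (lexx 0).
  by exists (A 0); exact: SA.
have [K SK] : exists K, forall A, S A -> `|A| <= K.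
  by have [B [_ HB]] := compact_bounded cS; exists (B + 1) => A SA; apply: HB => //; rewrite ltrDl.
have [C MC] : exists C, forall m, M m -> `|m| <= C.
  by have [B [_ HB]] := compact_bounded cM; exists (B + 1) => A SA; apply: HB => //; rewrite ltrDl.
have K0 : 0 <= K by apply: le_trans (SK _ SA0).
have C0 : 0 <= C by apply: le_trans (MC _ Mu).
have [eta eta0 Heta] : exists2 eta : R, 0 < eta & forall A, S A -> l (A *m u) <= - eta.
  have cf : continuous (fun A : 'M[R]_2 => - l (A *m u) : R^o).
    apply: (@lip_continuous _ _ _ _ ((`|p| + `|q|) * (2 * `|u|))) => A B.
    rewrite opprK addrC -lB -mulmxBl; apply: le_trans (lE _) _.
    rewrite -mulrA ler_wpM2l ?addr_ge0 //; apply: le_trans (norm_mul _ _) _.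
    by rewrite -normrN opprB mulrAC.
  have [|A] := @compact_EVT_min _ R (fun A : 'M[R]_2 => - l (A *m u)) S (ex_intro _ A0 SA0) cS.
    exact: continuous_subspaceT.
  rewrite inE => SA Hmin; exists (- l (A *m u)).
    by rewrite oppr_gt0 ltNge; apply/negP => h; apply: H; exists A.
  by move=> B SB; rewrite opprK -lerN2; apply: Hmin; rewrite inE.
pose W := (`|p| + `|q|) * (2 * K).
have W0 : 0 <= W by rewrite !mulr_ge0 // addr_ge0.
have WC0 : 0 <= W * (2 * K * C) by rewrite !mulr_ge0.
(* Chosen so that [W * (4 * K * C * t) <= eta / 2]: during the time [t] velocities change by at most
   half of [eta] in the direction of the covector. The 1 keeps the denominator positive. *)
pose t := eta / (4 * (W * (2 * K * C) + 1)).
have t0 : 0 < t by rewrite divr_gt0 // mulr_gt0 // ltr_wpDl.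
have [y [ty My0 yt]] := reach Mu (ltW t0).
have close r : 0 <= r -> r <= t -> `|y r - u| <= 4 * K * C * t.
  move=> r0 rt.
  have cl i : `|y r i 0 - u i 0| <= 4 * K * C * t.
    have h1 := traj_lip i SK MC ty My0 r0; have h2 := traj_lip i SK MC ty My0 (ltW t0).
    have KC0 : 0 <= K * C by exact: mulr_ge0.
    have h3 : K * C * r <= K * C * t by exact: ler_wpM2l.
    have := ler_distD (y 0 i 0) (y r i 0) (u i 0); rewrite -{2}yt (distrC (y 0 i 0)) yt.
    move: h2; rewrite yt; lra.
  by apply: norm_leP; rewrite !mxE.
have [acy [A [SA _ dy]]] := ty.
pose g r := l (y r) + eta / 2 * r.
have : g t <= g 0.
  have actc i := (ac_coord t y).1 (acy t) i.
  apply: (ac_dini (T := t)); [|by []|exact: ltW|].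
    apply: ac_add; first apply: ac_add; apply: ac_mul => //; try exact: ac_cst.
    exact: ac_id.
  apply: ae_sub dy => r dy r0 rt e e0.
  have pq0 : 0 < `|p| + `|q| + 1 by rewrite ltr_wpDl // addr_ge0.
  have [d d0 Hd] := derive_vec_eps (dy r0) (divr_gt0 e0 pq0); exists d => // h h0 hd.
  have := Hd h; rewrite (ger0_norm (ltW h0)) => /(_ hd) cl.
  have h1 : l (A r *m y r) <= - (eta / 2).
    have := Heta _ (SA r r0).
    have : l (A r *m y r) - l (A r *m u) <= eta / 2.
      rewrite -lB -mulmxBr; apply: le_trans (ler_norm _) _; apply: le_trans (lE _) _.
      apply: (@le_trans _ _ (W * (4 * K * C * t))).
        rewrite /W -mulrA; apply: ler_wpM2l; first by rewrite addr_ge0.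
        apply: le_trans (norm_mul _ _) _; apply: ler_pM; [by rewrite mulr_ge0|by []| |].
          by rewrite ler_pM2l //; exact: SK (SA r r0).
        exact: close (ltW rt).
      rewrite (_ : W * _ = eta / 2 * ((W * (2 * K * C)) / (W * (2 * K * C) + 1))).
        by rewrite ger_pMr ?divr_gt0 // ler_pdivrMr ?ltr_wpDl // mul1r lerDl.
      by rewrite /t; field; rewrite lt0r_neq0 // ltr_wpDl.
    by lra.
  have h2 : l (y (r + h) - y r - h *: (A r *m y r)) <= e * h.
    apply: le_trans (ler_norm _) _; apply: le_trans (lE _) _.
    apply: le_trans (_ : (`|p| + `|q|) * (e / (`|p| + `|q| + 1) * h) <= _).
      by apply: ler_wpM2l => //; rewrite addr_ge0.
    rewrite [leLHS](_ : _ = h * e * ((`|p| + `|q|) / (`|p| + `|q| + 1))); last by ring.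
    by rewrite [leRHS]mulrC ger_pMr ?mulr_gt0 // ler_pdivrMr // mul1r lerDl.
  have h3 : l (h *: (A r *m y r)) = h * l (A r *m y r) by rewrite /l !mxE; ring.
  rewrite !lB h3 in h2; have := ler_wpM2l (ltW h0) h1; rewrite /g; lra.
have := sup _ My0; rewrite /g yt -/(l u) -/(l (y 0)).
have := mulr_gt0 eta0 t0; lra.
Qed.

End Normalized.

(** The scalar matrix in [S] provides solutions that grow exactly like [expR (al * t)], and
    [traj_bounded] for the shifted system shows that nothing grows faster. Consequently the standing
    assumption on [S] means that the normalized system of an eigenset omits 0. *)
Lemma eigenset_exponent S M (al : R) : compact S -> compact M -> interior M !=set0 ->
  (forall t, 0 <= t -> reachable_set S M t = [set expR (al * t) *: v | v in M]) ->
  S al%:M -> lyapunov_exponent S = al.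
Proof.
move=> cS cM iM eig Sal.
have tg := eigenset_tangent (fun y ty => shift_stays eig ty).
have [K SK] : exists K, forall A, shift S (- al) A -> `|A| <= K.
  have [B [_ HB]] := compact_bounded cS.
  exists (B + 1 + `|(- al)%:M : 'M[R]_2|) => _ [A SA <-].
  apply: le_trans (ler_normD _ _) _; rewrite lerD2r; apply: HB => //; by rewrite ltrDl.
rewrite /lyapunov_exponent; set E := (X in inf X).
have Eal : E al.
  move=> x tx; have [C HC] := traj_bounded cM iM tg SK (traj_shift (- al) tx).
  exists C => t t0; have := HC t t0.
  by rewrite enormZ ?expR_ge0 // mulNr expRN mulrC ler_pdivrMr ?expR_gt0.
have lbE : lbound E al.
  move=> b Eb; rewrite leNgt; apply/negP => bal.
  have tc : trajectory (shift S (- al)) (cst (vec 1 0 : 'cV[R]_2)).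
    apply: (@traj_const _ _ 0); last by rewrite mul0mx.
    by exists al%:M => //; rewrite -raddfD /= subrr raddf0.
  have tx := traj_shift al tc; rewrite shiftNK in tx.
  have [C HC] := Eb _ tx.
  have v1 : enorm (vec 1 0 : 'cV[R]_2) = 1.
    by rewrite enormE vec0 vec1 expr1n expr0n addr0 sqrtr1.
  pose t := `|C| / (al - b).
  have ab0 : 0 < al - b by rewrite subr_gt0.
  have t0 : 0 <= t by apply: ge0_div.
  have := HC t t0; rewrite enormZ ?expR_ge0 // v1 mulr1 -ler_pdivrMr ?expR_gt0 // -expRN -expRD.
  have : 1 + (al * t + - (b * t)) <= expR (al * t + - (b * t)) by exact: expR_ge1Dx.
  have -> : al * t + - (b * t) = `|C| by rewrite /t; field; exact: lt0r_neq0.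
  have := ler_norm C; lra.
apply/eqP; rewrite eq_le ge_inf //=; last by exists al.
by apply: lb_le_inf => //; exists al.
Qed.

End Eigenset.

(** * Where the origin can lie relative to the hexagon *)

Section Hexagon.
Context (R : realType).
Implicit Types (S : set 'M[R]_2) (M P : set 'cV[R]_2) (A B : 'M[R]_2) (u v o e : 'cV[R]_2).

(* The value of the covector [(p, q)] on the affine vector field with linear part
   [[a, b], [c, d]] and zero [(X, Y)], at the point [(x, y)]. *)
Definition field_along (a b c d X Y p q x y : R) :=
  p * (a * (x - X) + b * (y - Y)) + q * (c * (x - X) + d * (y - Y)).

(* The first hypothesis is reachability of the midpoint of the edge from [(0, 1)]
   to [(2, 0)], the others are support inequalities at the vertices. The conclusion
   puts the zero [(X, Y)] in the double cone with apex [(1, 9)] over the edge. *)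
Lemma hexagon_edge (a b c d X Y : R) (F := field_along a b c d X Y) :
  0 <= F (-1) (-2) 1 (1 / 2) -> F (-1) (-2) 0 1 <= 0 -> F (-1) (-2) 2 0 <= 0 ->
  F (-1) 0 0 1 <= 0 -> F 0 (-1) 2 0 <= 0 -> F 1 1 1 9 <= 0 -> F (-1) 1 1 9 <= 0 ->
  F 0 (-1) 9 0 <= 0 -> F 1 1 8 2 <= 0 -> F (-1) 0 0 8 <= 0 ->
  ~ [/\ a = 0, b = 0, c = 0 & d = 0] ->
  0 <= (8 * X - Y + 1) * (18 - 9 * X - Y).
Proof.
rewrite /F /field_along => e0 f1 f2 g1 g2 g3 g4 g5 g6 g7 nz.
have h1 : (- a - 2 * c) * (0 - X) + (- b - 2 * d) * (1 - Y) = 0 by clear -e0 f1 f2; lra.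
have h2 : (- a - 2 * c) * (2 - X) + (- b - 2 * d) * (0 - Y) = 0 by clear -e0 f1 f2; lra.
have hz : - b - 2 * d = 2 * (- a - 2 * c) by clear -h1 h2; lra.
(* The edge normal composed with the field vanishes on the line of the edge and at [(X, Y)]. Either
   it vanishes identically, and the image of the matrix is parallel to the edge, or [(X, Y)] is on
   that line. *)
have : (- a - 2 * c) * (2 - 2 * Y - X) = 0 by move: h1; rewrite hz; clear; lra.
move=> /eqP; rewrite mulf_eq0 => /orP[]/eqP h3.
  have ea : a = - 2 * c by clear -h3; lra.
  have eb : b = - 2 * d by clear -h3 hz; lra.
  clear e0 f1 f2 g5 g6 g7 h1 h2 hz h3; subst a b.
  (* Moving [(1, 9)] parallel to the edge leaves the hexagon in either sense, so the field vanishes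
     there. The zero line of the field thus contains both [(1, 9)] and [(X, Y)]; by [k1] and [k2] it
     meets the edge. *)
  have wu : c * (1 - X) + d * (9 - Y) = 0 by clear -g3 g4; lra.
  have k1 : 0 <= c + 8 * d by clear -g1 wu; lra.
  have k2 : 0 <= c - 9 * d by clear -g2 wu; lra.
  have c0 : 0 < c.
    have [//|c0] := ltP 0 c; exfalso; apply: nz.
    have cc : c = 0 by clear -k1 k2 c0; lra.
    have dd : d = 0 by clear -k1 k2 cc; lra.
    by rewrite cc dd !mulr0.
  have l1 : c * (8 * X - Y + 1) = (c + 8 * d) * (9 - Y) by clear -wu; lra.
  have l2 : c * (18 - 9 * X - Y) = (c - 9 * d) * (9 - Y) by clear -wu; lra.
  have := mulr_ge0 (mulr_ge0 k1 k2) (sqr_ge0 (9 - Y)).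
  rewrite expr2 mulrACA -l1 -l2.
  by rewrite mulrACA pmulr_rge0 // mulr_gt0.
have hX : X = 2 - 2 * Y by clear -h3; lra.
move: h1 h2 g1 g2 g5 g6 g7; rewrite {h3 hz}hX => h1 h2 g1 g2 g5 g6 g7.
clear e0 f1 f2 g3 g4.
have k0 : 2 * a - b = - 2 * (2 * c - d) by clear -h1 h2; lra.
have k1 : 0 <= (Y - 1) * (2 * a - b) by clear -g1; lra.
have k2 : Y * (2 * a - b) <= 0 by rewrite k0; clear -g2; lra.
(* [2 * a - b] is the first coordinate of the image of the edge direction [(2, -1)]. If it is 0, the
   matrix kills this direction, and the conditions at the three vertices [(9, 0)], [(8, 2)],
   [(0, 8)] make the whole matrix 0. *)
have zero : 2 * a - b = 0 -> False.
  move=> z; apply: nz.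
  have eb : b = 2 * a by clear -z; lra.
  have ed : d = 2 * c by clear -z k0; lra.
  move: g5 g6 g7; rewrite eb ed => g5 g6 g7.
  have c0 : 0 <= c by clear -g5; lra.
  have a0 : 0 <= a by clear -g7; lra.
  have ac : a + c <= 0 by clear -g6; lra.
  have ea : a = 0 by clear -a0 c0 ac; lra.
  have ec : c = 0 by clear -a0 c0 ac; lra.
  by rewrite ea ec !mulr0.
(* On the line but off the edge, the conditions [k1] and [k2] at the two ends force [2 * a - b = 0].
   On the edge itself both factors of the conclusion are nonnegative. *)
have [Y0|Y0] := ltP Y 0.
  exfalso; apply: zero; apply/eqP; rewrite eq_le.
  rewrite -(nmulr_rle0 _ Y0) k2 andbT -(nmulr_rge0 _ (_ : Y - 1 < 0)) //.
  by clear -Y0; lra.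
have [Y1|Y1] := ltP 1 Y.
  exfalso; apply: zero; apply/eqP; rewrite eq_le.
  rewrite -(pmulr_rle0 _ (lt_trans ltr01 Y1)) k2 -(pmulr_rge0 _ (_ : 0 < Y - 1)) //.
  by rewrite subr_gt0.
by apply: mulr_ge0; clear -Y0 Y1; lra.
Qed.

(** The triangle with vertices [(0, 0)], [(10, 0)], [(0, 10)], each corner cut off after 1 unit on
    one side and 2 on the other, always in the same rotational sense. The affine map
    [(x, y) -> (10 - x - y, x)] of order three therefore permutes the vertices, and its fixed point,
    the centroid, lies outside the double cones. *)
Definition hexagon : seq (R * R) := [:: (2, 0); (9, 0); (8, 2); (1, 9); (0, 8); (0, 1)].

(* The double cones over the three edges obtained from that of [hexagon_edge] by
   the affine symmetry [(x, y) -> (10 - x - y, x)] have no common point. *)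
Lemma hexagon_no_origin (X Y : R) : 0 <= (8 * X - Y + 1) * (18 - 9 * X - Y) ->
  0 <= (8 * Y - (10 - X - Y) + 1) * (18 - 9 * Y - (10 - X - Y)) ->
  0 <= (8 * (10 - X - Y) - X + 1) * (18 - 9 * (10 - X - Y) - X) -> False.
Proof.
have sgn (x y : R) : 0 <= x * y -> (0 <= x /\ 0 <= y) \/ (x <= 0 /\ y <= 0).
  have [x0|x0] := ltP 0 x; first by rewrite pmulr_rge0 // => y0; left; split => //; exact: ltW.
  have [y0|y0] := leP y 0; first by right.
  rewrite pmulr_lge0 // => x0'; left; split=> //; exact: ltW.
by move=> /sgn[][h1 h2] /sgn[][h3 h4] /sgn[][h5 h6]; clear sgn; lra.
Qed.

Lemma mx_eq0 B : (forall v, B *m v = 0) -> B = 0.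
Proof.
move=> B0.
have h i j : B i j = (B *m \col_k (k == j)%:R) i 0.
  rewrite mxE (bigD1 j) //= mxE eqxx mulr1 big1 ?addr0 // => k /negbTE kj.
  by rewrite mxE kj mulr0.
by apply/matrixP => i j; rewrite h B0 !mxE.
Qed.

Lemma covector (e1 e2 : 'cV[R]_2) (p q : R) : det2 e1 e2 != 0 -> exists al be, forall c,
  al * (pt e1 e2 c) 0 0 + be * (pt e1 e2 c) 1 0 = p * c.1 + q * c.2.
Proof.
move=> D0; exists ((p * e2 1 0 - q * e1 1 0) / det2 e1 e2), ((q * e1 0 0 - p * e2 0 0) / det2 e1 e2).
by move=> c; rewrite !mxE /det2; field; exact: D0.
Qed.

Section EdgeCone.
Context (S : set 'M[R]_2) (M : set 'cV[R]_2) (o e1 e2 : 'cV[R]_2) (X Y : R)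
  (D0 : det2 e1 e2 != 0) (ME : M = convex_hull [set` [seq o + pt e1 e2 c | c <- hexagon]])
  (o0 : o + pt e1 e2 (X, Y) = 0)
  (sle : forall A u (p q : R), S A -> M u ->
    (forall m, M m -> p * m 0 0 + q * m 1 0 <= p * u 0 0 + q * u 1 0) ->
    p * (A *m u) 0 0 + q * (A *m u) 1 0 <= 0)
  (sge : forall u (p q : R), M u ->
    (forall m, M m -> p * m 0 0 + q * m 1 0 <= p * u 0 0 + q * u 1 0) ->
    exists2 A, S A & 0 <= p * (A *m u) 0 0 + q * (A *m u) 1 0)
  (S0 : ~ S 0).

Lemma hexagon_support (p q al be : R) c :
  (forall c, al * (pt e1 e2 c) 0 0 + be * (pt e1 e2 c) 1 0 = p * c.1 + q * c.2) ->
  (forall d, d \in hexagon -> p * d.1 + q * d.2 <= p * c.1 + q * c.2) ->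
  forall m, M m -> al * m 0 0 + be * m 1 0 <= al * (o + pt e1 e2 c) 0 0 + be * (o + pt e1 e2 c) 1 0.
Proof.
move=> cov sup m; rewrite ME => Mm.
pose C : set 'cV[R]_2 := [set m | al * m 0 0 + be * m 1 0 <=
  al * (o + pt e1 e2 c) 0 0 + be * (o + pt e1 e2 c) 1 0].
apply: (Mm C); split.
  apply/convexP => x y t; rewrite /C /= => Cx Cy t0 t1.
  have t1' : 0 <= 1 - t by rewrite subr_ge0.
  have := ler_wpM2l t0 Cy; have := ler_wpM2l t1' Cx; rewrite !mxE; lra.
move=> _ /mapP[d dh ->]; rewrite /C /=.
have := sup d dh; rewrite -!cov; move: (pt e1 e2 c) (pt e1 e2 d) => u v.
rewrite !mxE; lra.
Qed.

(** [(X, Y)] are the frame coordinates of the origin of the plane, so in the frame [A] becomes an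
    affine field with its zero there. *)
Lemma image_coord A : exists a b c d : R, (forall p q al be,
  (forall c, al * (pt e1 e2 c) 0 0 + be * (pt e1 e2 c) 1 0 = p * c.1 + q * c.2) ->
  forall x y, al * (A *m (o + pt e1 e2 (x, y))) 0 0 + be * (A *m (o + pt e1 e2 (x, y))) 1 0 =
    field_along a b c d X Y p q x y) /\
  ([/\ a = 0, b = 0, c = 0 & d = 0] -> A = 0).
Proof.
have [[a c] E1] := pt_coord (A *m e1) D0; have [[b d] E2] := pt_coord (A *m e2) D0.
have Apt x y : A *m pt e1 e2 (x, y) = pt e1 e2 (a * x + b * y, c * x + d * y).
  by rewrite /pt mulmxDr -!scalemxAr E1 E2 /pt /=; apply/matrixP => i j; rewrite !mxE; ring.
exists a, b, c, d; split=> [p q al be cov x y|[a0 b0 c0 d0]].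
  rewrite (_ : o + _ = pt e1 e2 (x - X, y - Y)); last first.
    have oE : o = - pt e1 e2 (X, Y) by apply/eqP; rewrite -addr_eq0 o0.
    rewrite oE.
    by rewrite /pt /=; apply/matrixP => i j; rewrite !mxE; ring.
  by rewrite Apt cov.
apply: mx_eq0 => v; have [[x y] ->] := pt_coord v D0.
by rewrite Apt a0 b0 c0 d0 !mul0r !addr0 /pt !scale0r addr0.
Qed.

(** The frame is arbitrary, so that composing it with the symmetry of order three yields the cones
    over the other two short edges. At the midpoint [(1, 1 / 2)] reachability supplies a matrix
    whose velocity does not point strictly inwards. *)
Lemma edge_cone : 0 <= (8 * X - Y + 1) * (18 - 9 * X - Y).
Proof.
have Mv c : c \in hexagon -> M (o + pt e1 e2 c).
  by move=> ch; rewrite ME; apply: hull_mem; apply/mapP; exists c.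
have Mmid : M (o + pt e1 e2 (1, 1 / 2)).
  rewrite (_ : o + _ = (1 - 1 / 2) *: (o + pt e1 e2 (2, 0)) + (1 / 2) *: (o + pt e1 e2 (0, 1))).
    rewrite ME; apply: hull_comb; [| |by []|]; last by lra.
      by rewrite -ME; apply: Mv; rewrite !inE eqxx.
    by rewrite -ME; apply: Mv; rewrite !inE eqxx !orbT.
  by rewrite /pt; apply/matrixP => i j; rewrite !mxE /=; field.
have [al [be cov]] := covector (-1) (-2) D0.
have [|A SA Age] := sge Mmid (hexagon_support cov _).
  by do 6 (apply: all_cons; first by rewrite /=; lra); exact: all_nil.
have [a [b [c [d [FE A0]]]]] := image_coord A.
rewrite (FE _ _ _ _ cov) in Age.
have fle p q x y : (x, y) \in hexagon ->
    (forall d, d \in hexagon -> p * d.1 + q * d.2 <= p * x + q * y) ->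
    field_along a b c d X Y p q x y <= 0.
  move=> xy sup; have [al' [be' cov']] := covector p q D0.
  by rewrite -(FE _ _ _ _ cov'); apply: sle => //; [exact: Mv | exact: hexagon_support].
have h0 : (2, 0) \in hexagon by rewrite !inE eqxx ?orbT.
have h1 : (9, 0) \in hexagon by rewrite !inE eqxx ?orbT.
have h2 : (8, 2) \in hexagon by rewrite !inE eqxx ?orbT.
have h3 : (1, 9) \in hexagon by rewrite !inE eqxx ?orbT.
have h4 : (0, 8) \in hexagon by rewrite !inE eqxx ?orbT.
have h5 : (0, 1) \in hexagon by rewrite !inE eqxx ?orbT.
apply: (hexagon_edge Age); try by apply: fle => //;
  do 6 (apply: all_cons; first by rewrite /=; lra); exact: all_nil.
by move=> /A0 A00; apply: S0; rewrite -A00.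
Qed.

End EdgeCone.

End Hexagon.

(** * No isometric copy of the hexagon is an eigenset *)

Section NonRealizable.
Context (R : realType).
Implicit Types (S : set 'M[R]_2) (M P : set 'cV[R]_2) (u v o : 'cV[R]_2).

Lemma hull_frame o (e1 e2 : 'cV[R]_2) (cs : seq (R * R)) :
  [set o + pt e1 e2 (v 0 0, v 1 0) | v in convex_hull [set` [seq vec c.1 c.2 | c <- cs]]] =
  convex_hull [set` [seq o + pt e1 e2 c | c <- cs]].
Proof.
rewrite (hull_affine (g := fun v => o + pt e1 e2 (v 0 0, v 1 0))); last first.
  by move=> u v t; rewrite /pt; apply/matrixP => i j; rewrite !mxE /=; ring.
congr convex_hull; apply/seteqP; split=> [_ [_ /mapP[[x y] ch ->] <-]|_ /mapP[[x y] ch ->]] /=.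
  by rewrite vec0 vec1; apply/mapP; exists (x, y).
exists (vec x y); last by rewrite vec0 vec1.
by apply/mapP; exists (x, y).
Qed.

Definition hexP : set 'cV[R]_2 := convex_hull [set` [seq vec c.1 c.2 | c <- hexagon R]].

(** A square inside the triangle of the vertices [(0, 1)], [(0, 8)], [(9, 0)]; it supplies an
    interior ball and three points of an orthonormal frame. The weight [s] of [(9, 0)] is read off
    from [x], and [t] then from [y]. *)
Lemma hexP_square (x y : R) : 2 <= x -> x <= 3 -> 2 <= y -> y <= 3 -> hexP (vec x y).
Proof.
move=> x2 x3 y2 y3; pose s := x / 9; pose t := (y - (1 - s)) / (7 * (1 - s)).
have s1 : 0 < 1 - s by rewrite /s; lra.
have hv c : c \in hexagon R -> hexP (vec c.1 c.2).
  by move=> ch; apply: hull_mem; apply/mapP; exists c.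
have -> : vec x y = (1 - s) *: ((1 - t) *: vec 0 1 + t *: vec 0 8) + s *: vec 9 0.
  have sn : 9 - x != 0 by rewrite lt0r_neq0 //; lra.
  by apply: col2P; rewrite !mxE /= /t /s; field.
apply: hull_comb; [apply: hull_comb| | |].
- by apply: (hv (0, 1)); rewrite !inE eqxx ?orbT.
- by apply: (hv (0, 8)); rewrite !inE eqxx ?orbT.
- by apply: ge0_div; rewrite ?mulr_gt0 //; rewrite /s; lra.
- by rewrite ler_pdivrMr ?mulr_gt0 // mul1r /s; lra.
- by apply: (hv (9, 0)); rewrite !inE eqxx ?orbT.
- by rewrite /s; lra.
- by rewrite /s; lra.
Qed.

Lemma hexP_interior o (e1 e2 : 'cV[R]_2) : det2 e1 e2 != 0 ->
  interior (convex_hull [set` [seq o + pt e1 e2 c | c <- hexagon R]]) !=set0.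
Proof.
move=> D0; exists (o + pt e1 e2 (5 / 2, 5 / 2)); apply/nbhs_ballP.
have D1 : 0 < `|det2 e1 e2| by rewrite normr_gt0.
have n1 : 0 < 4 * (`|e1| + `|e2| + 1) by rewrite mulr_gt0 // ltr_wpDl // addr_ge0.
exists (`|det2 e1 e2| / (4 * (`|e1| + `|e2| + 1))); first by rewrite /= divr_gt0.
move=> w; rewrite -ball_normE => wr.
have {}wr : `|o + pt e1 e2 (5 / 2, 5 / 2) - w| < `|det2 e1 e2| / (4 * (`|e1| + `|e2| + 1)) by [].
have [[x y] wE] := pt_coord (w - o) D0.
have {wE} wE : w = o + pt e1 e2 (x, y) by apply: pt_eq.
rewrite -hull_frame; exists (vec x y); last by rewrite vec0 vec1.
have bnd (u v : 'cV[R]_2) : `|det2 u v| <= 2 * `|u| * `|v|.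
  rewrite /det2; apply: le_trans (ler_normB _ _) _; rewrite !normrM.
  have h1 : `|u 0 0| * `|v 1 0| <= `|u| * `|v| by rewrite ler_pM // coord_le.
  have h2 : `|u 1 0| * `|v 0 0| <= `|u| * `|v| by rewrite ler_pM // coord_le.
  lra.
pose d := o + pt e1 e2 (5 / 2, 5 / 2) - w.
have dx : det2 d e2 = (5 / 2 - x) * det2 e1 e2.
  by rewrite /d wE /det2 !mxE /=; ring.
have dy : det2 e1 d = (5 / 2 - y) * det2 e1 e2.
  by rewrite /d wE /det2 !mxE /=; ring.
have small (u : 'cV[R]_2) : `|u| <= `|e1| + `|e2| -> 2 * `|d| * `|u| <= 1 / 2 * `|det2 e1 e2|.
  move=> ue; rewrite ltr_pdivlMr // in wr.
  apply: (@le_trans _ _ (2 * `|d| * (`|e1| + `|e2| + 1))).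
    by apply: ler_wpM2l; [rewrite mulr_ge0|lra].
  by move: wr; rewrite -/d; lra.
have cx : `|5 / 2 - x| <= 1 / 2.
  rewrite -(ler_pM2r D1) -normrM -dx; apply: le_trans (bnd _ _) _.
  by apply: small; rewrite lerDr.
have cy : `|5 / 2 - y| <= 1 / 2.
  rewrite -(ler_pM2r D1) -normrM -dy; apply: le_trans (bnd _ _) _.
  by rewrite mulrAC; apply: small; rewrite lerDl.
move: cx cy; rewrite !ler_norml => /andP[? ?] /andP[? ?]; apply: hexP_square; lra.
Qed.

Lemma hexP_ngon : convex_ngon 6 hexP.
Proof.
exists (fun i => vec (nth (0, 0) (hexagon R) i).1 (nth (0, 0) (hexagon R) i).2); split.
- rewrite /hexP; congr convex_hull; apply/seteqP; split=> [_ /mapP[c /(nthP (0, 0))[i ilt <-] ->]|].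
    by exists (Ordinal ilt).
  by move=> _ [i _ <-]; apply: (map_f (fun c : R * R => vec c.1 c.2)); exact: mem_nth.
- have strict (i : 'I_6) (p q k : R) :
      (forall j : 'I_6, j != i -> p * (nth (0, 0) (hexagon R) j).1 + q * (nth (0, 0) (hexagon R) j).2 <= k) ->
      k < p * (nth (0, 0) (hexagon R) i).1 + q * (nth (0, 0) (hexagon R) i).2 ->
      ~ convex_hull [set vec (nth (0, 0) (hexagon R) j).1 (nth (0, 0) (hexagon R) j).2 | j in [set j : 'I_6 | j != i]]
        (vec (nth (0, 0) (hexagon R) i).1 (nth (0, 0) (hexagon R) i).2).
    move=> hj hi Hi.
    suff : p * (nth (0, 0) (hexagon R) i).1 + q * (nth (0, 0) (hexagon R) i).2 <= k.
      by rewrite leNgt hi.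
    pose C : set 'cV[R]_2 := [set v | p * v 0 0 + q * v 1 0 <= k].
    have : C (vec (nth (0, 0) (hexagon R) i).1 (nth (0, 0) (hexagon R) i).2).
      apply: Hi; split.
        apply/convexP => u v t; rewrite /C /= => Cu Cv t0 t1.
        have t1' : 0 <= 1 - t by rewrite subr_ge0.
        have := ler_wpM2l t0 Cv; have := ler_wpM2l t1' Cu; rewrite !mxE; lra.
      by move=> _ [j /= ji <-]; rewrite /C /= vec0 vec1; exact: hj.
    by rewrite /C /= vec0 vec1.
  (* The covector at each vertex is, up to a positive factor, the sum of the normals of the two
     adjacent edges; the third number is its largest value on the other five vertices. *)
  case=> [[|[|[|[|[|[|//]]]]]] hi].
  + by apply: (strict _ (-1) (-3) (-3)) => [[[|[|[|[|[|[|//]]]]]] hj] //= _|/=]; lra.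
  + by apply: (strict _ 2 0 16) => [[[|[|[|[|[|[|//]]]]]] hj] //= _|/=]; lra.
  + by apply: (strict _ 3 2 27) => [[[|[|[|[|[|[|//]]]]]] hj] //= _|/=]; lra.
  + by apply: (strict _ 0 1 8) => [[[|[|[|[|[|[|//]]]]]] hj] //= _|/=]; lra.
  + by apply: (strict _ (-2) 1 7) => [[[|[|[|[|[|[|//]]]]]] hj] //= _|/=]; lra.
  + by apply: (strict _ (-1) (-1) (-2)) => [[[|[|[|[|[|[|//]]]]]] hj] //= _|/=]; lra.
- have D0 : det2 (vec 1 0) (vec 0 1 : 'cV[R]_2) != 0.
    by rewrite /det2 !vec0 !vec1 mulr1 mulr0 subr0 oner_eq0.
  have := hexP_interior 0 D0; rewrite -hull_frame.
  rewrite (_ : [set _ | _ in _] = hexP) //; rewrite -[RHS]image_id.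
  apply: eq_imagel => v _; apply: col2P; rewrite !mxE /=; ring.
Qed.

(** An isometry known only on [P] is affine there: by polarization [e1] and [e2] are orthonormal,
    and the distances of [f u] to the three points of the frame determine its coordinates. *)
Lemma isometry_frame P (f : 'cV[R]_2 -> 'cV[R]_2) o : P o -> P (o + vec 1 0) -> P (o + vec 0 1) ->
  (forall u v, P u -> P v -> enorm (f u - f v) = enorm (u - v)) ->
  let e1 := f (o + vec 1 0) - f o in let e2 := f (o + vec 0 1) - f o in
  det2 e1 e2 != 0 /\
  forall u, P u -> f u = f o + pt e1 e2 (u 0 0 - o 0 0, u 1 0 - o 1 0).
Proof.
move=> P0 P1 P2 iso e1 e2.
pose sq (v : 'cV[R]_2) := v 0 0 ^+ 2 + v 1 0 ^+ 2.
have sq0 v : 0 <= sq v by rewrite addr_ge0 // sqr_ge0.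
have isq u v : P u -> P v -> sq (f u - f v) = sq (u - v).
  move=> Pu Pv; have := congr1 (fun z => z ^+ 2) (iso u v Pu Pv).
  by rewrite /= !enormE !sqr_sqrtr //; exact: sq0.
have s1 : sq e1 = 1 by rewrite isq // addrAC subrr add0r /sq vec0 vec1 expr1n expr0n addr0.
have s2 : sq e2 = 1 by rewrite isq // addrAC subrr add0r /sq vec0 vec1 expr1n expr0n add0r.
have s12 : sq (e1 - e2) = 2.
  rewrite (_ : e1 - e2 = f (o + vec 1 0) - f (o + vec 0 1)); last first.
    by rewrite /e1 /e2 opprB addrA subrK.
  by rewrite isq // /sq !mxE /=; ring.
have o12 : e1 0 0 * e2 0 0 + e1 1 0 * e2 1 0 = 0.
  by move: s12 s1 s2; rewrite /sq !mxE; clear; lra.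
split.
  rewrite -sqrf_eq0 (_ : _ ^+ 2 = sq e1 * sq e2 - (e1 0 0 * e2 0 0 + e1 1 0 * e2 1 0) ^+ 2).
    by rewrite s1 s2 o12 mulr1 expr0n subr0 oner_eq0.
  by rewrite /det2 /sq; ring.
move=> u Pu; apply: pt_eq; set g := f u - f o.
pose dx := u 0 0 - o 0 0; pose dy := u 1 0 - o 1 0.
have g0 : sq g = dx ^+ 2 + dy ^+ 2 by rewrite isq // /sq !mxE.
have g1 : sq (g - e1) = (dx - 1) ^+ 2 + dy ^+ 2.
  rewrite (_ : g - e1 = f u - f (o + vec 1 0)); last by rewrite /g /e1 opprB addrA subrK.
  by rewrite isq // /sq !mxE /= /dx /dy; ring.
have g2 : sq (g - e2) = dx ^+ 2 + (dy - 1) ^+ 2.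
  rewrite (_ : g - e2 = f u - f (o + vec 0 1)); last by rewrite /g /e2 opprB addrA subrK.
  by rewrite isq // /sq !mxE /= /dx /dy; ring.
have h1 : g 0 0 * e1 0 0 + g 1 0 * e1 1 0 = dx.
  by move: g0 g1 s1; rewrite /sq !mxE; clear; lra.
have h2 : g 0 0 * e2 0 0 + g 1 0 * e2 1 0 = dy.
  by move: g0 g2 s2; rewrite /sq !mxE; clear; lra.
have : sq (g - pt e1 e2 (dx, dy)) = 0.
  transitivity (sq g + dx ^+ 2 * sq e1 + dy ^+ 2 * sq e2
     - 2 * dx * (g 0 0 * e1 0 0 + g 1 0 * e1 1 0) - 2 * dy * (g 0 0 * e2 0 0 + g 1 0 * e2 1 0)
     + 2 * dx * dy * (e1 0 0 * e2 0 0 + e1 1 0 * e2 1 0)).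
    by rewrite /sq !mxE /=; ring.
  by rewrite g0 s1 s2 h1 h2 o12; ring.
move=> /eqP; rewrite /sq paddr_eq0 ?sqr_ge0 // !sqrf_eq0 => /andP[/eqP z0 /eqP z1].
by apply/eqP; rewrite -subr_eq0; apply/eqP; apply: col2P; rewrite ?z0 ?z1 mxE.
Qed.

Lemma hexagon_rot o (e1 e2 : 'cV[R]_2) :
  convex_hull [set` [seq o + pt e1 e2 c | c <- hexagon R]] =
  convex_hull [set` [seq o + 10 *: e1 + pt (e2 - e1) (- e1) c | c <- hexagon R]].
Proof.
have E x y : o + 10 *: e1 + pt (e2 - e1) (- e1) (x, y) = o + pt e1 e2 (10 - x - y, x).
  by rewrite /pt; apply/matrixP => i j; rewrite !mxE /=; ring.
congr convex_hull.
have -> : [seq o + 10 *: e1 + pt (e2 - e1) (- e1) c | c <- hexagon R] =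
    [seq o + pt e1 e2 c | c <- rot 2 (hexagon R)].
  rewrite /hexagon /rot /= !E.
  by congr [:: _; _; _; _; _; _]; congr (_ + pt _ _ (_, _)); ring.
by apply/eq_set => v; rewrite map_rot mem_rot.
Qed.

Lemma hexagon_not_eigenset S o (e1 e2 : 'cV[R]_2) : det2 e1 e2 != 0 ->
  linear_switching_system S ->
  ~ eigenset S (convex_hull [set` [seq o + pt e1 e2 c | c <- hexagon R]]).
Proof.
move=> D0 [_ cS _ nS] [cM _ _ [al eig]].
set M := convex_hull _ in cM eig.
have stay := shift_stays eig; have reach := shift_reaches eig.
pose T := shift S (- al).
have cT : compact T.
  apply: continuous_compact cS; apply: continuous_subspaceT.
  by apply: (@lip_continuous _ _ _ _ 1) => A B; rewrite mul1r opprD addrACA subrr addr0.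
have T0 : ~ T 0.
  move=> [A SA A0]; apply: nS; have Sal : S al%:M.
    suff <- : A = al%:M by [].
    by apply/eqP; rewrite -subr_eq0 -[X in _ == X]A0 raddfN.
  by rewrite (eigenset_exponent cS cM (hexP_interior o D0) eig Sal).
have [[nX nY] XY] := pt_coord o D0; pose X := - nX; pose Y := - nY.
have o0 : o + pt e1 e2 (X, Y) = 0.
  by rewrite XY /X /Y /pt; apply/matrixP => i j; rewrite !mxE /=; ring.
have sle A u p q := @eigenset_support_le R T M (fun y ty => stay y ty) A u p q.
have sge u p q := @eigenset_support_ge R T M (fun y ty => stay y ty) reach u p q cT cM.
have cone z (f1 f2 : 'cV[R]_2) x y : det2 f1 f2 != 0 ->
    M = convex_hull [set` [seq z + pt f1 f2 c | c <- hexagon R]] -> z + pt f1 f2 (x, y) = 0 ->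
    0 <= (8 * x - y + 1) * (18 - 9 * x - y).
  by move=> d0 ME z0; exact: (edge_cone d0 ME z0 sle sge T0).
have D1 : det2 (e2 - e1) (- e1) != 0.
  by rewrite (_ : det2 _ _ = det2 e1 e2) // /det2 !mxE; ring.
have D2 : det2 (- e1 - (e2 - e1)) (- (e2 - e1)) != 0.
  by rewrite (_ : det2 _ _ = det2 e1 e2) // /det2 !mxE; ring.
apply: (@hexagon_no_origin R X Y).
- exact: cone D0 erefl o0.
- apply: (cone _ _ _ _ _ D1 (hexagon_rot _ _ _)).
  by rewrite -[RHS]o0 /pt; apply/matrixP => i j; rewrite !mxE /=; ring.
- apply: (cone _ _ _ _ _ D2); first by rewrite /M hexagon_rot hexagon_rot.
  by rewrite -[RHS]o0 /pt; apply/matrixP => i j; rewrite !mxE /=; ring.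
Qed.

Lemma hexP_not_realizable : ~ has_realizable_copy hexP.
Proof.
move=> [_ [f [<- iso]] [S [lin _ eig]]].
have sq (x y : R) := @hexP_square x y.
have P0 : hexP (vec 2 2) by apply: sq; lra.
have P1 : hexP (vec 2 2 + vec 1 0).
  rewrite (_ : _ + _ = vec 3 2); first by apply: sq; lra.
  by apply: col2P; rewrite !mxE /=; ring.
have P2 : hexP (vec 2 2 + vec 0 1).
  rewrite (_ : _ + _ = vec 2 3); first by apply: sq; lra.
  by apply: col2P; rewrite !mxE /=; ring.
have [D0 fE] := isometry_frame P0 P1 P2 iso.
move: D0 fE; set e1 := f _ - _; set e2 := f _ - _ => D0 fE.
(* The base point of the frame is where the affine extension of [f] would send the origin. *)
apply: (@hexagon_not_eigenset S (f (vec 2 2) - pt e1 e2 (2, 2)) e1 e2 D0 lin).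
rewrite -hull_frame (_ : [set _ | _ in _] = [set f v | v in hexP]) //.
apply: eq_imagel => v Pv; rewrite [RHS]fE // vec0 vec1 -addrA; congr (_ + _).
by rewrite /pt; apply/matrixP => i j; rewrite !mxE /=; ring.
Qed.

End NonRealizable.

Theorem theorem11 (R : realType) :
  (forall n : nat, n \in [:: 3; 4; 5]%N ->
     forall P : set 'cV[R]_2, convex_ngon n P -> has_realizable_copy P) /\
  (exists P : set 'cV[R]_2, convex_ngon 6 P /\ ~ has_realizable_copy P).
Proof.
split=> [n n345 P|]; first exact: small_ngon.
by exists (@hexP R); split; [exact: hexP_ngon | exact: hexP_not_realizable].
Qed.
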